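(* Let $m,n\geqslant1$ be integers, and let $\tilde w\in\mathbb{O}_2$ be equal to $\tilde w_i$ for some $1\leqslant i\leqslant 8$, where $\tilde w_1=t^{n\Lambda_1}s_2s_1$; $\tilde w_2\in\{t^{n(\Lambda_2-\Lambda_1)}s_2s_1,\ t^{n\Lambda_1}s_1s_2,\ t^{(n-1)(\Lambda_2-\Lambda_1)}s_1s_2\}$; $\tilde w_3\in\{t^{m(2\Lambda_1-\Lambda_2)+n\Lambda_1}s_1s_2,\ t^{-m(2\Lambda_1-\Lambda_2)+n(\Lambda_2-\Lambda_1)}s_2s_1\}$; $\tilde w_4=t^{m\Lambda_2+(n-1)(\Lambda_2-\Lambda_1)}s_1s_2$; $\tilde w_5=t^{m\Lambda_2+(n-1)\Lambda_1}s_2s_1$; $\tilde w_6=t^{m(2\Lambda_1-\Lambda_2)+n\Lambda_1}s_2s_1$; $\tilde w_7\in\{t^{m\Lambda_2+n\Lambda_1}s_1s_2,\ t^{m\Lambda_2+n(\Lambda_2-\Lambda_1)}s_2s_1\}$; $\tilde w_8=t^{(1-m)(2\Lambda_1-\Lambda_2)+n(\Lambda_2-\Lambda_1)}s_1s_2$. Then for every conjugacy class $\mathbb{O}$ of $\widetilde W$, $$\deg(f_{\tilde w,\mathbb{O}})=\begin{cases}2,&\mathbb{O}\in\{\mathbb{O}_\lambda\mid\lambda\in\lambda(\tilde w)\},\\1,&\mathbb{O}\in\mathbb{O}^<_{\tilde w},\\0,&\mathbb{O}=\mathbb{O}_2,\\-\infty,&\text{otherwise},\end{cases}$$ where $$\lambda(\tilde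 w)=\begin{cases}\Lambda^<_{n\Lambda_1},&\tilde w=\tilde w_1,\\ \Lambda^<_{(n-1)\Lambda_1},&\tilde w=\tilde w_2,\\ \Lambda^{\leqslant}_{m\Lambda_2+(n-1)\Lambda_1},&\tilde w=\tilde w_3\text{ or }\tilde w_7,\\ \Lambda^{\leqslant}_{(m-1)\Lambda_2+n\Lambda_1},&\tilde w=\tilde w_4\text{ or }\tilde w_8,\\ \Lambda^{\leqslant}_{m\Lambda_2+(n-2)\Lambda_1},&\tilde w=\tilde w_5,\\ \Lambda^{\leqslant}_{(m+1)\Lambda_2+(n-2)\Lambda_1},&\tilde w=\tilde w_6,\end{cases}$$ and $\mathbb{O}^<_{\tilde w}=\{\mathbb{O}_{4i+1}\mid1\leqslant i\leqslant n(\tilde w)\}\cup\{\mathbb{O}'_{6i+3}\mid0\leqslant i\leqslant n'(\tilde w)\}\cup\{\mathbb{O}'_{6i+1}\mid1\leqslant i\leqslant n''(\tilde w)\}$ with $$n(\tilde w)=\begin{cases}n-1,&\tilde w=\tilde w_1\text{ or }\tilde w_2,\\ m+n-1,&\tilde w\in\{\tilde w_3,\tilde w_4,\tilde w_6,\tilde w_7,\tilde w_8\},\\ m+n-2,&\tilde w=\tilde w_5,\end{cases}$$ $$n'(\tilde w)=\begin{cases}\lfloor\frac{n-1}{2}\rfloor,&\tilde w=\tilde w_1,\\ \lfloor\frac n2\rfloor-1,&\tilde w=\tilde w_2,\\ m+\lfloor\frac n2\rfloor-1,&\tilde w=\tilde w_3\text{ or }\tilde w_7,\\ m+\lfloor\frac{n-1}2\rfloor-1,&\tilde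 w\in\{\tilde w_4,\tilde w_5,\tilde w_8\},\\ m+\lfloor\frac{n-1}2\rfloor,&\tilde w=\tilde w_6,\end{cases}$$ $$n''(\tilde w)=\begin{cases}\lfloor\frac n2\rfloor,&\tilde w=\tilde w_1,\\ \lfloor\frac{n-1}2\rfloor,&\tilde w=\tilde w_2,\\ m+\lfloor\frac{n-1}2\rfloor,&\tilde w=\tilde w_3\text{ or }\tilde w_7,\\ m+\lfloor\frac n2\rfloor-1,&\tilde w\in\{\tilde w_4,\tilde w_5,\tilde w_8\},\\ m+\lfloor\frac n2\rfloor,&\tilde w=\tilde w_6.\end{cases}$$
   Context: Type $C_2$ data: simple roots $\alpha_1=(1,-1)$, $\alpha_2=(0,2)$ in $\mathbb{R}^2$; $\epsilon_1=(1,0)$, $\epsilon_2=(\frac12,\frac12)$, $\Lambda_1=\epsilon_1$, $\Lambda_2=2\epsilon_2$; $P=\mathbb{Z}\epsilon_1\oplus\mathbb{Z}\epsilon_2$, $Q=\mathbb{Z}\Lambda_1\oplus\mathbb{Z}\Lambda_2$. $W=\langle s_1,s_2\rangle$ is the Weyl group (dihedral of order 8): $s_1(\Lambda_1)=\Lambda_2-\Lambda_1$, $s_1(\Lambda_2)=\Lambda_2$, $s_2(\Lambda_1)=\Lambda_1$, $s_2(\Lambda_2)=2\Lambda_1-\Lambda_2$. $\widetilde W=P\rtimes W$, with $t^\lambda$ the translation by $\lambda$. $W_a=Q\rtimes W$ is the Coxeter group generated by $\widetilde{\mathbb{S}}=\{s_0,s_1,s_2\}$, $s_0=t^{\Lambda_1}s_1s_2s_1$.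 $\tau=t^{\epsilon_2}s_2s_1s_2$ satisfies $\tau^2=1$, $\tau s_0\tau^{-1}=s_2$, $\tau s_1\tau^{-1}=s_1$, and $\widetilde W=W_a\rtimes\{1,\tau\}$. $\ell$ is the Coxeter length on $W_a$, extended by $\ell(x\tau)=\ell(x)$. $\mathbb{N}=\{0,1,2,\dots\}$. Class polynomials: $A=\mathbb{Z}[v,v^{-1}]$; $\widetilde H$ is the associative $A$-algebra with basis $T_{\tilde w}$ ($\tilde w\in\widetilde W$) and relations $T_{\tilde x}T_{\tilde y}=T_{\tilde x\tilde y}$ if $\ell(\tilde x)+\ell(\tilde y)=\ell(\tilde x\tilde y)$, $(T_s-v)(T_s+v^{-1})=0$ for $s\in\widetilde{\mathbb{S}}$. $[\widetilde H,\widetilde H]$ is the $A$-submodule generated by all $hh'-h'h$. For a conjugacy class $\mathbb{O}$ of $\widetilde W$, $T_{\mathbb{O}}$ denotes the image in $\widetilde H/[\widetilde H,\widetilde H]$ of $T_x$ for any minimal length element $x\in\mathbb{O}$ (independent of the choice); the $T_{\mathbb{O}}$ form an $A$-basis of $\widetilde H/[\widetilde H,\widetilde H]$ (He–Nie). The class polynomials $f_{\tilde w,\mathbb{O}}\in A$ are defined by $T_{\tilde w}\equiv\sum_{\mathbb{O}}f_{\tilde w,\mathbb{O}}T_{\mathbb{O}}$ modulo $[\widetilde H,\widetilde H]$; they are polynomials in $v-v^{-1}$, $\deg$ is the degree in $v-v^{-1}$, and $\deg 0=-\infty$. Conjugacy classes of $\widetilde W$ (for $k\in\mathbb{N}$,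 $\lambda\in Q_+=\{a\Lambda_1+b\Lambda_2\mid a,b\in\mathbb{N}\}$): $\mathbb{O}_2=\{t^\lambda s_1s_2,\ t^\lambda s_2s_1\mid\lambda\in Q\}$; $\mathbb{O}_\lambda=\{t^{w(\lambda)}\mid w\in W\}$; $\mathbb{O}_{4k+1}=\{t^{\pm k(\Lambda_2-\Lambda_1)+m'\Lambda_1}s_1s_2s_1,\ t^{\pm k\Lambda_1+m'(\Lambda_2-\Lambda_1)}s_2\mid m'\in\mathbb{Z}\}$; $\mathbb{O}'_{6k+1}=\{t^{\pm k\Lambda_2+m'(2\Lambda_1-\Lambda_2)}s_1,\ t^{\pm k(2\Lambda_1-\Lambda_2)+m'\Lambda_2}s_2s_1s_2\mid m'\in\mathbb{Z}\}$; $\mathbb{O}'_{6k+3}=\{t^{\pm(k\Lambda_2+\Lambda_1)+m'(2\Lambda_1-\Lambda_2)}s_1,\ t^{\pm(k(2\Lambda_1-\Lambda_2)+\Lambda_1)+m'\Lambda_2}s_2s_1s_2\mid m'\in\mathbb{Z}\}$. Sets of coweights: $Q_{++}=\{a\Lambda_1+b\Lambda_2\mid a,b\in\mathbb{Z},\ a,b\geqslant1\}$. For $\lambda=a\Lambda_1+b\Lambda_2$ with $a,b\in\mathbb{Z}$, $\diamondsuit_\lambda$ is the convex hull of $0,\ (\frac a2+b)\Lambda_2,\ (a+b)\Lambda_1,\ \lambda$; $\Lambda^{\leqslant}_\lambda=Q_{++}\cap\diamondsuit_\lambda$ and $\Lambda^<_\lambda=\Lambda^{\leqslant}_\lambda\setminus\{\lambda\}$.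 *)

(* Defs.v *)
From HB Require Import structures.
From mathcomp Require Import all_boot all_order all_algebra.
From mathcomp Require Import fraction ring.
From mathcomp Require Import mathcomp_extra boolp classical_sets functions.
From mathcomp Require Import cardinality fsbigop reals.

Set Implicit Arguments.
Unset Strict Implicit.
Unset Printing Implicit Defensive.

Import Order.TTheory GRing.Theory Num.Theory.

Local Open Scope classical_set_scope.
Local Open Scope ring_scope.

(* A = Z[v, v^-1] as the subring of Q(v) of the elements p / v^k. *)

Definition laurent_pred : {pred {fraction {poly int}}} :=
  fun x => `[< exists (p : {poly int}) (k : nat), x * (tofrac 'X) ^+ k = tofrac p >].

Fact laurent_subring : subring_closed laurent_pred.
Proof.
split.
- by apply/asboolP; exists 1, 0%N; rewrite expr0 mulr1 tofrac1.
- move=> x y /asboolP[p [k hp]] /asboolP[q [l hq]]; apply/asboolP.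
  exists (p * 'X^l - q * 'X^k), (k + l)%N.
  rewrite tofracB !tofracM !tofracXn -hp -hq exprD mulrBl !mulrA; congr (_ - _).
  by rewrite -mulrA [_ ^+ k * _]mulrC mulrA.
- move=> x y /asboolP[p [k hp]] /asboolP[q [l hq]]; apply/asboolP.
  by exists (p * q), (k + l)%N; rewrite tofracM -hp -hq exprD mulrACA.
Qed.

HB.instance Definition _ :=
  GRing.isSubringClosed.Build {fraction {poly int}} laurent_pred
    laurent_subring.

Record laurent := Laurent {
  laurent_val : {fraction {poly int}};
  laurent_valP : laurent_val \in laurent_pred }.

HB.instance Definition _ := [isSub for laurent_val].
HB.instance Definition _ := [Choice of laurent by <:].
HB.instance Definition _ := [SubChoice_isSubComNzRing of laurent by <:].

Fact v_subproof : (tofrac 'X : {fraction {poly int}}) \in laurent_pred.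
Proof. by apply/asboolP; exists 'X, 0%N; rewrite expr0 mulr1. Qed.
Definition v : laurent := Laurent v_subproof.

Fact v_inv_subproof : ((tofrac 'X)^-1 : {fraction {poly int}}) \in laurent_pred.
Proof.
apply/asboolP; exists 1, 1%N.
by rewrite expr1 mulVf ?tofrac1// tofrac_eq0 polyX_eq0.
Qed.
Definition v_inv : laurent := Laurent v_inv_subproof.

(* The degree in v - v^-1; None stands for -oo, the degree of 0.  As v - v^-1
   is transcendental over Z, there is at most one such d. *)
Definition has_degree (a : laurent) (d : option nat) : Prop :=
  exists p : {poly int},
    a = (map_poly intr p).[v - v_inv] /\
    d = (if p == 0 then None else Some (size p).-1).

(* An element of P is given by its coordinates in the basis
   (epsilon_1, epsilon_2). *)
Definition coweight : Type := (int * int)%type.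
Definition eps1 : coweight := (1, 0).
Definition eps2 : coweight := (0, 1).
Definition Lam1 : coweight := eps1.
Definition Lam2 : coweight := eps2 *+ 2.

(* An endomorphism of P is given by the images of epsilon_1 and epsilon_2. *)
Definition endoP : Type := (coweight * coweight)%type.
Definition endo_act (g : endoP) (l : coweight) : coweight :=
  (g.1.1 * l.1 + g.2.1 * l.2, g.1.2 * l.1 + g.2.2 * l.2).
Definition endo_id : endoP := (eps1, eps2).
Definition endo_comp (g h : endoP) : endoP := (endo_act g h.1, endo_act g h.2).

(* s_1(Lambda_1) = Lambda_2 - Lambda_1 and s_1(Lambda_2) = Lambda_2. *)
Definition refl1 : endoP := (Lam2 - Lam1, eps2).
(* s_2(Lambda_1) = Lambda_1 and s_2(Lambda_2) = 2 Lambda_1 - Lambda_2, that is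
   s_2(epsilon_2) = epsilon_1 - epsilon_2. *)
Definition refl2 : endoP := (Lam1, eps1 - eps2).

(* The dihedral group <s_1, s_2> of order 8, listed by reduced words. *)
Definition weyl_elements : seq endoP :=
  [:: endo_id; refl1; refl2; endo_comp refl1 refl2; endo_comp refl2 refl1;
      endo_comp refl1 (endo_comp refl2 refl1);
      endo_comp refl2 (endo_comp refl1 refl2);
      endo_comp refl1 (endo_comp refl2 (endo_comp refl1 refl2))].

Record weyl := Weyl {
  weyl_val : endoP;
  weyl_valP : weyl_val \in weyl_elements }.

HB.instance Definition _ := [isSub for weyl_val].
HB.instance Definition _ := [Choice of weyl by <:].

(* The inverse matrix of g when its determinant is 1 or -1. *)
Definition endo_inv (g : endoP) : endoP :=
  let d := g.1.1 * g.2.2 - g.2.1 * g.1.2 in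
  ((d * g.2.2, - (d * g.1.2)), (- (d * g.2.1), d * g.1.1)).

Fact weyl_id_subproof : endo_id \in weyl_elements.
Proof. by []. Qed.

Fact weyl_comp_subproof (g h : weyl) :
  endo_comp (weyl_val g) (weyl_val h) \in weyl_elements.
Proof.
have : all (fun x => all (fun y => endo_comp x y \in weyl_elements)
  weyl_elements) weyl_elements by vm_compute.
by move=> /allP/(_ _ (weyl_valP g))/allP/(_ _ (weyl_valP h)).
Qed.

Fact weyl_inv_subproof (g : weyl) : endo_inv (weyl_val g) \in weyl_elements.
Proof.
have : all (fun x => endo_inv x \in weyl_elements) weyl_elements by vm_compute.
by move=> /allP/(_ _ (weyl_valP g)).
Qed.

Definition weyl_one : weyl := Weyl weyl_id_subproof.
Definition weyl_mul (g h : weyl) : weyl := Weyl (weyl_comp_subproof g h).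
Definition weyl_inv (g : weyl) : weyl := Weyl (weyl_inv_subproof g).

Fact endo_actD (g : endoP) (k l : coweight) :
  endo_act g (k + l) = endo_act g k + endo_act g l.
Proof. by congr pair => /=; ring. Qed.

Fact endo_act_id (l : coweight) : endo_act endo_id l = l.
Proof.
by rewrite /endo_act /= !mul1r !mul0r addr0 add0r -surjective_pairing.
Qed.

Fact endo_act_comp (g h : endoP) (l : coweight) :
  endo_act (endo_comp g h) l = endo_act g (endo_act h l).
Proof. by congr pair => /=; ring. Qed.

Fact weyl_mulA : associative weyl_mul.
Proof.
move=> g h k; apply: val_inj.
by congr pair; rewrite /= -endo_act_comp.
Qed.

Fact weyl_mul1g : left_id weyl_one weyl_mul.
Proof.
move=> g; apply: val_inj => /=.
by rewrite /endo_comp !endo_act_id -surjective_pairing.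
Qed.

Fact weyl_mulg1 : right_id weyl_one weyl_mul.
Proof.
move=> [[[a b] [c d]] hg]; apply: val_inj => /=.
by congr (pair (pair _ _) (pair _ _)); rewrite /= !mulr0 !mulr1 ?addr0 ?add0r.
Qed.

Fact weyl_mulVg : left_inverse weyl_one weyl_inv weyl_mul.
Proof.
move=> g; apply: val_inj => /=; apply/eqP.
have : all (fun x => endo_comp (endo_inv x) x == endo_id) weyl_elements
  by vm_compute.
by move=> /allP/(_ _ (weyl_valP g)).
Qed.

Fact weyl_mulgV : right_inverse weyl_one weyl_inv weyl_mul.
Proof.
move=> g; apply: val_inj => /=; apply/eqP.
have : all (fun x => endo_comp x (endo_inv x) == endo_id) weyl_elements
  by vm_compute.
by move=> /allP/(_ _ (weyl_valP g)).
Qed.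

HB.instance Definition _ :=
  isGroup.Build weyl weyl_mulA weyl_mul1g weyl_mulg1 weyl_mulVg weyl_mulgV.

Definition weyl_act (g : weyl) (l : coweight) : coweight :=
  endo_act (weyl_val g) l.

(* The extended affine Weyl group P ><| W; (l, g) stands for t^l g. *)
Record extended := Extended { transl : coweight; linpart : weyl }.

Fact extendedK :
  cancel (fun x => (transl x, linpart x)) (fun p => Extended p.1 p.2).
Proof. by case. Qed.
HB.instance Definition _ := Choice.copy extended (can_type extendedK).

Definition ext_one : extended := Extended 0 1%g.
Definition ext_mul (x y : extended) : extended :=
  Extended (transl x + weyl_act (linpart x) (transl y))
           (linpart x * linpart y)%g.
Definition ext_inv (x : extended) : extended :=
  Extended (- weyl_act (linpart x)^-1%g (transl x)) (linpart x)^-1%g.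

Fact weyl_act1 (l : coweight) : weyl_act 1%g l = l.
Proof. exact: endo_act_id. Qed.

Fact weyl_actM (g h : weyl) (l : coweight) :
  weyl_act (g * h)%g l = weyl_act g (weyl_act h l).
Proof. exact: endo_act_comp. Qed.

Fact weyl_actD (g : weyl) (k l : coweight) :
  weyl_act g (k + l) = weyl_act g k + weyl_act g l.
Proof. exact: endo_actD. Qed.

Fact weyl_act0 (g : weyl) : weyl_act g 0 = 0.
Proof. by apply: (addrI (weyl_act g 0)); rewrite -weyl_actD !addr0. Qed.

Fact weyl_actN (g : weyl) (l : coweight) : weyl_act g (- l) = - weyl_act g l.
Proof. by apply: (addrI (weyl_act g l)); rewrite -weyl_actD !subrr weyl_act0. Qed.

Fact ext_mulA : associative ext_mul.
Proof.
by move=> x y z; congr Extended; rewrite /= ?weyl_actD ?weyl_actM ?addrA ?mulgA.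
Qed.

Fact ext_mul1g : left_id ext_one ext_mul.
Proof.
by case=> l g; congr Extended; rewrite /= ?weyl_act1 ?add0r ?mul1g.
Qed.

Fact ext_mulg1 : right_id ext_one ext_mul.
Proof.
by case=> l g; congr Extended; rewrite /= ?weyl_act0 ?addr0 ?mulg1.
Qed.

Fact ext_mulVg : left_inverse ext_one ext_inv ext_mul.
Proof.
by case=> l g; congr Extended; rewrite /= ?addNr ?mulVg.
Qed.

Fact ext_mulgV : right_inverse ext_one ext_inv ext_mul.
Proof.
by case=> l g; congr Extended;
  rewrite /= ?weyl_actN -?weyl_actM ?mulgV ?weyl_act1 ?subrr.
Qed.

HB.instance Definition _ :=
  isGroup.Build extended ext_mulA ext_mul1g ext_mulg1 ext_mulVg ext_mulgV.

Definition t (l : coweight) : extended := Extended l 1%g.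
Definition s1 : extended :=
  Extended 0 (Weyl (isT : refl1 \in weyl_elements)).
Definition s2 : extended :=
  Extended 0 (Weyl (isT : refl2 \in weyl_elements)).
Definition s0 : extended := (t Lam1 * s1 * s2 * s1)%g.
Definition tau : extended := (t eps2 * s2 * s1 * s2)%g.

Definition simple_reflections : seq extended := [:: s0; s1; s2].

(* Every element of the extended group is x * tau ^+ e for a unique x in W_a
   and e : bool; such an element has the Coxeter length of x. *)
Definition has_word (w : extended) : set nat :=
  [set k | exists (l : seq extended) (e : bool),
     [/\ size l = k, {subset l <= simple_reflections} &
         w = (\prod_(x <- l) x * tau ^+ e)%g]].

Definition len (w : extended) : nat :=
  xget 0%N [set k | has_word w k /\ forall j, has_word w j -> (k <= j)%N].

Definition conj_class (x : extended) : set extended :=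
  [set (x ^ y)%g | y in [set: extended]].

Definition conj_classes : set (set extended) :=
  [set conj_class x | x in [set: extended]].

Definition min_length (O : set extended) : set extended :=
  [set x | O x /\ forall y, O y -> (len x <= len y)%N].

Definition is_hecke_algebra (H : algType laurent) (T : extended -> H) : Prop :=
  [/\ forall h : H, exists! c : extended -> laurent,
        finite_set [set w | c w != 0] /\
        h = \sum_(w \in [set: extended]) (c w *: T w),
      forall x y : extended, (len x + len y)%N = len (x * y)%g ->
        T x * T y = T (x * y)%g &
      forall s : extended, s \in simple_reflections ->
        (T s - v%:A) * (T s + v_inv%:A) = 0].

Definition commutator_submodule (H : algType laurent) : set H :=
  [set h | exists r : seq (laurent * (H * H)),
     h = \sum_(q <- r) q.1 *: (q.2.1 * q.2.2 - q.2.2 * q.2.1)].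

(* f sends a conjugacy class O to f_{w,O}; T_O is represented by T (x O), where
   x is any choice of minimal length elements.  As f is extended by 0 outside
   of the conjugacy classes, such an f is unique. *)
Definition class_polynomials (H : algType laurent) (T : extended -> H)
    (w : extended) (f : set extended -> laurent) : Prop :=
  [/\ [set O | f O != 0] `<=` conj_classes,
      finite_set [set O | f O != 0] &
      forall x : set extended -> extended,
        (forall O, conj_classes O -> min_length O (x O)) ->
        commutator_submodule
          (T w - \sum_(O \in conj_classes) (f O *: T (x O)))].

Definition latticeQ : set coweight :=
  [set Lam1 *~ a + Lam2 *~ b | a in [set: int] & b in [set: int]].

Definition classO2 : set extended :=
  [set (t l * s1 * s2)%g | l in latticeQ] `|`
  [set (t l * s2 * s1)%g | l in latticeQ].

Definition classO_coweight (l : coweight) : set extended :=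
  [set t (weyl_act g l) | g in [set: weyl]].

Definition pm (l : coweight) : set coweight := [set l; - l].

(* The three families below are O_{4k+1}, O'_{6k+1} and O'_{6k+3}. *)
Definition classO4_1 (k : nat) : set extended :=
  [set (t (l + Lam1 *~ m') * s1 * s2 * s1)%g |
     l in pm ((Lam2 - Lam1) *+ k) & m' in [set: int]] `|`
  [set (t (l + (Lam2 - Lam1) *~ m') * s2)%g |
     l in pm (Lam1 *+ k) & m' in [set: int]].

Definition classO6_1 (k : nat) : set extended :=
  [set (t (l + (Lam1 *+ 2 - Lam2) *~ m') * s1)%g |
     l in pm (Lam2 *+ k) & m' in [set: int]] `|`
  [set (t (l + Lam2 *~ m') * s2 * s1 * s2)%g |
     l in pm ((Lam1 *+ 2 - Lam2) *+ k) & m' in [set: int]].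

Definition classO6_3 (k : nat) : set extended :=
  [set (t (l + (Lam1 *+ 2 - Lam2) *~ m') * s1)%g |
     l in pm (Lam2 *+ k + Lam1) & m' in [set: int]] `|`
  [set (t (l + Lam2 *~ m') * s2 * s1 * s2)%g |
     l in pm ((Lam1 *+ 2 - Lam2) *+ k + Lam1) & m' in [set: int]].

Section Diamond.
Variable R : realType.

Definition convex_hull (V : lmodType R) (s : seq V) : set V :=
  [set x | exists c : 'I_(size s) -> R,
     [/\ forall j, 0 <= c j, \sum_j c j = 1 & x = \sum_j c j *: s`_j]].

(* The inclusion of P in R^2, where epsilon_1 = (1, 0) and
   epsilon_2 = (1/2, 1/2). *)
Definition to_plane (l : coweight) : R^o * R^o :=
  (l.1%:~R + l.2%:~R / 2, l.2%:~R / 2).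

(* diamond a b is attached to the coweight a Lambda_1 + b Lambda_2. *)
Definition diamond (a b : int) : set (R^o * R^o)%type :=
  convex_hull
    [:: 0; (a%:~R / 2 + b%:~R) *: to_plane Lam2;
        (a + b)%:~R *: to_plane Lam1; to_plane (Lam1 *~ a + Lam2 *~ b)].

Definition Qpp : set coweight :=
  [set Lam1 *~ a + Lam2 *~ b | a in [set a : int | 1 <= a] &
                               b in [set b : int | 1 <= b]].

Definition Lambda_le (a b : int) : set coweight :=
  Qpp `&` to_plane @^-1` diamond a b.
Definition Lambda_lt (a b : int) : set coweight :=
  Lambda_le a b `\ (Lam1 *~ a + Lam2 *~ b).

End Diamond.

Definition w_tilde (i : nat) (m n : int) : seq extended :=
  match i with
  | 1 => [:: (t (Lam1 *~ n) * s2 * s1)%g]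
  | 2 => [:: (t ((Lam2 - Lam1) *~ n) * s2 * s1)%g;
             (t (Lam1 *~ n) * s1 * s2)%g;
             (t ((Lam2 - Lam1) *~ (n - 1)) * s1 * s2)%g]
  | 3 => [:: (t ((Lam1 *+ 2 - Lam2) *~ m + Lam1 *~ n) * s1 * s2)%g;
             (t (- ((Lam1 *+ 2 - Lam2) *~ m) + (Lam2 - Lam1) *~ n)
                * s2 * s1)%g]
  | 4 => [:: (t (Lam2 *~ m + (Lam2 - Lam1) *~ (n - 1)) * s1 * s2)%g]
  | 5 => [:: (t (Lam2 *~ m + Lam1 *~ (n - 1)) * s2 * s1)%g]
  | 6 => [:: (t ((Lam1 *+ 2 - Lam2) *~ m + Lam1 *~ n) * s2 * s1)%g]
  | 7 => [:: (t (Lam2 *~ m + Lam1 *~ n) * s1 * s2)%g;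
             (t (Lam2 *~ m + (Lam2 - Lam1) *~ n) * s2 * s1)%g]
  | 8 => [:: (t ((Lam1 *+ 2 - Lam2) *~ (1 - m) + (Lam2 - Lam1) *~ n)
                * s1 * s2)%g]
  | _ => [::]
  end.

Definition lambda_set (R : realType) (i : nat) (m n : int) : set coweight :=
  match i with
  | 1 => Lambda_lt R n 0
  | 2 => Lambda_lt R (n - 1) 0
  | 3 | 7 => Lambda_le R (n - 1) m
  | 4 | 8 => Lambda_le R n (m - 1)
  | 5 => Lambda_le R (n - 2) m
  | 6 => Lambda_le R (n - 2) (m + 1)
  | _ => set0
  end.

(* bound4_1, bound6_3 and bound6_1 are n, n' and n'' of w~_i. *)
Definition bound4_1 (i : nat) (m n : int) : int :=
  match i with
  | 1 | 2 => n - 1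
  | 5 => m + n - 2
  | _ => m + n - 1
  end.

Definition bound6_3 (i : nat) (m n : int) : int :=
  match i with
  | 1 => ((n - 1) %/ 2)%Z
  | 2 => (n %/ 2)%Z - 1
  | 3 | 7 => m + (n %/ 2)%Z - 1
  | 6 => m + ((n - 1) %/ 2)%Z
  | _ => m + ((n - 1) %/ 2)%Z - 1
  end.

Definition bound6_1 (i : nat) (m n : int) : int :=
  match i with
  | 1 => (n %/ 2)%Z
  | 2 => ((n - 1) %/ 2)%Z
  | 3 | 7 => m + ((n - 1) %/ 2)%Z
  | 6 => m + (n %/ 2)%Z
  | _ => m + (n %/ 2)%Z - 1
  end.

Definition degree2_classes (R : realType) (i : nat) (m n : int) :
    set (set extended) :=
  [set classO_coweight l | l in lambda_set R i m n].

Definition degree1_classes (i : nat) (m n : int) : set (set extended) :=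
  [set classO4_1 k | k in [set k : nat | 1 <= k%:Z <= bound4_1 i m n]] `|`
  [set classO6_3 k | k in [set k : nat | k%:Z <= bound6_3 i m n]] `|`
  [set classO6_1 k | k in [set k : nat | 1 <= k%:Z <= bound6_1 i m n]].

Definition expected_degree (R : realType) (i : nat) (m n : int)
    (O : set extended) : option nat :=
  if O \in degree2_classes R i m n then Some 2%N
  else if O \in degree1_classes i m n then Some 1%N
  else if O == classO2 then Some 0%N
  else None.

(* Main.v *)
Require Import Defs.
From HB Require Import structures.
From Stdlib Require Import ZArith Lia.
From mathcomp Require Import all_boot all_order all_algebra.
From mathcomp Require Import fraction ring lra ssrZ zify.
From mathcomp Require Import boolp classical_sets functions.
From mathcomp Require Import cardinality fsbigop reals.

Set Implicit Arguments.
Unset Strict Implicit.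

Import Order.TTheory GRing.Theory Num.Theory.

Local Open Scope classical_set_scope.
Local Open Scope ring_scope.
Local Arguments Z.add : simpl never.
Local Arguments Z.sub : simpl never.
Local Arguments Z.mul : simpl never.
Local Arguments Z.opp : simpl never.
Local Arguments Z.abs : simpl never.
Local Arguments Z.max : simpl never.
Local Arguments Z.min : simpl never.
Local Arguments Z.div : simpl never.
Local Arguments Z.modulo : simpl never.

(** Put q = v - v^-1.  Modulo commutators T_(ab) and T_(ba) agree as soon as
    both products are length additive; in particular conjugation by a simple
    reflection s that preserves the length does not change the image of T_x in
    the cocenter, while T_x = T_(sxs) + q T_(sx) when sxs is shorter than x by
    two.  All the expansions below are obtained by iterating these two moves.

    Let O'(2k) = O'_(6k+1) and O'(2k+1) = O'_(6k+3), and write coweights in the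
    orthonormal coordinates (X, Y) of the plane.  Each w~_i is congruent to
      T_(O_2) + q sum_(1 <= k <= N) T_(O_(4k+1)) + q sum_(1 <= k <= D) T_(O'(k))
        + q^2 sum T_(O_(X, Y)),
    where the last sum is over 1 <= Y < X <= N with X + Y <= D, for some
    integers N and D depending on w~_i ([expansion], [expands_w_tilde]).  The
    reason is that, by length preserving moves and possibly an inversion, the
    w~_i can be brought to one of the two shapes [cox21 N D] and [cox12 N D] with
    N <= D <= 2N + 1.  If N < D, a descent lowers D by one and
    splits off a reflection of the class O'(D); this reflection descends in turn
    along the line X + Y = D and contributes the translations on this line with
    X <= N.  If N = D, a descent lowers N by one and splits off a reflection of
    minimal length of the class O_(4N+1).  This is [reduces_coxeter].  As only
    sums of powers of q occur, nothing cancels, and the degree of f_(w,O) is read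
    off the exponent with which O occurs.  Finally the inequalities on (X, Y) are
    those which cut out the points of Q_++ in the relevant diamond
    ([lambda_setE]).

    That the class polynomials are well defined has two sides.  Any two elements
    of minimal length in one of the classes above have congruent T_x
    ([minimal_rep]).  And the T_O, for O ranging over all conjugacy classes of
    the extended group, are linearly independent in the cocenter
    ([cocenter_independent]).  For the latter, the Hecke algebra acts on finite
    free A-modules whose bases are finite quotients of the set of alcoves, or of
    the set of their faces, oriented from infinity, and on a few modules of the
    finite Hecke algebra of W.  A group of translations acts on the basis and
    commutes with H, so traces twisted by a translation vanish on commutators.
    At v = 1 these traces count twisted fixed points,
    which is enough to separate the conjugacy classes ([separation]).  Hence in a
    linear relation between the T_O all coefficients vanish at v = 1; as A is a
    domain one may divide by v - 1 and start again ([specialization_argument]). *)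

(** * The extended affine Weyl group in integer coordinates *)
Delimit Scope Z_scope with ZZ.

(** The eight elements of W, by reduced words: [R12] is s_1 s_2.  Coordinates
    in Z and an enumeration of W turn every statement about lengths into
    linear arithmetic with absolute values. *)
Variant dihedral := Id | R1 | R2 | R12 | R21 | R121 | R212 | R1212.

Definition dih_mul1 (u : dihedral) : dihedral :=
  match u with
  | Id => R1 | R1 => Id | R2 => R12 | R12 => R2
  | R21 => R121 | R121 => R21 | R212 => R1212 | R1212 => R212
  end.

Definition dih_mul2 (u : dihedral) : dihedral :=
  match u with
  | Id => R2 | R2 => Id | R1 => R21 | R21 => R1
  | R12 => R212 | R212 => R12 | R121 => R1212 | R1212 => R121
  end.

(** Evaluates the word of u at two given involutions; multiplication in W and
    the action of W on the coweights are both instances. *)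
Definition dih_fold {T : Type} (f1 f2 : T -> T) (u : dihedral) (x : T) : T :=
  match u with
  | Id => x | R1 => f1 x | R2 => f2 x | R12 => f1 (f2 x) | R21 => f2 (f1 x)
  | R121 => f1 (f2 (f1 x)) | R212 => f2 (f1 (f2 x))
  | R1212 => f1 (f2 (f1 (f2 x)))
  end.

Definition dih_mul : dihedral -> dihedral -> dihedral := dih_fold dih_mul1 dih_mul2.

Definition dih_inv (u : dihedral) : dihedral :=
  match u with R12 => R21 | R21 => R12 | u => u end.

Definition dih_act (u : dihedral) : Z * Z -> Z * Z :=
  dih_fold (fun l => (- l.1, 2 * l.1 + l.2)%ZZ) (fun l => (l.1 + l.2, - l.2)%ZZ) u.

(** [Aff x y u] stands for t^(x epsilon_1 + y epsilon_2) u. *)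
Record affine := Aff { ax : Z; ay : Z; adir : dihedral }.

Definition aff_one := Aff 0 0 Id.
Definition aff_mul (a b : affine) : affine :=
  let l := dih_act (adir a) (ax b, ay b) in
  Aff (ax a + l.1) (ay a + l.2) (dih_mul (adir a) (adir b)).
Definition aff_inv (a : affine) : affine :=
  let l := dih_act (dih_inv (adir a)) (ax a, ay a) in
  Aff (- l.1) (- l.2) (dih_inv (adir a)).

Declare Scope aff_scope.
Delimit Scope aff_scope with A.
Bind Scope aff_scope with affine.
Infix "*" := aff_mul : aff_scope.

(** The hyperplanes of the arrangement are the level sets, at integers, of the
    four forms 2x + y, y, x and x + y.  These are the integer parts of the four
    forms at the image under u of a point of the base alcove, where all four
    forms have values between 0 and 1. *)
Definition floors (u : dihedral) : Z * Z * Z * Z :=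
  match u with
  | Id => (0, 0, 0, 0) | R1 => (0, 0, -1, 0) | R2 => (0, -1, 0, 0)
  | R12 => (-1, 0, -1, 0) | R21 => (0, -1, 0, -1)
  | R121 => (-1, 0, -1, -1) | R212 => (-1, -1, 0, -1)
  | R1212 => (-1, -1, -1, -1)
  end%ZZ.

(** The number of hyperplanes which separate the base alcove from its image. *)
Definition alen (a : affine) : Z :=
  let: (f1, f2, f3, f4) := floors (adir a) in
  (Z.abs (2 * ax a + ay a + f1) + Z.abs (ay a + f2)
   + Z.abs (ax a + f3) + Z.abs (ax a + ay a + f4))%ZZ.

Variant gen := G0 | G1 | G2.
Definition agen (s : gen) : affine :=
  match s with G0 => Aff 1 0 R121 | G1 => Aff 0 0 R1 | G2 => Aff 0 0 R2 end.
Definition atau : affine := Aff 0 1 R212.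

Ltac aff_eq := rewrite /aff_mul /aff_inv /aff_one /=; (congr Aff); try reflexivity; lia.

Lemma aff_mulA (a b c : affine) : (a * (b * c))%A = (a * b * c)%A.
Proof. case: a b c => [x y u] [x' y' w] [x'' y'' z]; case: u; case: w; case: z; aff_eq. Qed.

Lemma aff_mul1 a : (aff_one * a)%A = a.
Proof. by case: a => x y u; aff_eq. Qed.
Lemma aff_mulr1 a : (a * aff_one)%A = a.
Proof. by case: a => x y u; case: u; aff_eq. Qed.
Lemma aff_mulrV a : (a * aff_inv a)%A = aff_one.
Proof. by case: a => x y u; case: u; aff_eq. Qed.
Lemma aff_gg s a : (agen s * (agen s * a))%A = a.
Proof. by case: a => x y u; case: s; case: u; aff_eq. Qed.
Lemma aff_tt a : (atau * (atau * a))%A = a.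
Proof. by case: a => x y u; case: u; aff_eq. Qed.

(** The integer part, on the image of the base alcove, of the form which defines
    the wall of s, with the sign that makes it nonnegative on the base alcove.
    So s a is longer than a exactly when this is nonnegative. *)
Definition wall (s : gen) (a : affine) : Z :=
  let: (f1, f2, f3, f4) := floors (adir a) in
  match s with
  | G0 => - (2 * ax a + ay a + f1)
  | G1 => ax a + f3
  | G2 => ay a + f2
  end%ZZ.

Lemma alen_up s a : (0 <= wall s a)%ZZ -> alen (agen s * a) = (alen a + 1)%ZZ.
Proof. by case: a => x y u; case: s; case: u; rewrite /alen /wall /=; lia. Qed.
Lemma alen_down s a : (wall s a < 0)%ZZ -> alen (agen s * a) = (alen a - 1)%ZZ.
Proof. by case: a => x y u; case: s; case: u; rewrite /alen /wall /=; lia. Qed.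
Lemma alen_tau a : alen (atau * a) = alen a.
Proof. by case: a => x y u; case: u; rewrite /alen /=; lia. Qed.
Lemma alen_inv a : alen (aff_inv a) = alen a.
Proof. by case: a => x y u; case: u; rewrite /alen /=; lia. Qed.
Lemma alen_ge0 a : (0 <= alen a)%ZZ.
Proof. by case: a => x y u; case: u; rewrite /alen /=; lia. Qed.

Arguments alen_ge0 : clear implicits.

(** Only the base alcove lies on the inner side of all three walls, and its
    stabilizer is {1, tau}. *)
Lemma alen_descent a : (forall s, (0 <= wall s a)%ZZ) -> a = aff_one \/ a = atau.
Proof.
case: a => x y u H; have := (H G0, H G1, H G2); rewrite /wall.
case: u {H} => /= -[[h0 h1] h2]; by [left; aff_eq | right; aff_eq | exfalso; lia].
Qed.

(** * Identification with the extended affine Weyl group *)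
Definition weyl_of (u : dihedral) : weyl :=
  dih_fold (fun g => linpart s1 * g)%g (fun g => linpart s2 * g)%g u 1%g.

Definition ext_of (a : affine) : extended :=
  Extended (int_of_Z (ax a), int_of_Z (ay a)) (weyl_of (adir a)).

Lemma weyl_of_mul u w : weyl_of (dih_mul u w) = (weyl_of u * weyl_of w)%g.
Proof. by apply: val_inj; case: u; case: w; vm_compute. Qed.

Lemma weyl_of_inj : injective weyl_of.
Proof.
have inj (u w : dihedral) : weyl_val (weyl_of u) = weyl_val (weyl_of w) -> u = w.
  by case: u; case: w.
by move=> u w e; apply: inj; rewrite e.
Qed.

Lemma weyl_of_surj g : exists u, g = weyl_of u.
Proof.
have := weyl_valP g; rewrite /weyl_elements !inE.
repeat (case/orP => [/eqP e|]; first by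
  [ exists Id; apply: val_inj; rewrite /= e; vm_compute
  | exists R1; apply: val_inj; rewrite /= e; vm_compute
  | exists R2; apply: val_inj; rewrite /= e; vm_compute
  | exists R12; apply: val_inj; rewrite /= e; vm_compute
  | exists R21; apply: val_inj; rewrite /= e; vm_compute
  | exists R121; apply: val_inj; rewrite /= e; vm_compute
  | exists R212; apply: val_inj; rewrite /= e; vm_compute]).
by move/eqP => e; exists R1212; apply: val_inj; rewrite /= e; vm_compute.
Qed.

Lemma weyl_act_of u x y :
  weyl_act (weyl_of u) (int_of_Z x, int_of_Z y) =
  (int_of_Z (dih_act u (x, y)).1, int_of_Z (dih_act u (x, y)).2).
Proof.
have act1 x' y' : weyl_act (linpart s1) (int_of_Z x', int_of_Z y') =
   (int_of_Z (- x')%ZZ, int_of_Z (2 * x' + y')%ZZ).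
  by rewrite /weyl_act /endo_act /=; congr pair; lia.
have act2 x' y' : weyl_act (linpart s2) (int_of_Z x', int_of_Z y') =
   (int_of_Z (x' + y')%ZZ, int_of_Z (- y')%ZZ).
  by rewrite /weyl_act /endo_act /=; congr pair; lia.
case: u; rewrite /weyl_of /dih_act /dih_fold ?weyl_actM weyl_act1 //;
  by rewrite !(act1, act2).
Qed.

Lemma ext_of_mul a b : ext_of (a * b)%A = (ext_of a * ext_of b)%g.
Proof.
rewrite /ext_of /=; congr Extended; rewrite ?weyl_of_mul //.
rewrite weyl_act_of /=; case: (dih_act _ _) => l1 l2 /=; by congr pair => /=; lia.
Qed.

Lemma ext_of_inj : injective ext_of.
Proof.
move=> [x y u] [x' y' w] [/(can_inj int_of_ZK)-> /(can_inj int_of_ZK)-> h].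
by rewrite (weyl_of_inj h).
Qed.

Lemma ext_of_surj e : exists a, e = ext_of a.
Proof.
case: e => [[x y] g]; have [u ->] := weyl_of_surj g.
by exists (Aff (Z_of_int x) (Z_of_int y) u); rewrite /ext_of /= !Z_of_intK.
Qed.

Lemma ext_of_one : ext_of aff_one = 1%g.
Proof. by []. Qed.
Lemma ext_of_inv a : ext_of (aff_inv a) = (ext_of a)^-1%g.
Proof. by apply: (mulgI (ext_of a)); rewrite mulgV -ext_of_mul aff_mulrV. Qed.

Lemma s0E : s0 = ext_of (agen G0).
Proof. by congr Extended; apply: val_inj; vm_compute. Qed.
Lemma s1E : s1 = ext_of (agen G1).
Proof. by congr Extended; apply: val_inj; vm_compute. Qed.
Lemma s2E : s2 = ext_of (agen G2).
Proof. by congr Extended; apply: val_inj; vm_compute. Qed.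
Lemma tauE : tau = ext_of atau.
Proof. by congr Extended; apply: val_inj; vm_compute. Qed.

Lemma simple_reflection_of s : ext_of (agen s) \in simple_reflections.
Proof. by case: s; rewrite !inE -?s0E -?s1E -?s2E eqxx ?orbT. Qed.
Lemma simple_reflectionsP e :
  e \in simple_reflections -> exists s, e = ext_of (agen s).
Proof.
rewrite !inE => /or3P[] /eqP->; [exists G0|exists G1|exists G2].
- exact: s0E. - exact: s1E. - exact: s2E.
Qed.

Lemma alen_gen_le s a : (alen (agen s * a) <= alen a + 1)%ZZ.
Proof. by case: (Z_lt_le_dec (wall s a) 0) => [/alen_down|/alen_up] ->; lia. Qed.

Arguments alen_gen_le : clear implicits.

Lemma has_word_alen a : has_word (ext_of a) (Z.to_nat (alen a)).
Proof.
move hk : (Z.to_nat _) => k; elim: k a hk => [|k IH] a hk.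
  have /alen_descent[->|->] : forall s, (0 <= wall s a)%ZZ.
  - move=> s; case: (Z_lt_le_dec (wall s a) 0) => [/alen_down h|//].
    have := alen_ge0 (agen s * a)%A; have := alen_ge0 a; lia.
  - by exists [::], false; split => //; rewrite big_nil mul1g.
  - by exists [::], true; split => //; rewrite big_nil mul1g tauE.
have [s ws] : exists s, (wall s a < 0)%ZZ.
  apply: contrapT => /forallNP h.
  have /alen_descent[] : forall s, (0 <= wall s a)%ZZ by move=> s; have := h s; lia.
  - by move=> e; move: hk; rewrite e.
  - by move=> e; move: hk; rewrite e.
have hl := alen_down ws.
have [l [e [sz sub ew]]] := IH (agen s * a)%A ltac:(lia).
exists (ext_of (agen s) :: l), e; split.
- by rewrite /= sz.
- move=> x; rewrite inE => /predU1P[->|/sub //]; exact: simple_reflection_of.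
- by rewrite big_cons -mulgA -ew ext_of_mul mulgA -ext_of_mul -[(agen s * _)%A]aff_mulr1 -aff_mulA aff_gg ext_of_one mul1g.
Qed.

Lemma alen_word a k : has_word (ext_of a) k -> (alen a <= Z.of_nat k)%ZZ.
Proof.
move=> [l [e [<- sub ew]]]; elim: l a sub ew => [|x l IH] a sub ew.
  have -> : a = if e then atau else aff_one.
    apply: ext_of_inj; rewrite ew big_nil mul1g; case: e {ew} => //; exact: tauE.
  by case: e {ew}.
have [s xE] := simple_reflectionsP (sub x (mem_head _ _)).
have h : (alen (agen s * a) <= Z.of_nat (size l))%ZZ.
  apply: IH => [y yl|]; first by apply: sub; rewrite inE yl orbT.
  by rewrite ext_of_mul ew big_cons xE !mulgA -ext_of_mul -[(agen s * _)%A]aff_mulr1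
    -aff_mulA aff_gg ext_of_one mul1g.
by have := alen_gen_le s (agen s * a)%A; rewrite aff_gg /=; lia.
Qed.

(** A word of length k crosses at most k hyperplanes, and descents produce a
    word with as many letters as there are separating hyperplanes. *)
Lemma len_of a : len (ext_of a) = Z.to_nat (alen a).
Proof.
apply: xget_unique => [|j [hj jmin]].
  split; first exact: has_word_alen.
  by move=> j /alen_word; have := alen_ge0 a; lia.
have := jmin _ (has_word_alen a); have := alen_word hj; have := alen_ge0 a; lia.
Qed.

(** * The Hecke algebra and its cocenter *)
Definition q : laurent := v - v_inv.

Lemma v_mul_inv : v * v_inv = 1.
Proof. by apply: val_inj; rewrite /= mulfV ?tofrac_eq0 ?polyX_eq0. Qed.

Lemma fsum_seq (J : choiceType) (V : nmodType) (A : set J) (r : seq J) (F : J -> V) :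
  uniq r -> (forall i, i \in r -> A i) ->
  (forall i, A i -> i \notin r -> F i = 0) ->
  \sum_(i \in A) F i = \sum_(i <- r) F i.
Proof.
move=> ur rA F0; rewrite (@fsbigE _ _ _ _ _ r) // [LHS]big_mkcond /=.
by apply: eq_big_seq => i ir; rewrite mem_set //; exact: rA.
Qed.

Lemma aff_gs s : (agen s * agen s)%A = aff_one.
Proof. by case: s. Qed.
Lemma aff_ggr s a : (a * agen s * agen s)%A = a.
Proof. by rewrite -aff_mulA aff_gs aff_mulr1. Qed.

Section Hecke.
Variables (H : algType laurent) (T : extended -> H).
Hypothesis HT : is_hecke_algebra T.

Definition Taff (a : affine) : H := T (ext_of a).

Lemma hecke_expand (h : H) : exists (l : seq affine) (c : affine -> laurent),
  h = \sum_(a <- l) c a *: Taff a.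
Proof.
case: HT => /(_ h) [c [[fc hE] _]] _ _.
have [l lE] := (finite_seqP _).1 fc.
have [f fK] := choice ext_of_surj.
exists (map f (undup l)), (c \o ext_of); rewrite big_map hE.
rewrite (@fsum_seq _ _ _ (undup l)) ?undup_uniq //.
  by apply: eq_bigr => e _; rewrite /Taff /= -fK.
move=> e _; rewrite mem_undup => el.
have : ~ [set` l] e by exact/negP.
by rewrite -lE /= => /negP; rewrite negbK => /eqP->; rewrite scale0r.
Qed.

(** As the T_w span H, linear properties need only be checked on them. *)
Lemma hecke_ind (P : H -> Prop) :
  P 0 -> (forall h h', P h -> P h' -> P (h + h')) ->
  (forall c h, P h -> P (c *: h)) -> (forall a, P (Taff a)) -> forall h, P h.
Proof.
move=> P0 PD PZ PT h; have [l [c ->]] := hecke_expand h.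
by elim/big_ind: _ => // a _; exact/PZ.
Qed.

Lemma Taff_mul a b : (alen a + alen b = alen (a * b))%ZZ -> Taff a * Taff b = Taff (a * b).
Proof.
case: HT => _ mulT _ e; rewrite /Taff ext_of_mul; apply: mulT.
rewrite -ext_of_mul !len_of; have := alen_ge0 a; have := alen_ge0 b; lia.
Qed.

(** T_1 is a left identity on the basis, hence on H; apply this to 1. *)
Lemma Taff_one : Taff aff_one = 1.
Proof.
have id1 h : Taff aff_one * h = h.
  elim/hecke_ind: h => [|h h' e e'|c h e|a]; rewrite ?mulr0 // ?mulrDr ?e ?e' //.
    by rewrite -scalerAr e.
  by rewrite Taff_mul aff_mul1.
by rewrite -[RHS]id1 mulr1.
Qed.

Lemma Taff_sqr s : Taff (agen s) * Taff (agen s) = 1 + q *: Taff (agen s).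
Proof.
case: HT => _ _ /(_ _ (simple_reflection_of s)) /eqP.
rewrite -/(Taff (agen s)) mulrDr !mulrBl => /eqP e.
apply/eqP; rewrite -subr_eq0 -[X in _ == X]e; apply/eqP.
rewrite -!scalerAl -!scalerAr !mul1r mulr1 scalerA v_mul_inv /q scalerBl scale1r.
rewrite opprD opprB -[RHS]addrA; congr (_ + _).
by rewrite [LHS]addrC [RHS]addrC -!addrA; congr (_ + _); rewrite addrC.
Qed.

Lemma Taff_up s a : (0 <= wall s a)%ZZ -> Taff (agen s) * Taff a = Taff (agen s * a).
Proof. by move=> /alen_up h; apply: Taff_mul; rewrite h; case: s {h} => /=; rewrite /alen /=; lia. Qed.

Lemma Taff_down s a : (wall s a < 0)%ZZ ->
  Taff (agen s) * Taff a = Taff (agen s * a) + q *: Taff a.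
Proof.
move=> h; have hd := alen_down h.
have e : Taff a = Taff (agen s) * Taff (agen s * a).
  by rewrite Taff_mul aff_gg // hd; case: s {h hd} => /=; rewrite /alen /=; lia.
by rewrite {1}e mulrA Taff_sqr mulrDl mul1r -scalerAl -e.
Qed.

(** Congruence modulo commutators. *)
Definition cong (h h' : H) := commutator_submodule (h - h').

Lemma commutatorD (h h' : H) : commutator_submodule h -> commutator_submodule h' ->
  commutator_submodule (h + h').
Proof. by move=> [r ->] [r' ->]; exists (r ++ r'); rewrite big_cat. Qed.

Lemma commutatorZ c (h : H) : commutator_submodule h -> commutator_submodule (c *: h).
Proof.
move=> [r ->]; exists [seq (c * p.1, p.2) | p <- r].
by rewrite big_map scaler_sumr; apply: eq_bigr => p _; rewrite scalerA.
Qed.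

Lemma cong_refl h : cong h h.
Proof. by rewrite /cong subrr; exists [::]; rewrite big_nil. Qed.
Lemma cong_sym h h' : cong h h' -> cong h' h.
Proof. by move=> /(commutatorZ (-1)); rewrite scaleN1r opprB. Qed.
Lemma cong_trans h h' h'' : cong h h' -> cong h' h'' -> cong h h''.
Proof. by move=> /commutatorD /[apply]; rewrite /cong addrA subrK. Qed.
Lemma congD h1 h2 h1' h2' : cong h1 h1' -> cong h2 h2' -> cong (h1 + h2) (h1' + h2').
Proof. by move=> /commutatorD /[apply]; rewrite /cong addrACA opprD. Qed.
Lemma congZ c h h' : cong h h' -> cong (c *: h) (c *: h').
Proof. by move=> /(commutatorZ c); rewrite /cong scalerBr. Qed.
Lemma cong_mulC h h' : cong (h * h') (h' * h).
Proof. by exists [:: (1, (h, h'))]; rewrite big_seq1 scale1r. Qed.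

Definition Tsum (l : seq (affine * nat)) : H := \sum_(p <- l) q ^+ p.2 *: Taff p.1.
End Hecke.

(** * Reduction modulo commutators *)
Definition raise (l : seq (affine * nat)) := [seq (p.1, p.2.+1) | p <- l].

(** The list (a_i, e_i) is a reduction of a when T_a = sum_i q^(e_i) T_(a_i)
    modulo commutators can be derived from cyclic shifts and descents alone.
    Keeping the derivation combinatorial makes it stable under inversion, which
    halves the number of elements of O_2 to be treated. *)
Inductive reduces : affine -> seq (affine * nat) -> Prop :=
| reduces_refl a : reduces a [:: (a, 0%N)]
| reduces_shift a b l : (alen a + alen b = alen (a * b))%ZZ ->
    (alen b + alen a = alen (b * a))%ZZ ->
    reduces (b * a) l -> reduces (a * b) l
| reduces_descent s a l l' : alen a = (alen (agen s * a * agen s) + 2)%ZZ ->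
    reduces (agen s * a * agen s) l -> reduces (agen s * a) l' ->
    reduces a (l ++ raise l').

Lemma alen_gen s : alen (agen s) = 1%ZZ.
Proof. by case: s. Qed.

Lemma alen_gen_right s a : (alen a - 1 <= alen (a * agen s) <= alen a + 1)%ZZ.
Proof.
rewrite -(alen_inv (a * agen s)) -(alen_inv a).
have -> : aff_inv (a * agen s) = (agen s * aff_inv a)%A.
  by case: a => x y u; case: s; case: u; aff_eq.
by case: (Z_lt_le_dec (wall s (aff_inv a)) 0) => [/alen_down|/alen_up] ->; lia.
Qed.

Lemma alen_gen_left s a : (alen a - 1 <= alen (agen s * a) <= alen a + 1)%ZZ.
Proof. by case: (Z_lt_le_dec (wall s a) 0) => [/alen_down|/alen_up] ->; lia. Qed.

Lemma descent_lengths s a : alen a = (alen (agen s * a * agen s) + 2)%ZZ ->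
  alen (agen s * a) = (alen a - 1)%ZZ /\ alen (a * agen s) = (alen a - 1)%ZZ.
Proof.
move=> e; have h1 := alen_gen_left s a; have h2 := alen_gen_right s (agen s * a).
have h3 := alen_gen_right s a; have h4 := alen_gen_left s (a * agen s).
by rewrite aff_mulA in h4; split; lia.
Qed.

(** For a descent put b = sas; then T_a = T_s T_b T_s, which is congruent to
    T_b T_s^2 = T_b + q T_(bs), and bs = sa. *)
Lemma reduces_cong (H : algType laurent) (T : extended -> H) (HT : is_hecke_algebra T) a l :
  reduces a l -> cong (Taff T a) (Tsum T l).
Proof.
elim=> {a l} [a|a b l e1 e2 _ IH|s a l l' e _ IH _ IH'].
- by rewrite /Tsum big_seq1 scale1r; exact: cong_refl.
- rewrite -(Taff_mul HT e1); apply: cong_trans (cong_mulC _ _) _.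
  by rewrite (Taff_mul HT e2).
- have [e1 e2] := descent_lengths e.
  set b := (agen s * a * agen s)%A in e IH *.
  have sa : (b * agen s)%A = (agen s * a)%A by rewrite aff_ggr.
  have sbs : (agen s * (b * agen s))%A = a by rewrite sa aff_gg.
  have mul_b : Taff T b * Taff T (agen s) = Taff T (agen s * a).
    by rewrite (Taff_mul HT) sa // alen_gen; lia.
  have -> : Taff T a = Taff T (agen s) * (Taff T b * Taff T (agen s)).
    by rewrite mul_b (Taff_mul HT) aff_gg // alen_gen; lia.
  apply: cong_trans (cong_mulC _ _) _.
  rewrite -mulrA (Taff_sqr HT) mulrDr mulr1 -scalerAr mul_b.
  rewrite /Tsum big_cat; apply: congD => //.
  have -> : \sum_(p <- raise l') q ^+ p.2 *: Taff T p.1 = q *: Tsum T l'.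
    by rewrite big_map scaler_sumr; apply: eq_bigr => p _; rewrite scalerA exprS.
  exact: congZ.
Qed.

Lemma aff_inv_mul a b : aff_inv (a * b) = (aff_inv b * aff_inv a)%A.
Proof. by apply: ext_of_inj; rewrite !(ext_of_inv, ext_of_mul) invgM. Qed.
Lemma aff_inv_gen s : aff_inv (agen s) = agen s.
Proof. by case: s. Qed.

(** The inverse of a descent of a by s is a descent of a^-1, except that it
    splits off a^-1 s instead of s a^-1; these two differ by a cyclic shift. *)
Lemma reduces_inv a l : reduces a l -> reduces (aff_inv a) [seq (aff_inv p.1, p.2) | p <- l].
Proof.
elim=> {a l} [a|a b l e1 e2 _ IH|s a l l' e _ IH _ IH'] /=.
- exact: reduces_refl.
- rewrite aff_inv_mul; apply: reduces_shift; rewrite -?aff_inv_mul ?alen_inv //; lia.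
- rewrite map_cat.
  have [e1 e2] := descent_lengths e.
  have inv_conj : aff_inv (agen s * a * agen s) = (agen s * aff_inv a * agen s)%A.
    by rewrite !aff_inv_mul aff_inv_gen aff_mulA.
  have -> : [seq (aff_inv p.1, p.2) | p <- raise l']
     = raise [seq (aff_inv p.1, p.2) | p <- l'] by rewrite /raise -!map_comp.
  apply: (@reduces_descent s); rewrite -?inv_conj ?alen_inv //.
  rewrite aff_inv_mul aff_inv_gen in IH'.
  have ia : (agen s * aff_inv a)%A = aff_inv (a * agen s) by rewrite aff_inv_mul aff_inv_gen.
  have ai : (aff_inv a * agen s)%A = aff_inv (agen s * a) by rewrite aff_inv_mul aff_inv_gen.
  have lc : alen (agen s * aff_inv a * agen s) = (alen a - 2)%ZZ.
    by rewrite -inv_conj alen_inv; lia.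
  rewrite -[(agen s * aff_inv a)%A](aff_ggr s); apply: reduces_shift.
  - by rewrite aff_ggr lc ia alen_inv alen_gen; lia.
  - by rewrite -aff_mulA aff_gg aff_mulA lc ai alen_inv alen_gen; lia.
  - by rewrite -aff_mulA aff_gg.
Qed.

(** * Expansion of the elements of Coxeter type *)

(** A reduction, up to the order and the multiplicities of its terms.  The
    degrees of the class polynomials do not depend on the multiplicities, since
    the terms cannot cancel. *)
Definition reduces_to (a : affine) (P : affine -> nat -> Prop) : Prop :=
  exists2 l, reduces a l & forall b e, List.In (b, e) l <-> P b e.

Lemma reduces_to_refl a : reduces_to a (fun b e => b = a /\ e = 0%N).
Proof.
exists [:: (a, 0%N)]; first exact: reduces_refl.
by move=> b e /=; split=> [[[-> ->]|//]|[-> ->]]; auto.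
Qed.

Lemma reduces_to_ext a P P' : (forall b e, P b e <-> P' b e) ->
  reduces_to a P -> reduces_to a P'.
Proof. by move=> PP' [l al lP]; exists l => // b e; rewrite lP. Qed.

(** Conjugation by s preserves the length when exactly one of sa < a and
    as < a holds; [wall] expresses these conditions by linear inequalities. *)
Lemma reduces_left s a b l : (wall s a < 0)%ZZ ->
  (0 <= wall s (aff_inv (agen s * a)))%ZZ -> b = (agen s * a * agen s)%A ->
  reduces b l -> reduces a l.
Proof.
move=> h1 h2 -> al.
have e1 := alen_down h1; have e2 := alen_up h2.
rewrite -[X in alen (X * _)]aff_inv_gen -aff_inv_mul !alen_inv in e2.
rewrite -(aff_gg s a); apply: reduces_shift => //; rewrite ?aff_gg ?alen_gen; lia.
Qed.

Lemma reduces_right s a b l : (wall s (aff_inv a) < 0)%ZZ ->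
  (0 <= wall s (a * agen s))%ZZ -> b = (agen s * a * agen s)%A ->
  reduces b l -> reduces a l.
Proof.
move=> h1 h2 -> al.
have e1 := alen_down h1; have e2 := alen_up h2.
rewrite -[X in alen (X * _)]aff_inv_gen -aff_inv_mul !alen_inv in e1.
rewrite -(aff_ggr s a); apply: reduces_shift; rewrite ?aff_ggr ?alen_gen ?aff_mulA //; try lia.
by rewrite -aff_mulA; lia.
Qed.

Lemma reduces_tau a b l : b = (atau * a * atau)%A -> reduces b l -> reduces a l.
Proof.
move=> -> al.
have er : alen (atau * a * atau) = alen (atau * a).
  rewrite -[RHS]alen_inv -[LHS]alen_inv aff_inv_mul -[X in (X * _)%A]/atau.
  by rewrite alen_tau.
have t0 : alen atau = 0%ZZ by [].
by rewrite -(aff_tt a); apply: reduces_shift => //; rewrite ?aff_tt ?er alen_tau; lia.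
Qed.

Lemma reduces_to_via a b P : (forall l, reduces b l -> reduces a l) ->
  reduces_to b P -> reduces_to a P.
Proof. by move=> h [l al lP]; exists l => //; exact: h. Qed.

Lemma reduces_to_left s a b P : (wall s a < 0)%ZZ ->
  (0 <= wall s (aff_inv (agen s * a)))%ZZ -> b = (agen s * a * agen s)%A ->
  reduces_to b P -> reduces_to a P.
Proof. by move=> h1 h2 e; apply: reduces_to_via => l; exact: reduces_left h1 h2 e. Qed.

Lemma reduces_to_right s a b P : (wall s (aff_inv a) < 0)%ZZ ->
  (0 <= wall s (a * agen s))%ZZ -> b = (agen s * a * agen s)%A ->
  reduces_to b P -> reduces_to a P.
Proof. by move=> h1 h2 e; apply: reduces_to_via => l; exact: reduces_right h1 h2 e. Qed.

Lemma reduces_to_tau a b P : b = (atau * a * atau)%A ->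
  reduces_to b P -> reduces_to a P.
Proof. by move=> e; apply: reduces_to_via => l; exact: reduces_tau e. Qed.

Lemma reduces_to_descent s a b c P P' : (wall s a < 0)%ZZ ->
  (wall s (aff_inv (agen s * a)) < 0)%ZZ ->
  b = (agen s * a * agen s)%A -> c = (agen s * a)%A ->
  reduces_to b P -> reduces_to c P' ->
  reduces_to a (fun x e => P x e \/ exists2 d, e = d.+1 & P' x d).
Proof.
move=> h1 h2 -> -> [l bl lP] [l' cl' lP']; exists (l ++ raise l').
  have e1 := alen_down h1; have e2 := alen_down h2.
  rewrite -[X in alen (X * _)]aff_inv_gen -aff_inv_mul !alen_inv in e2.
  apply: (@reduces_descent s) => //; lia.
move=> x e; rewrite List.in_app_iff lP; split=> -[?|h]; [by left|right|by left|right].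
  have /List.in_map_iff[[y d] /= [[<- <-] yd]] := h.
  by exists d => //; apply/lP'.
by have [d -> /lP' xd] := h; apply/List.in_map_iff; exists (x, d).
Qed.

Lemma reduces_to_inv a P : reduces_to a P ->
  reduces_to (aff_inv a) (fun x e => P (aff_inv x) e).
Proof.
have invK b : aff_inv (aff_inv b) = b.
  by apply: ext_of_inj; rewrite !ext_of_inv invgK.
move=> [l al lP]; eexists; first exact: (reduces_inv al).
move=> b e; rewrite -lP List.in_map_iff; split=> [[[c d] [[<- <-]]]|h].
  by rewrite invK.
by exists (aff_inv b, e); rewrite invK.
Qed.

(** Orthonormal coordinates of the plane: epsilon_1 = (1, 0) and
    epsilon_2 = (1/2, 1/2).  Only coweights of Q have integral coordinates. *)
Definition plane_aff (X Y : Z) (u : dihedral) : affine := Aff (X - Y) (2 * Y) u.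

Ltac wall_lia := rewrite /wall /=; lia.
(** [go s] and [go_tau] replace the element to be reduced by its conjugate under
    s or tau, which must have the same length. *)
Ltac go s := first
  [ apply: (@reduces_to_left s); [wall_lia|wall_lia|aff_eq|]
  | apply: (@reduces_to_right s); [wall_lia|wall_lia|aff_eq|]
  | apply: (@reduces_left s); [wall_lia|wall_lia|aff_eq|]
  | apply: (@reduces_right s); [wall_lia|wall_lia|aff_eq|] ].
Ltac go_tau := first
  [ apply: reduces_to_tau; [aff_eq|] | apply: reduces_tau; [aff_eq|] ].

(** [rep_refl2 k] and [rep_refl1 k] are elements of minimal length in the
    classes of reflections O_(4k+1) and O'(k), conjugate to t^mu s_2 and
    t^mu s_1 respectively, and [rep_coxeter] is one in O_2. *)
Definition rep_refl2 (k : Z) : affine := Aff k 0 R2.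
Definition rep_refl1 (k : Z) : affine :=
  if Z.even k then Aff 0 k R1 else Aff 1 (k - 1) R1.
Definition rep_coxeter : affine := Aff 1 0 R12.

(** The terms of the reflection t^(X, Y) s_1: its class O'(X + Y), and the
    translations on the line X + Y = const strictly between (X, Y) and the
    diagonal. *)
Definition refl1_terms (X Y : Z) (b : affine) (e : nat) : Prop :=
  (b = rep_refl1 (X + Y) /\ e = 0%N) \/
  e = 1%N /\ exists X' Y', [/\ b = plane_aff X' Y' Id, (X' + Y' = X + Y)%ZZ & (Y < Y' < X')%ZZ].

(** Three length preserving conjugations reflect (X, Y) to (Y + 1, X - 1), and
    conjugation by s_1 then descends to (X - 1, Y + 1), splitting off the
    translation by (X - 1, Y + 1).  The difference X - Y drops by two in each
    round; for differences 0 and 1 the reflection has minimal length, and for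
    difference 2 the reflected point is already on the diagonal. *)
Lemma reduces_reflection1 X Y : (0 <= Y <= X)%ZZ ->
  reduces_to (plane_aff X Y R1) (refl1_terms X Y).
Proof.
move=> hXY; have [d hd] : exists d : nat, (X - Y)%ZZ = Z.of_nat d.
  by exists (Z.to_nat (X - Y)); lia.
elim/ltn_ind: d X Y hXY hd => d IH X Y hXY hd.
have even2 (k : Z) : Z.even (2 * k) = true by rewrite Z.even_mul.
case: d => [|[|d]] in hd IH *.
- apply: reduces_to_ext (reduces_to_refl _) => b e; rewrite /refl1_terms.
  have -> : rep_refl1 (X + Y) = plane_aff X Y R1.
    by rewrite /rep_refl1; have -> : (X + Y = 2 * Y)%ZZ by [lia]; rewrite even2; aff_eq.
  split=> [?|[//|[_ [X' [Y' [_]]]]]]; [by left|lia].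
- apply: reduces_to_ext (reduces_to_refl _) => b e; rewrite /refl1_terms.
  have -> : rep_refl1 (X + Y) = plane_aff X Y R1.
    rewrite /rep_refl1; have -> : (X + Y = 2 * Y + 1)%ZZ by lia.
    by rewrite Z.even_add even2; aff_eq.
  split=> [?|[//|[_ [X' [Y' [_]]]]]]; [by left|lia].
rewrite /plane_aff; go G0; go G1; go G2.
case: d => [|d] in hd IH *.
  apply: reduces_to_ext (reduces_to_refl _) => b e; rewrite /refl1_terms.
  have -> : rep_refl1 (X + Y) = plane_aff (Y + 1) (X - 1) R1.
    by rewrite /rep_refl1; have -> : (X + Y = 2 * (Y + 1))%ZZ by [lia]; rewrite even2; aff_eq.
  rewrite /plane_aff /=; split=> [[-> ->]|[[-> ->]|[_ [X' [Y' [_]]]]]]; [left|..|lia].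
    by split=> //; aff_eq.
  by split=> //; aff_eq.
apply: reduces_to_ext; last first.
  apply: (@reduces_to_descent G1 _ (plane_aff (X - 1) (Y + 1) R1) (plane_aff (X - 1) (Y + 1) Id));
    [wall_lia|wall_lia|aff_eq|aff_eq| |exact: reduces_to_refl].
  by apply: (IH d.+1); lia.
move=> b e; rewrite /refl1_terms; have -> : (X - 1 + (Y + 1) = X + Y)%ZZ by lia.
split=> [[[?|[-> [X' [Y' [-> ? ?]]]]]|[_ -> [-> ->]]]|[?|[-> [X' [Y' [-> ? ?]]]]]].
- by left.
- by right; split => //; exists X', Y'; split => //; lia.
- by right; split => //; exists (X - 1)%ZZ, (Y + 1)%ZZ; split => //; lia.
- by left; left.
- case: (Z.eq_dec Y' (Y + 1)) => eY; last first.
    by left; right; split => //; exists X', Y'; split => //; lia.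
  right; exists 0%N => //; split => //; rewrite /plane_aff; aff_eq.
Qed.

(** The terms of the expansion attached to (N, D): b occurs with q^e. *)
Definition expansion (N D : Z) (b : affine) (e : nat) : Prop :=
  [\/ b = rep_coxeter /\ e = 0%N,
      e = 1%N /\ exists k, b = rep_refl2 k /\ (1 <= k <= N)%ZZ,
      e = 1%N /\ exists k, b = rep_refl1 k /\ (1 <= k <= D)%ZZ |
      e = 2%N /\ exists X Y, [/\ b = plane_aff X Y Id, (1 <= Y < X)%ZZ, (X <= N)%ZZ & (X + Y <= D)%ZZ] ].

(** Elements of O_2 that expand as (N, D); the first one descends by s_2
    when N < D <= 2N + 1, the second one is conjugate to it without change of
    length when moreover D <= 2N, and takes over on the diagonal N = D. *)
Definition cox21 (N D : Z) : affine := Aff D (2 * (N + 1 - D)) R21.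
Definition cox12 (N D : Z) : affine := Aff (2 * N + 1 - D) (2 * (D - N)) R12.

(** The reflection that is split off is t^(N + 1, D - N - 1) s_1: the
    translations on its line X + Y = D are those with X <= N. *)
Lemma reduces_coxeter_step21 N D : (N < D <= 2 * N + 1)%ZZ ->
  reduces_to (cox12 N (D - 1)) (expansion N (D - 1)) ->
  reduces_to (cox21 N D) (expansion N D).
Proof.
move=> h hB; rewrite /cox21; apply: reduces_to_ext; last first.
  apply: (@reduces_to_descent G2 _ (cox12 N (D - 1)) (plane_aff (N + 1) (D - N - 1) R1));
    [wall_lia|wall_lia|rewrite /cox12; aff_eq|rewrite /plane_aff; aff_eq|exact: hB|].
  by apply: reduces_reflection1; lia.
move=> b e; rewrite /expansion /refl1_terms.
have -> : (N + 1 + (D - N - 1) = D)%ZZ by lia.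
split.
  move=> [[|[-> [k [-> hk]]]|[-> [k [-> hk]]]|[-> [X [Y [-> h1 h2 h3]]]]]|].
  - by constructor 1.
  - by constructor 2; split => //; exists k.
  - by constructor 3; split => //; exists k; split => //; lia.
  - by constructor 4; split => //; exists X, Y; split => //; lia.
  - move=> [d -> [[-> ->]|[-> [X [Y [-> h1 h2]]]]]].
      by constructor 3; split => //; exists D; split => //; lia.
    by constructor 4; split => //; exists X, Y; split => //; lia.
move=> [|[-> [k [-> hk]]]|[-> [k [-> hk]]]|[-> [X [Y [-> h1 h2 h3]]]]].
- by left; constructor 1.
- by left; constructor 2; split => //; exists k.
- case: (Z.eq_dec k D) => [->|nk]; first by right; exists 0%N => //; left.
  by left; constructor 3; split => //; exists k; split => //; lia.
- case: (Z.eq_dec (X + Y) D) => [eD|nD].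
    by right; exists 1%N => //; right; split => //; exists X, Y; split => //; lia.
  by left; constructor 4; split => //; exists X, Y; split => //; lia.
Qed.

(** On the diagonal N = D there is no translation with X = N to be added, and
    the reflection that is split off has minimal length. *)
Lemma reduces_coxeter_step12 N : (1 <= N)%ZZ ->
  reduces_to (cox21 (N - 1) N) (expansion (N - 1) N) ->
  reduces_to (cox12 N N) (expansion N N).
Proof.
move=> h hA; rewrite /cox12; go G0; go_tau.
apply: reduces_to_ext; last first.
  apply: (@reduces_to_descent G1 _ (cox21 (N - 1) N) (rep_refl2 N));
    [wall_lia|wall_lia|rewrite /cox21; aff_eq|rewrite /rep_refl2; aff_eq|exact: hA|].
  exact: reduces_to_refl.
move=> b e; rewrite /expansion; split.
  move=> [[|[-> [k [-> hk]]]|[-> [k [-> hk]]]|[-> [X [Y [-> h1 h2 h3]]]]]|].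
  - by constructor 1.
  - by constructor 2; split => //; exists k; split => //; lia.
  - by constructor 3; split => //; exists k.
  - by constructor 4; split => //; exists X, Y; split => //; lia.
  - by move=> [d -> [-> ->]]; constructor 2; split => //; exists N; split => //; lia.
move=> [|[-> [k [-> hk]]]|[-> [k [-> hk]]]|[-> [X [Y [-> h1 h2 h3]]]]].
- by left; constructor 1.
- case: (Z.eq_dec k N) => [->|nk]; first by right; exists 0%N.
  by left; constructor 2; split => //; exists k; split => //; lia.
- by left; constructor 3; split => //; exists k.
- by left; constructor 4; split => //; exists X, Y; split => //; lia.
Qed.

Lemma reduces_coxeter (N D : Z) : (0 <= N)%ZZ ->
  ((N < D <= 2 * N + 1)%ZZ -> reduces_to (cox21 N D) (expansion N D)) /\
  ((N <= D <= 2 * N)%ZZ -> reduces_to (cox12 N D) (expansion N D)).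
Proof.
move=> hN; have [k hk] : exists k : nat, (N + D)%ZZ = Z.of_nat k \/ (D < N)%ZZ.
  exists (Z.to_nat (N + D)); lia.
case: hk => [hk|hk]; last by split; lia.
elim/ltn_ind: k N D hN hk => k IH N D hN hk.
have h21 : (N < D <= 2 * N + 1)%ZZ -> reduces_to (cox21 N D) (expansion N D).
  move=> h; apply: reduces_coxeter_step21 => //.
  by apply: (IH k.-1 _ N (D - 1)%ZZ _ _).2; lia.
split=> // h; case: (Z.eq_dec N D) => [eND|nND]; last first.
  rewrite /cox12; go G1; go G2; go_tau.
  have := h21 ltac:(lia); rewrite /cox21; congr reduces_to; aff_eq.
subst D; case: (Z.eq_dec N 0) => [->|N0].
  apply: reduces_to_ext (reduces_to_refl _) => b e; split => [?|]; first by constructor 1.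
  by move=> [//|[_ [? [_]]]|[_ [? [_]]]|[_ [? [? [_]]]]]; lia.
apply: reduces_coxeter_step12; first lia.
by apply: (IH k.-1 _ (N - 1)%ZZ N _ _).1; lia.
Qed.

(** * Conjugacy classes *)
Ltac mod_lia := Z.to_euclidean_division_equations; lia.
(** A complete invariant of conjugacy.  For translations it is the dominant
    coweight of the orbit, in doubled plane coordinates.  Conjugating t^mu u by
    translations changes mu by (1 - u)P, so the other cases record the class of
    mu in P / (1 - u)P, up to the centralizer of u.  This quotient is
    Z x Z/2, Z, Z/2 and (Z/2)^2 when u is s_1, s_2, s_1 s_2 and the central
    element w_0; in the last case W identifies the two classes outside Q. *)
Definition class_inv (a : affine) : nat * Z * Z :=
  let: Aff x y u := a in
  match u with
  | Id => (0%N, Z.max (Z.abs (2 * x + y)) (Z.abs y), Z.min (Z.abs (2 * x + y)) (Z.abs y))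
  | R1 => (1%N, Z.abs (x + y), y mod 2) | R212 => (1%N, Z.abs x, y mod 2)
  | R2 => (2%N, Z.abs (2 * x + y), 0) | R121 => (2%N, Z.abs y, 0)
  | R12 | R21 => (3%N, y mod 2, 0)
  | R1212 => (4%N, y mod 2, if (y mod 2 =? 0) then x mod 2 else 0)
  end%ZZ.

Definition aff_conj (a b : affine) := exists c, b = (aff_inv c * a * c)%A.

Lemma aff_invK a : aff_inv (aff_inv a) = a.
Proof. by apply: ext_of_inj; rewrite !ext_of_inv invgK. Qed.

Lemma aff_conj_sym a b : aff_conj a b -> aff_conj b a.
Proof.
by move=> [c ->]; exists (aff_inv c); rewrite aff_invK -!aff_mulA aff_mulrV aff_mulr1
  aff_mulA aff_mulrV aff_mul1.
Qed.
Lemma aff_conj_trans a b c : aff_conj a b -> aff_conj b c -> aff_conj a c.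
Proof. by move=> [d ->] [e ->]; exists (d * e)%A; rewrite aff_inv_mul !aff_mulA. Qed.

(** W~ is generated by the simple reflections and tau. *)
Lemma affine_ind_left (P : affine -> Prop) : P aff_one -> P atau ->
  (forall s a, P a -> P (agen s * a)%A) -> forall a, P a.
Proof.
move=> P1 Pt Ps a; have [k hk] : exists k, Z.to_nat (alen a) = k by exists (Z.to_nat (alen a)).
elim/ltn_ind: k a hk => k IH a hk.
case: (pselect (exists s, (wall s a < 0)%ZZ)) => [[s hs]|/forallNP h]; last first.
  have /alen_descent[->|->] // : forall s, (0 <= wall s a)%ZZ by move=> s; have := h s; lia.
rewrite -(aff_gg s a); apply: Ps; have := alen_down hs; have := alen_ge0 (agen s * a)%A.
by move=> h1 h2; apply: (IH (Z.to_nat (alen (agen s * a)))) => //; lia.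
Qed.

Lemma class_inv_gen s a : class_inv (agen s * a * agen s) = class_inv a.
Proof.
case: a => x y u; case: s; case: u; rewrite /class_inv /=; congr (_, _, _); try mod_lia.
all: case: Z.eqb_spec => ?; case: Z.eqb_spec => ?; mod_lia.
Qed.

Lemma class_inv_tau a : class_inv (atau * a * atau) = class_inv a.
Proof.
case: a => x y u; case: u; rewrite /class_inv /=; congr (_, _, _); try mod_lia.
all: case: Z.eqb_spec => ?; case: Z.eqb_spec => ?; mod_lia.
Qed.

Lemma class_inv_conj a c : class_inv (aff_inv c * a * c) = class_inv a.
Proof.
elim/affine_ind_left: c a => [||s c IH] a.
- by rewrite aff_mulr1 -[X in (X * _)%A]/aff_one aff_mul1.
- by rewrite -[X in (X * _ * _)%A]/atau class_inv_tau.
- by rewrite aff_inv_mul aff_inv_gen !aff_mulA -[in LHS](aff_mulA (aff_inv c)) -(aff_mulA (aff_inv c)) IH class_inv_gen.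
Qed.

Lemma class_inv_inv a : class_inv (aff_inv a) = class_inv a.
Proof.
case: a => x y u; case: u; rewrite /class_inv /=; congr (_, _, _); try mod_lia.
all: case: Z.eqb_spec => ?; case: Z.eqb_spec => ?; mod_lia.
Qed.

(** A normal form with a given invariant. *)
Definition class_rep (i : nat * Z * Z) : affine :=
  match i.1.1 with
  | 0%N => Aff ((i.1.2 - i.2) / 2) i.2 Id
  | 1%N => Aff (i.1.2 - i.2) i.2 R1
  | 2%N => Aff (i.1.2 / 2) (i.1.2 mod 2) R2
  | 3%N => Aff 0 i.1.2 R12
  | _ => Aff i.2 i.1.2 R1212
  end%ZZ.

Ltac conj_by c := exists c; rewrite /class_rep /class_inv /aff_mul /aff_inv /=; (congr Aff); try reflexivity; mod_lia.
Lemma aff_conj_rep a : aff_conj a (class_rep (class_inv a)).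
Proof.
have via s b : aff_conj (agen s * b * agen s)%A (class_rep (class_inv (agen s * b * agen s))) ->
    aff_conj b (class_rep (class_inv b)).
  rewrite class_inv_gen; apply: aff_conj_trans; exists (agen s); by rewrite aff_inv_gen.
have conj0 x y : (Z.abs y <= 2 * x + y)%ZZ ->
    aff_conj (Aff x y Id) (class_rep (class_inv (Aff x y Id))).
  move=> h; case: (Z_le_gt_dec 0 y) => h'; [conj_by (Aff 0 0 Id)|conj_by (Aff 0 0 R2)].
have conj1 x y : aff_conj (Aff x y R1) (class_rep (class_inv (Aff x y R1))).
  case: (Z_le_gt_dec 0 (x + y)) => h; first conj_by (Aff ((y mod 2 - y) / 2) 0 Id).
  conj_by (Aff ((- (y mod 2) - y) / 2) 0 R1212).
have conj2 x y : aff_conj (Aff x y R2) (class_rep (class_inv (Aff x y R2))).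
  case: (Z_le_gt_dec 0 (2 * x + y)) => h; first conj_by (Aff 0 (y / 2) Id).
  conj_by (Aff 0 ((y + 1) / 2) R1212).
have conj3 x y : aff_conj (Aff x y R12) (class_rep (class_inv (Aff x y R12))).
  conj_by (Aff ((y mod 2 - y) / 2) (x - 2 * ((y mod 2 - y) / 2)) Id).
have conj4 x y : (y mod 2 = 0 \/ x mod 2 = 0)%ZZ ->
    aff_conj (Aff x y R1212) (class_rep (class_inv (Aff x y R1212))).
  move=> h; exists (Aff (x / 2) (y / 2) Id).
  rewrite /class_rep /class_inv /aff_mul /aff_inv /=.
  by case: Z.eqb_spec => hy; (congr Aff); try reflexivity; mod_lia.
case: a => x y u; case: u; try by [].
- case: (Z_le_gt_dec (Z.abs y) (2 * x + y)) => h1; first exact: conj0.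
  case: (Z_le_gt_dec (Z.abs y) (- (2 * x + y))) => h2.
    by apply/(via G1)/(via G2)/(via G1)/conj0 => /=; lia.
  case: (Z_le_gt_dec 0 y) => h3; first by apply/(via G1)/conj0 => /=; lia.
  by apply/(via G2)/(via G1)/conj0 => /=; lia.
- by apply/(via G1)/conj3.
- by apply/(via G1)/conj2.
- by apply/(via G2)/conj1.
- case: (Z.eqb_spec (x mod 2) 0) => hx; first by apply: conj4; right.
  case: (Z.eqb_spec (y mod 2) 0) => hy; first by apply: conj4; left.
  by apply/(via G2)/conj4; right; rewrite /=; mod_lia.
Qed.

Lemma aff_conjP a b : aff_conj a b <-> class_inv a = class_inv b.
Proof.
split=> [[c ->]|e]; first by rewrite class_inv_conj.
by apply: aff_conj_trans (aff_conj_rep a) _; rewrite e; exact/aff_conj_sym/aff_conj_rep.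
Qed.

Lemma conj_class_of a :
  conj_class (ext_of a) = [set ext_of b | b in [set b | class_inv b = class_inv a]].
Proof.
apply/seteqP; split=> x.
  move=> [y _ <-]; have [c ->] := ext_of_surj y.
  exists (aff_inv c * a * c)%A; first exact: class_inv_conj.
  by rewrite !ext_of_mul ext_of_inv conjgE mulgA.
move=> [b /esym /aff_conjP[c ->] <-].
by exists (ext_of c) => //; rewrite !ext_of_mul ext_of_inv conjgE mulgA.
Qed.

(** * The classes O_2, O_lambda, O_(4k+1), O'_(6k+1) and O'_(6k+3) *)
Lemma cw_mulz (a b n : int) : ((a, b) : coweight) *~ n = (a * n, b * n).
Proof.
rewrite [LHS]surjective_pairing; congr pair.
  by rewrite (raddfMz (fst : coweight -> int)) /= -mulrzr intz.
by rewrite (raddfMz (snd : coweight -> int)) /= -mulrzr intz.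
Qed.
Lemma cw_muln (a b : int) (n : nat) : ((a, b) : coweight) *+ n = (a * n%:Z, b * n%:Z).
Proof. by rewrite -cw_mulz pmulrn. Qed.
Lemma cw_add (a b c d : int) : ((a, b) : coweight) + (c, d) = (a + c, b + d).
Proof. by []. Qed.
Lemma cw_opp (a b : int) : - ((a, b) : coweight) = (- a, - b).
Proof. by []. Qed.
Lemma Lam1E : Lam1 = (1, 0). Proof. by []. Qed.
Lemma Lam2E : Lam2 = (0, 2). Proof. by []. Qed.
Definition cwE := (Lam1E, Lam2E, cw_mulz, cw_muln, cw_add, cw_opp).

Lemma t_mul (a b : int) x y u :
  (t (a, b) * ext_of (Aff x y u))%g = ext_of (Aff (Z_of_int a + x) (Z_of_int b + y) u).
Proof.
have -> : t (a, b) = ext_of (Aff (Z_of_int a) (Z_of_int b) Id).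
  by rewrite /ext_of /= !Z_of_intK.
by rewrite -ext_of_mul.
Qed.

Lemma t_s1 (a b : int) : (t (a, b) * s1)%g = ext_of (Aff (Z_of_int a) (Z_of_int b) R1).
Proof. by rewrite s1E t_mul !Z.add_0_r. Qed.
Lemma t_s2 (a b : int) : (t (a, b) * s2)%g = ext_of (Aff (Z_of_int a) (Z_of_int b) R2).
Proof. by rewrite s2E t_mul !Z.add_0_r. Qed.
Lemma ext_s1 x y u : (ext_of (Aff x y u) * s1)%g = ext_of (Aff x y (dih_mul u R1)).
Proof. by rewrite s1E -ext_of_mul; congr ext_of; case: u; aff_eq. Qed.
Lemma ext_s2 x y u : (ext_of (Aff x y u) * s2)%g = ext_of (Aff x y (dih_mul u R2)).
Proof. by rewrite s2E -ext_of_mul; congr ext_of; case: u; aff_eq. Qed.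
Definition ext_of_words := (t_s1, t_s2, ext_s1, ext_s2).

Lemma classO2E : classO2 = conj_class (ext_of rep_coxeter).
Proof.
rewrite conj_class_of; apply/seteqP; split=> x.
  move=> [] [l [a _ [b _ <-]] <-]; rewrite !cwE !ext_of_words; eexists; rewrite //=;
    congr (_, _, _); mod_lia.
move=> [[a b u] + <-]; case: u => // -[e].
- left; exists (int_of_Z a, int_of_Z b); last by rewrite !ext_of_words !int_of_ZK.
  exists (int_of_Z a) => //; exists (int_of_Z (b / 2)) => //.
  by rewrite !cwE; congr pair; mod_lia.
- right; exists (int_of_Z a, int_of_Z b); last by rewrite !ext_of_words !int_of_ZK.
  exists (int_of_Z a) => //; exists (int_of_Z (b / 2)) => //.
  by rewrite !cwE; congr pair; mod_lia.
Qed.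

Lemma classO4_1E k : classO4_1 k = conj_class (ext_of (rep_refl2 (Z.of_nat k))).
Proof.
rewrite conj_class_of; apply/seteqP; split=> x.
  move=> [] [l + [m' _ <-]] => -[] ->; rewrite !cwE !ext_of_words; eexists; rewrite //=;
    congr (_, _, _); lia.
move=> [[a b u] + <-]; case: u => // -[e].
- right; case: (Z_le_gt_dec 0 (2 * a + b)) => h.
  + exists (Lam1 *+ k); [by left|exists (int_of_Z (b / 2)) => //].
    by rewrite !cwE !ext_of_words; congr (ext_of (Aff _ _ _)) => /=; mod_lia.
  + exists (- (Lam1 *+ k)); [by right|exists (int_of_Z (b / 2)) => //].
    by rewrite !cwE !ext_of_words; congr (ext_of (Aff _ _ _)) => /=; mod_lia.
- left; case: (Z_le_gt_dec 0 b) => h.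
  + exists ((Lam2 - Lam1) *+ k); [by left|exists (int_of_Z (a + Z.of_nat k)) => //].
    by rewrite !cwE !ext_of_words; congr (ext_of (Aff _ _ _)) => /=; mod_lia.
  + exists (- ((Lam2 - Lam1) *+ k)); [by right|exists (int_of_Z (a - Z.of_nat k)) => //].
    by rewrite !cwE !ext_of_words; congr (ext_of (Aff _ _ _)) => /=; mod_lia.
Qed.

(** For coweights of Q the parity of the coordinate x of t^(x, y) s_1 is that of
    x + y, so the classes of reflections of this kind that meet W_a form a single
    family [rep_refl1 k]; the even and odd members are O'_(6k+1) and
    O'_(6k+3). *)
Lemma classO6_1E k : classO6_1 k = conj_class (ext_of (rep_refl1 (2 * Z.of_nat k))).
Proof.
have r6 : class_inv (rep_refl1 (2 * Z.of_nat k)) = (1%N, 2 * Z.of_nat k, 0)%ZZ.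
  by rewrite /rep_refl1 Z.even_mul /=; congr (_, _, _); mod_lia.
rewrite conj_class_of r6; apply/seteqP; split=> x.
  move=> [] [l + [m' _ <-]] => -[] ->; rewrite !cwE !ext_of_words; eexists; rewrite //=;
    congr (_, _, _); mod_lia.
move=> [[a b u] + <-]; case: u => // -[e e'].
- left; case: (Z_le_gt_dec 0 (a + b)) => h.
  + exists (Lam2 *+ k); [by left|exists (int_of_Z (a / 2)) => //].
    by rewrite !cwE !ext_of_words; congr (ext_of (Aff _ _ _)) => /=; mod_lia.
  + exists (- (Lam2 *+ k)); [by right|exists (int_of_Z (a / 2)) => //].
    by rewrite !cwE !ext_of_words; congr (ext_of (Aff _ _ _)) => /=; mod_lia.
- right; case: (Z_le_gt_dec 0 a) => h.
  + exists ((Lam1 *+ 2 - Lam2) *+ k); [by left|exists (int_of_Z (b / 2 + Z.of_nat k)) => //].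
    by rewrite !cwE !ext_of_words; congr (ext_of (Aff _ _ _)) => /=; mod_lia.
  + exists (- ((Lam1 *+ 2 - Lam2) *+ k)); [by right|exists (int_of_Z (b / 2 - Z.of_nat k)) => //].
    by rewrite !cwE !ext_of_words; congr (ext_of (Aff _ _ _)) => /=; mod_lia.
Qed.

Lemma classO6_3E k : classO6_3 k = conj_class (ext_of (rep_refl1 (2 * Z.of_nat k + 1))).
Proof.
have r6 : class_inv (rep_refl1 (2 * Z.of_nat k + 1)) = (1%N, 2 * Z.of_nat k + 1, 0)%ZZ.
  by rewrite /rep_refl1 Z.even_add Z.even_mul /=; congr (_, _, _); mod_lia.
rewrite conj_class_of r6; apply/seteqP; split=> x.
  move=> [] [l + [m' _ <-]] => -[] ->; rewrite !cwE !ext_of_words; eexists; rewrite //=;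
    congr (_, _, _); mod_lia.
move=> [[a b u] + <-]; case: u => // -[e e'].
- left; case: (Z_le_gt_dec 0 (a + b)) => h.
  + exists (Lam2 *+ k + Lam1); [by left|exists (int_of_Z (a / 2)) => //].
    by rewrite !cwE !ext_of_words; congr (ext_of (Aff _ _ _)) => /=; mod_lia.
  + exists (- (Lam2 *+ k + Lam1)); [by right|exists (int_of_Z ((a + 1) / 2)) => //].
    by rewrite !cwE !ext_of_words; congr (ext_of (Aff _ _ _)) => /=; mod_lia.
- right; case: (Z_le_gt_dec 0 a) => h.
  + exists ((Lam1 *+ 2 - Lam2) *+ k + Lam1); [by left|exists (int_of_Z (b / 2 + Z.of_nat k)) => //].
    by rewrite !cwE !ext_of_words; congr (ext_of (Aff _ _ _)) => /=; mod_lia.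
  + exists (- ((Lam1 *+ 2 - Lam2) *+ k + Lam1)); [by right|exists (int_of_Z (b / 2 - Z.of_nat k)) => //].
    by rewrite !cwE !ext_of_words; congr (ext_of (Aff _ _ _)) => /=; mod_lia.
Qed.

Lemma classO_coweightE (x y : Z) : classO_coweight (int_of_Z x, int_of_Z y) = conj_class (ext_of (Aff x y Id)).
Proof.
apply/seteqP; split=> e.
  move=> [g _ <-]; exists (Extended 0 g^-1)%g => //.
  rewrite conjgE /t; congr Extended => /=.
    by rewrite weyl_act1 invgK weyl_act0 oppr0 add0r addr0.
  by rewrite mul1g invgK mulgV.
move=> [[l g] _ <-]; exists (g^-1)%g => //.
rewrite conjgE /t; congr Extended => /=.
  by rewrite weyl_act1 -weyl_actN -weyl_actD addrCA addNr addr0.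
by rewrite mul1g mulVg.
Qed.

(** * Elements of minimal length *)
Lemma reduces_eq a b : a = b -> reduces a [:: (b, 0%N)].
Proof. by move=> ->; exact: reduces_refl. Qed.

(** Besides having minimal length, r can be reached by length preserving moves
    from every other element of minimal length in its class.  So T_O does not
    depend on the choice of such an element. *)
Definition minimal_rep (r : affine) : Prop :=
  forall b, class_inv b = class_inv r ->
    (alen r <= alen b)%ZZ /\
    (alen b = alen r -> reduces b [:: (r, 0%N)]).

Ltac stop := apply: reduces_eq; aff_eq.

Lemma abs_bounds z : (z <= Z.abs z /\ - z <= Z.abs z)%ZZ.
Proof. lia. Qed.
Lemma abs_cases z k : Z.abs z = k -> (z = k \/ z = - k)%ZZ.
Proof. lia. Qed.

Ltac abs_value := repeat match goal with |- context [Z.abs ?z] =>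
  first [rewrite (Z.abs_eq z); [|lia] | rewrite (Z.abs_neq z); [|lia]] end.
(** Forgets everything about absolute values but the inequalities
    z <= |z| and - z <= |z|, which suffice for lower bounds of the length. *)
Ltac abs_linear := repeat match goal with |- context [Z.abs ?z] =>
  move: (Z.abs z) (abs_bounds z) => ? [? ?] end.

(** In each of the following proofs the length is a sum of absolute values whose
    minimum on the class is attained at a few points; from each of these a
    short sequence of conjugations leads to the chosen representative. *)
Lemma minimal_rep_refl2 k : (1 <= k)%ZZ -> minimal_rep (rep_refl2 k).
Proof.
move=> hk; have lr : alen (rep_refl2 k) = (4 * k + 1)%ZZ by rewrite /alen /=; abs_value; lia.
have cr : class_inv (rep_refl2 k) = (2%N, 2 * k, 0)%ZZ by rewrite /class_inv /=; abs_value; congr (_, _, _); lia.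
move=> [x y u]; rewrite cr lr; case: u; rewrite /class_inv => // -[/abs_cases e].
- have lb : (4 * k + 1 <= alen (Aff x y R2) /\ (alen (Aff x y R2) = 4 * k + 1 -> y = 0 \/ y = 2))%ZZ.
    by case: e => e; rewrite /alen /=; abs_linear; lia.
  split=> [|/(proj2 lb) ey]; first by case: lb.
  rewrite /rep_refl2; case: e ey {lb} => ex [] ey; subst y.
  + have -> : x = k by [lia]; stop.
  + have -> : (x = k - 1)%ZZ by [lia]; go G0; go G1; go_tau; stop.
  + have -> : (x = - k)%ZZ by [lia]; go G0; stop.
  + have -> : (x = - k - 1)%ZZ by [lia]; go G1; go_tau; stop.
- have lb : (4 * k + 1 <= alen (Aff x y R121) /\
      (alen (Aff x y R121) = 4 * k + 1 -> 2 * x + y = 0 \/ 2 * x + y = 2))%ZZ.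
    by case: e => e; rewrite /alen /=; abs_linear; lia.
  split=> [|/(proj2 lb) ex]; first by case: lb.
  rewrite /rep_refl2; case: e ex {lb} => ey [] ex; subst y.
  + have -> : (x = - k)%ZZ by [lia]; go G1; stop.
  + have -> : (x = 1 - k)%ZZ by [lia]; go G2; go_tau; stop.
  + have -> : (x = k)%ZZ by [lia]; go G1; go G0; stop.
  + have -> : (x = k + 1)%ZZ by [lia]; go_tau; stop.
Qed.

Lemma minimal_rep_refl1_even j : (1 <= j)%ZZ -> minimal_rep (Aff 0 (2 * j) R1).
Proof.
move=> hj; have lr : alen (Aff 0 (2 * j) R1) = (6 * j + 1)%ZZ by rewrite /alen /=; abs_value; lia.
have cr : class_inv (Aff 0 (2 * j) R1) = (1%N, 2 * j, 0)%ZZ.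
  by rewrite /class_inv; congr (_, _, _); [lia|mod_lia].
move=> [x y u]; rewrite cr lr; case: u; rewrite /class_inv => // -[/abs_cases e /Z.mod_divide] [//|p yE]; subst y.
- have lb : (6 * j + 1 <= alen (Aff x (p * 2) R1) /\
      (alen (Aff x (p * 2) R1) = 6 * j + 1 -> x = 0 \/ x = 2))%ZZ.
    by case: e => e; rewrite /alen /=; abs_linear; lia.
  split=> [|/(proj2 lb) ex]; first by case: lb.
  case: e ex {lb} => ey [] ex; subst x.
  + have -> : (p = j)%ZZ by [lia]; stop.
  + have -> : (p = j - 1)%ZZ by [lia]; go G0; go G1; go G2; stop.
  + have -> : (p = - j)%ZZ by [lia]; go_tau; stop.
  + have -> : (p = - j - 1)%ZZ by [lia]; go G0; go G2; stop.
- have lb : (6 * j + 1 <= alen (Aff x (p * 2) R212) /\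
      (alen (Aff x (p * 2) R212) = 6 * j + 1 -> x + p * 2 = 0 \/ x + p * 2 = 2))%ZZ.
    by case: e => e; rewrite /alen /=; abs_linear; lia.
  split=> [|/(proj2 lb) ey]; first by case: lb.
  case: e ey {lb} => ex [] ey; subst x.
  + have -> : (p = - j)%ZZ by [lia]; go G2; stop.
  + have -> : (p = 1 - j)%ZZ by [lia]; go G1; go G0; stop.
  + have -> : (p = j)%ZZ by [lia]; go G2; go_tau; stop.
  + have -> : (p = 1 + j)%ZZ by [lia]; go G0; stop.
Qed.

Lemma minimal_rep_refl1_odd j : (0 <= j)%ZZ -> minimal_rep (Aff 1 (2 * j) R1).
Proof.
move=> hj; have lr : alen (Aff 1 (2 * j) R1) = (6 * j + 3)%ZZ by rewrite /alen /=; abs_value; lia.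
have cr : class_inv (Aff 1 (2 * j) R1) = (1%N, 2 * j + 1, 0)%ZZ.
  by rewrite /class_inv; congr (_, _, _); [lia|mod_lia].
move=> [x y u]; rewrite cr lr; case: u; rewrite /class_inv => // -[/abs_cases e /Z.mod_divide] [//|p yE]; subst y.
- have lb : (6 * j + 3 <= alen (Aff x (p * 2) R1) /\
      (alen (Aff x (p * 2) R1) = 6 * j + 3 -> x = 1))%ZZ.
    by case: e => e; rewrite /alen /=; abs_linear; lia.
  split=> [|/(proj2 lb) ex]; first by case: lb.
  case: e ex {lb} => ey ex; subst x.
  + have -> : (p = j)%ZZ by [lia]; stop.
  + have -> : (p = - j - 1)%ZZ by [lia]; go_tau; stop.
- have lb : (6 * j + 3 <= alen (Aff x (p * 2) R212) /\
      (alen (Aff x (p * 2) R212) = 6 * j + 3 -> x + p * 2 = 1))%ZZ.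
    by case: e => e; rewrite /alen /=; abs_linear; lia.
  split=> [|/(proj2 lb) ey]; first by case: lb.
  case: e ey {lb} => ex ey; subst x.
  + have -> : (p = - j)%ZZ by [lia]; go G2; stop.
  + have -> : (p = j + 1)%ZZ by [lia]; go G0; stop.
Qed.

Lemma minimal_rep_refl1 k : (1 <= k)%ZZ -> minimal_rep (rep_refl1 k).
Proof.
move=> hk; rewrite /rep_refl1; have := Z.div2_odd k; rewrite -Z.negb_odd.
case: (Z.odd k) => /= kE.
  by rewrite (_ : Aff 1 (k - 1) R1 = Aff 1 (2 * Z.div2 k) R1); [apply: minimal_rep_refl1_odd; lia|aff_eq].
by rewrite (_ : Aff 0 k R1 = Aff 0 (2 * Z.div2 k) R1); [apply: minimal_rep_refl1_even; lia|aff_eq].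
Qed.

Lemma minimal_rep_coxeter : minimal_rep rep_coxeter.
Proof.
have lr : alen rep_coxeter = 2%ZZ by [].
have cr : class_inv rep_coxeter = (3%N, 0, 0)%ZZ by [].
move=> [x y u]; rewrite cr lr; case: u; rewrite /class_inv => // -[/Z.mod_divide] [//|p yE]; subst y.
- have lb : (2 <= alen (Aff x (p * 2) R12) /\
      (alen (Aff x (p * 2) R12) = 2 -> p = 0 /\ (x = 0 \/ x = 1)))%ZZ.
    by rewrite /alen /=; abs_linear; lia.
  split=> [|/(proj2 lb) [-> [] ->]]; first by case: lb.
    by go G1; go_tau; stop.
  by stop.
- have lb : (2 <= alen (Aff x (p * 2) R21) /\
      (alen (Aff x (p * 2) R21) = 2 -> x = 0 /\ p = 0 \/ x = -1 /\ p = 1))%ZZ.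
    by rewrite /alen /=; abs_linear; lia.
  split=> [|/(proj2 lb) [] [-> ->]]; first by case: lb.
    by go_tau; stop.
  by go G0; stop.
Qed.

Lemma minimal_rep_translation X Y : (1 <= Y < X)%ZZ -> minimal_rep (plane_aff X Y Id).
Proof.
move=> hXY; have lr : alen (plane_aff X Y Id) = (4 * X + 2 * Y)%ZZ by rewrite /alen /=; abs_value; lia.
have cr : class_inv (plane_aff X Y Id) = (0%N, 2 * X, 2 * Y)%ZZ.
  by rewrite /class_inv /plane_aff; abs_value; rewrite Z.max_l ?Z.min_r; try lia; congr (_, _, _); lia.
move=> [x y u]; rewrite cr lr; case: u; rewrite /class_inv => // -[eM em].
have : (Z.abs (2 * x + y) = 2 * X /\ Z.abs y = 2 * Y \/
        Z.abs (2 * x + y) = 2 * Y /\ Z.abs y = 2 * X)%ZZ.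
  by move: eM em; move: (Z.abs (2 * x + y)) (Z.abs y) => A B; lia.
rewrite /plane_aff => {eM em} -[] [/abs_cases ex /abs_cases ey]; case: ey => ey; subst y; case: ex => ex.
- have -> : (x = X - Y)%ZZ by [lia]; split; [by rewrite /alen /=; abs_value; lia|move=> _; stop].
- have -> : (x = - X - Y)%ZZ by [lia]; split; [by rewrite /alen /=; abs_value; lia|move=> _; go G0; stop].
- have -> : (x = X + Y)%ZZ by [lia]; split; [by rewrite /alen /=; abs_value; lia|move=> _; go G2; stop].
- have -> : (x = - X + Y)%ZZ by [lia]; split; [by rewrite /alen /=; abs_value; lia|move=> _; go G0; go G2; stop].
- have -> : (x = Y - X)%ZZ by [lia]; split; [by rewrite /alen /=; abs_value; lia|move=> _; go G1; stop].
- have -> : (x = - Y - X)%ZZ by [lia]; split; [by rewrite /alen /=; abs_value; lia|move=> _; go G0; go G1; stop].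
- have -> : (x = Y + X)%ZZ by [lia]; split; [by rewrite /alen /=; abs_value; lia|move=> _; go G1; go G0; stop].
- have -> : (x = - Y + X)%ZZ by [lia]; split; [by rewrite /alen /=; abs_value; lia|move=> _; go_tau; stop].
Qed.

(** * The elements w~_1, ..., w~_8 *)

(** The terms may be replaced by elements of the same length in the same class,
    for instance by their inverses. *)
Definition expands (a : affine) (N D : Z) : Prop :=
  exists P, [/\ reduces_to a P,
    forall x e, P x e -> exists r, [/\ expansion N D r e, class_inv x = class_inv r & alen x = alen r] &
    forall r e, expansion N D r e -> exists2 x, P x e & class_inv x = class_inv r].

Lemma expands_direct a N D : reduces_to a (expansion N D) -> expands a N D.
Proof. by move=> h; exists (expansion N D); split=> // x e hx; exists x. Qed.

Lemma expands_inv a N D : reduces_to (aff_inv a) (expansion N D) -> expands a N D.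
Proof.
move=> /reduces_to_inv; rewrite aff_invK => h; eexists; split; first exact: h.
  by move=> x e hx; exists (aff_inv x); rewrite class_inv_inv alen_inv.
by move=> r e hr; exists (aff_inv r); rewrite ?aff_invK ?class_inv_inv.
Qed.

Lemma expands_at a N D N' D' : N' = N -> D' = D -> expands a N D -> expands a N' D'.
Proof. by move=> -> ->. Qed.

(** The common bound for the two families O'_(6k+3) and O'_(6k+1): the class
    O'(k) occurs for 1 <= k <= D. *)
Definition bound6 (i : nat) (m n : int) : int :=
  match i with
  | 1 => n | 2 => n - 1 | 3 | 7 => 2 * m + n - 1 | 6 => 2 * m + n
  | _ => 2 * m + n - 2
  end.

Lemma reduces_to_at a b P : a = b -> reduces_to b P -> reduces_to a P.
Proof. by move=> ->. Qed.

(** The elements w~_1, w~_2, w~_6, w~_7 and w~_8 are linked by length preserving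
    moves to [cox21] or [cox12], while for w~_3, w~_4 and w~_5 this is true of
    the inverses. *)
Lemma expands_w_tilde (m n : int) (i : nat) (w : extended) :
  1 <= m -> 1 <= n -> (1 <= i <= 8)%N -> w \in w_tilde i m n ->
  exists2 a, w = ext_of a &
    expands a (Z_of_int (bound4_1 i m n)) (Z_of_int (bound6 i m n)).
Proof.
move=> hm hn hi hw.
have [M mE] : exists M, m = int_of_Z M by exists (Z_of_int m); rewrite Z_of_intK.
have [K nE] : exists K, n = int_of_Z K by exists (Z_of_int n); rewrite Z_of_intK.
subst m n; have {hm} hM : (1 <= M)%ZZ by lia.
have {hn} hK : (1 <= K)%ZZ by lia.
case: i hi hw => [//|[|[|[|[|[|[|[|[|//]]]]]]]]] _;
  rewrite !inE ?cwE ?ext_of_words /bound4_1 /bound6 /=.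
- move=> /eqP->; eexists; first reflexivity.
  have h : reduces_to (cox21 (K - 1) K) (expansion (K - 1) K).
    by apply: (@reduces_coxeter _ _ _).1; lia.
  (apply: (@expands_at _ (K - 1)%ZZ K); [lia|lia|apply: expands_direct]).
  by apply: reduces_to_at h; rewrite /cox21; aff_eq.
- have h : reduces_to (cox12 (K - 1) (K - 1)) (expansion (K - 1) (K - 1)).
    by apply: (@reduces_coxeter _ _ _).2; lia.
  move=> /or3P[] /eqP->; eexists; try reflexivity; (apply: (@expands_at _ (K - 1)%ZZ (K - 1)%ZZ); [lia|lia|apply: expands_direct]).
  + rewrite (_ : Aff _ _ _ = Aff (- K) (2 * K) R21); last aff_eq.
    by go G1; apply: reduces_to_at h; rewrite /cox12; aff_eq.
  + by apply: reduces_to_at h; rewrite /cox12; aff_eq.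
  + rewrite (_ : Aff _ _ _ = Aff (1 - K) (2 * K - 2) R12); last aff_eq.
    by go G2; go_tau; apply: reduces_to_at h; rewrite /cox12; aff_eq.
- have h : reduces_to (cox12 (M + K - 1) (2 * M + K - 1)) (expansion (M + K - 1) (2 * M + K - 1)).
    by apply: (@reduces_coxeter _ _ _).2; lia.
  move=> /orP[] /eqP->; eexists; try reflexivity; (apply: (@expands_at _ (M + K - 1)%ZZ (2 * M + K - 1)%ZZ); [lia|lia|apply: expands_inv]).
  + rewrite (_ : aff_inv _ = Aff (- K) (2 * M + 2 * K) R21); last aff_eq.
    by go G1; apply: reduces_to_at h; rewrite /cox12; aff_eq.
  + by apply: reduces_to_at h; rewrite /cox12; aff_eq.
- have h : reduces_to (cox12 (M + K - 1) (2 * M + K - 2)) (expansion (M + K - 1) (2 * M + K - 2)).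
    by apply: (@reduces_coxeter _ _ _).2; lia.
  move=> /eqP->; eexists; first reflexivity; (apply: (@expands_at _ (M + K - 1)%ZZ (2 * M + K - 2)%ZZ); [lia|lia|apply: expands_inv]).
  rewrite (_ : aff_inv _ = Aff (1 - 2 * M - K) (2 * M) R21); last aff_eq.
  by go G0; apply: reduces_to_at h; rewrite /cox12; aff_eq.
- have h : reduces_to (cox21 (M + K - 2) (2 * M + K - 2)) (expansion (M + K - 2) (2 * M + K - 2)).
    by apply: (@reduces_coxeter _ _ _).1; lia.
  move=> /eqP->; eexists; first reflexivity; (apply: (@expands_at _ (M + K - 2)%ZZ (2 * M + K - 2)%ZZ); [lia|lia|apply: expands_inv]).
  by go_tau; apply: reduces_to_at h; rewrite /cox21; aff_eq.
- have h : reduces_to (cox21 (M + K - 1) (2 * M + K)) (expansion (M + K - 1) (2 * M + K)).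
    by apply: (@reduces_coxeter _ _ _).1; lia.
  move=> /eqP->; eexists; first reflexivity; (apply: (@expands_at _ (M + K - 1)%ZZ (2 * M + K)%ZZ); [lia|lia|apply: expands_direct]).
  by apply: reduces_to_at h; rewrite /cox21; aff_eq.
- have h : reduces_to (cox12 (M + K - 1) (2 * M + K - 1)) (expansion (M + K - 1) (2 * M + K - 1)).
    by apply: (@reduces_coxeter _ _ _).2; lia.
  move=> /orP[] /eqP->; eexists; try reflexivity; (apply: (@expands_at _ (M + K - 1)%ZZ (2 * M + K - 1)%ZZ); [lia|lia|apply: expands_direct]).
  + by apply: reduces_to_at h; rewrite /cox12; aff_eq.
  + rewrite (_ : Aff _ _ _ = Aff (- K) (2 * M + 2 * K) R21); last aff_eq.
    by go G1; apply: reduces_to_at h; rewrite /cox12; aff_eq.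
- have h : reduces_to (cox12 (M + K - 1) (2 * M + K - 2)) (expansion (M + K - 1) (2 * M + K - 2)).
    by apply: (@reduces_coxeter _ _ _).2; lia.
  move=> /eqP->; eexists; first reflexivity; (apply: (@expands_at _ (M + K - 1)%ZZ (2 * M + K - 2)%ZZ); [lia|lia|apply: expands_direct]).
  rewrite (_ : Aff _ _ _ = Aff (2 - 2 * M - K) (2 * M + 2 * K - 2) R12); last aff_eq.
  by go G2; go_tau; apply: reduces_to_at h; rewrite /cox12; aff_eq.
Qed.

(** * Laurent polynomials and the specialization v = 1 *)
Lemma val_laurentM (x y : laurent) : \val (x * y) = \val x * \val y.
Proof. exact: rmorphM. Qed.

Lemma val_laurentD (x y : laurent) : \val (x + y) = \val x + \val y.
Proof. exact: rmorphD. Qed.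
Lemma val_laurent_int (c : int) : \val (c%:~R : laurent) = c%:~R.
Proof. exact: rmorph_int. Qed.
Lemma val_laurentX (x : laurent) k : \val (x ^+ k) = \val x ^+ k.
Proof. exact: rmorphXn. Qed.
Lemma val_laurent0 : \val (0 : laurent) = 0.
Proof. exact: rmorph0. Qed.

Definition at_v (p : {poly int}) : laurent := (map_poly intr p).[v].

Lemma at_vD p p' : at_v (p + p') = at_v p + at_v p'.
Proof. by rewrite /at_v rmorphD hornerD. Qed.
Lemma at_vM p p' : at_v (p * p') = at_v p * at_v p'.
Proof. by rewrite /at_v rmorphM hornerM. Qed.
Lemma at_vC c : at_v c%:P = c%:~R.
Proof. by rewrite /at_v map_polyC hornerC. Qed.
Lemma at_v0 : at_v 0 = 0.
Proof. by rewrite /at_v rmorph0 horner0. Qed.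
Lemma at_v1 : at_v 1 = 1.
Proof. by rewrite /at_v rmorph1 hornerC. Qed.
Lemma at_vX : at_v 'X = v.
Proof. by rewrite /at_v map_polyX hornerX. Qed.
Lemma at_vXn k : at_v 'X^k = v ^+ k.
Proof. by elim: k => [|k IH]; rewrite ?expr0 ?at_vC // !exprS at_vM at_vX IH. Qed.

Lemma val_at_v p : \val (at_v p) = tofrac p.
Proof.
elim/poly_ind: p => [|p c IH]; first by rewrite /at_v map_poly0 horner0 tofrac0.
rewrite at_vD at_vM at_vX at_vC val_laurentD val_laurentM IH tofracD tofracM; congr (_ + _).
by rewrite val_laurent_int -[c in RHS]intz (rmorph_int (@polyC int)) (rmorph_int (@tofrac {poly int})).
Qed.

Lemma at_v_inj : injective at_v.
Proof. by move=> p p' /(congr1 val); rewrite !val_at_v => /eqP; rewrite tofrac_eq => /eqP. Qed.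

Lemma laurentP (x : laurent) : exists p k, x * v ^+ k = at_v p.
Proof.
have /asboolP[p [k pk]] := valP x; exists p, k; apply: val_inj.
by rewrite val_at_v -pk val_laurentM val_laurentX.
Qed.

Lemma laurent_mulf_eq0 (x y : laurent) : x * y = 0 -> x = 0 \/ y = 0.
Proof.
move=> /(congr1 val); rewrite val_laurentM val_laurent0 => /eqP; rewrite mulf_eq0.
by case/orP => /eqP e; [left|right]; apply: val_inj; rewrite e val_laurent0.
Qed.

Lemma v_neq0 : v <> 0.
Proof. by move=> /(congr1 val) /eqP; rewrite val_laurent0 /= tofrac_eq0 polyX_eq0. Qed.

Lemma vX_neq0 k : v ^+ k <> 0.
Proof.
elim: k => [|k IH]; first by rewrite expr0 => /eqP; rewrite oner_eq0.
by rewrite exprS => /laurent_mulf_eq0[/v_neq0|/IH].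
Qed.

(** c is the value of x at v = 1. *)
Definition specializes (x : laurent) (c : int) : Prop :=
  exists p k, x * v ^+ k = at_v p /\ p.[1] = c.

Lemma specializesD x y c d : specializes x c -> specializes y d ->
  specializes (x + y) (c + d).
Proof.
move=> [p [k [xp <-]]] [p' [k' [yp <-]]]; exists (p * 'X^k' + p' * 'X^k), (k + k')%N.
rewrite at_vD !at_vM !at_vXn -xp -yp mulrDl exprD mulrA; split.
  by congr (_ + _); rewrite mulrCA mulrC.
by rewrite hornerD !hornerM !hornerXn !expr1n !mulr1.
Qed.

Lemma specializesM x y c d : specializes x c -> specializes y d ->
  specializes (x * y) (c * d).
Proof.
move=> [p [k [xp <-]]] [p' [k' [yp <-]]]; exists (p * p'), (k + k')%N.
by rewrite at_vM -xp -yp exprD mulrACA hornerM.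
Qed.

Lemma specializesC c : specializes c%:~R c.
Proof. by exists c%:P, 0%N; rewrite expr0 mulr1 at_vC hornerC. Qed.
Lemma specializes0 : specializes 0 0.
Proof. exact: specializesC 0. Qed.
Lemma specializes1 : specializes 1 1.
Proof. exact: specializesC 1. Qed.
Lemma specializes_v : specializes v 1.
Proof. by exists 'X, 0%N; rewrite expr0 mulr1 at_vX hornerX. Qed.
Lemma specializes_v_inv : specializes v_inv 1.
Proof. by exists 1, 1%N; rewrite expr1 mulrC v_mul_inv at_v1 hornerC. Qed.
Lemma specializesN x c : specializes x c -> specializes (- x) (- c).
Proof. by move=> h; rewrite -mulN1r -[- c]mulN1r; apply: specializesM h; exact: specializesC (-1). Qed.
Lemma specializes_q : specializes q 0.
Proof. by rewrite -(subrr 1); apply: specializesD specializes_v (specializesN specializes_v_inv). Qed.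
Lemma specializes_sum (I : Type) (r : seq I) (F : I -> laurent) (c : I -> int) :
  (forall i, specializes (F i) (c i)) ->
  specializes (\sum_(i <- r) F i) (\sum_(i <- r) c i).
Proof.
move=> h; elim: r => [|i r IH]; first by rewrite !big_nil; exact: specializes0.
by rewrite !big_cons; apply: specializesD.
Qed.
Lemma specializes_0 c : specializes 0 c -> c = 0.
Proof.
move=> [p [k [+ <-]]]; rewrite mul0r -at_v0 => /at_v_inj <-.
by rewrite horner0.
Qed.

(** After multiplication by a power of v the coefficients are polynomials in v.
    Their values at v = 1 satisfy the specialized relations, hence vanish.  So
    all of them are divisible by v - 1; the quotients satisfy the same relations
    and have smaller degree. *)
Lemma specialization_argument (J : eqType) (r : seq J) (F : Type) (theta : F -> J -> laurent)
    (c : F -> J -> int) (g : J -> laurent) :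
  uniq r -> (forall f j, specializes (theta f j) (c f j)) ->
  (forall z : J -> int, (forall f, \sum_(j <- r) z j * c f j = 0) -> {in r, forall j, z j = 0}) ->
  (forall f, \sum_(j <- r) g j * theta f j = 0) -> {in r, forall j, g j = 0}.
Proof.
move=> ur sp inj rel.
have [P [K PK]] : exists (P : J -> {poly int}) (K : nat), {in r, forall j, g j * v ^+ K = at_v (P j)}.
  elim: r ur {inj rel} => [|j r IH] /=; first by exists (fun=> 0), 0%N.
  move=> /andP[jr /IH[P [K PK]]]; have [p [k pk]] := laurentP (g j).
  exists (fun i => if i == j then p * 'X^K else P i * 'X^k), (K + k)%N => i.
  rewrite inE; case: eqP => [-> _|_ /= ir]; rewrite at_vM at_vXn.
    by rewrite -pk exprD mulrA [LHS]mulrAC.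
  by rewrite -PK // exprD mulrA.
suff P0 : {in r, forall j, P j = 0}.
  move=> j jr; have := PK j jr; rewrite P0 // at_v0.
  by move=> /laurent_mulf_eq0[//|/vX_neq0].
have {rel} : forall f, \sum_(j <- r) at_v (P j) * theta f j = 0.
  move=> f; transitivity ((\sum_(j <- r) g j * theta f j) * v ^+ K); last by rewrite rel mul0r.
  rewrite mulr_suml; by apply: eq_big_seq => j jr; rewrite -PK // mulrAC.
have : exists n, forall j, j \in r -> (size (P j) <= n)%N.
  exists (\max_(j <- r) size (P j))%N => j jr.
  by rewrite (big_rem _ jr) leq_maxl.
move=> {PK} [n]; elim: n P => [|n IH] P hn rel.
  by move=> j /hn; rewrite leqn0 size_poly_eq0 => /eqP.
have P1 : {in r, forall j, (P j).[1] = 0}.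
  apply: inj => f; apply: specializes_0; rewrite -(rel f).
  apply: specializes_sum => j; apply: specializesM; last exact: sp.
  by exists (P j), 0%N; rewrite expr0 mulr1.
have [Q PQ] : exists Q, {in r, forall j, P j = Q j * ('X - 1%:P)}.
  have : forall j, exists Qj, j \in r -> P j = Qj * ('X - 1%:P).
    move=> j; have [jr|_] := boolP (j \in r); last by exists 0.
    by have /factor_theorem[Qj] : root (P j) 1 by [apply/rootP/P1]; exists Qj.
  by move=> /choice[Q hQ]; exists Q => j /hQ.
have v1 : at_v ('X - 1%:P) <> 0.
  rewrite -at_v0 => /at_v_inj /eqP; rewrite polyXsubC_eq0 //.
have Q0 : {in r, forall j, Q j = 0}.
  apply: IH => [j jr|f].
    have := hn j jr; rewrite PQ //; have [->|Qj] := eqVneq (Q j) 0; first by rewrite size_poly0.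
    by rewrite size_Mmonic ?monicXsubC // size_XsubC addn2.
  have := rel f; rewrite (eq_big_seq (fun j => at_v (Q j) * theta f j * at_v ('X - 1%:P))).
    by rewrite -mulr_suml => /laurent_mulf_eq0[].
  by move=> j jr; rewrite PQ // at_vM mulrAC.
by move=> j jr; rewrite PQ // Q0 // mul0r.
Qed.

(** * Coordinates in the basis T_w *)
Section LinearExtension.
Variables (H : algType laurent) (T : extended -> H).
Hypothesis HT : is_hecke_algebra T.

Definition coef (h : H) : extended -> laurent :=
  let: And3 hb _ _ := HT in sval (cid (hb h)).

Lemma coefP h : finite_set [set w | coef h w != 0] /\
  h = \sum_(w \in [set: extended]) (coef h w *: T w).
Proof. by rewrite /coef; case: HT => hb _ _; case: cid => c [[]]. Qed.

Lemma coef_unique h c : finite_set [set w | c w != 0] ->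
  h = \sum_(w \in [set: extended]) (c w *: T w) -> coef h = c.
Proof. by rewrite /coef; case: HT => hb _ _; case: cid => d [hd u] fc hc /=; exact: u. Qed.

Lemma fsum_supp (V : nmodType) (c : extended -> laurent) (F : extended -> V) (s : seq extended) :
  [set w | c w != 0] `<=` [set` s] -> (forall w, c w = 0 -> F w = 0) ->
  \sum_(w \in [set: extended]) F w = \sum_(w <- undup s) F w.
Proof.
move=> cs F0; apply: fsum_seq; rewrite ?undup_uniq // => w _.
rewrite mem_undup => ws; apply: F0; apply/eqP; apply: contraNT ws => cw.
exact: cs.
Qed.

Lemma coef_seq h : exists s : seq extended, [set w | coef h w != 0] `<=` [set` s].
Proof. by have [/finite_seqP[s ->] _] := coefP h; exists s. Qed.

Lemma coefD h h' : coef (h + h') = (fun w => coef h w + coef h' w).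
Proof.
have [s hs] := coef_seq h; have [s' hs'] := coef_seq h'.
have sub : [set w | coef h w + coef h' w != 0] `<=` [set` s ++ s'].
  move=> w /=; rewrite mem_cat; have [e|/hs->//] := eqVneq (coef h w) 0.
  by have [e'|/hs'->] := eqVneq (coef h' w) 0; rewrite ?orbT // e e' addr0 eqxx.
apply: coef_unique; first by apply: sub_finite_set sub _; exact: finite_seq.
rewrite (fsum_supp sub); last by move=> w ->; rewrite scale0r.
rewrite [in LHS](coefP h).2 [in LHS](coefP h').2.
rewrite (@fsum_supp _ (coef h) _ (s ++ s')); last by move=> w ->; rewrite scale0r.
  rewrite (@fsum_supp _ (coef h') _ (s ++ s')); last by move=> w ->; rewrite scale0r.
    by rewrite -big_split; apply: eq_bigr => w _; rewrite scalerDl.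
  by move=> w /hs' /=; rewrite mem_cat => ->; rewrite orbT.
by move=> w /hs /=; rewrite mem_cat => ->.
Qed.

Lemma coefZ c h : coef (c *: h) = (fun w => c * coef h w).
Proof.
have [s hs] := coef_seq h.
have sub : [set w | c * coef h w != 0] `<=` [set` s].
  by move=> w /=; have [->|/hs//] := eqVneq (coef h w) 0; rewrite mulr0 eqxx.
apply: coef_unique; first by apply: sub_finite_set sub _; exact: finite_seq.
rewrite (fsum_supp sub); last by move=> w ->; rewrite scale0r.
rewrite [in LHS](coefP h).2 (fsum_supp hs); last by move=> w ->; rewrite scale0r.
by rewrite scaler_sumr; apply: eq_bigr => w _; rewrite scalerA.
Qed.

Lemma coefT w : coef (T w) = (fun w' => (w' == w)%:R).
Proof.
have sub : [set w' | (w' == w)%:R != 0 :> laurent] `<=` [set` [:: w]].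
  by move=> w' /=; rewrite inE; case: (w' == _) => //; rewrite (mulr0n (1 : laurent)) eqxx.
apply: coef_unique; first by apply: sub_finite_set sub _; exact: finite_seq.
rewrite (fsum_supp sub); last by move=> w' ->; rewrite scale0r.
by rewrite big_seq1 eqxx scale1r.
Qed.

(** The linear form on H with given values on the basis. *)
Definition lin_ext (theta : affine -> laurent) (h : H) : laurent :=
  \sum_(w \in [set: extended]) coef h w * theta (sval (cid (ext_of_surj w))).

Lemma lin_extD theta h h' : lin_ext theta (h + h') = lin_ext theta h + lin_ext theta h'.
Proof.
have [s hs] := coef_seq h; have [s' hs'] := coef_seq h'.
rewrite /lin_ext coefD (@fsum_supp _ (fun w => coef h w + coef h' w) _ (s ++ s')); last first.
- by move=> w ->; rewrite mul0r.
- move=> w /=; rewrite mem_cat; have [e|/hs->//] := eqVneq (coef h w) 0.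
  by have [e'|/hs'->] := eqVneq (coef h' w) 0; rewrite ?orbT // e e' addr0 eqxx.
rewrite (@fsum_supp _ (coef h) _ (s ++ s')); last by move=> w ->; rewrite mul0r.
  rewrite (@fsum_supp _ (coef h') _ (s ++ s')); last by move=> w ->; rewrite mul0r.
    by rewrite -big_split; apply: eq_bigr => w _; rewrite mulrDl.
  by move=> w /hs' /=; rewrite mem_cat => ->; rewrite orbT.
by move=> w /hs /=; rewrite mem_cat => ->.
Qed.

Lemma lin_extZ theta c h : lin_ext theta (c *: h) = c * lin_ext theta h.
Proof.
have [s hs] := coef_seq h.
rewrite /lin_ext coefZ (@fsum_supp _ (fun w => c * coef h w) _ s); last first.
- by move=> w ->; rewrite mul0r.
- by move=> w /=; have [->|/hs//] := eqVneq (coef h w) 0; rewrite mulr0 eqxx.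
rewrite (fsum_supp hs); last by move=> w ->; rewrite mul0r.
by rewrite mulr_sumr; apply: eq_bigr => w _; rewrite mulrA.
Qed.

Lemma lin_extT theta a : lin_ext theta (Taff T a) = theta a.
Proof.
rewrite /lin_ext /Taff coefT (@fsum_supp _ (fun w' => (w' == ext_of a)%:R) _ [:: ext_of a]).
- rewrite big_seq1 eqxx mul1r; case: cid => b /= /ext_of_inj -> //.
- by move=> w' /=; rewrite inE; case: (w' == _) => //; rewrite (mulr0n (1 : laurent)) eqxx.
- by move=> w' ->; rewrite mul0r.
Qed.

Lemma lin_ext0 theta : lin_ext theta 0 = 0.
Proof. by rewrite -(scale0r (0 : H)) lin_extZ mul0r. Qed.
End LinearExtension.

(** * Modules over the Hecke algebra and their twisted traces *)
Definition gen_tau (s : gen) : gen := match s with G0 => G2 | G1 => G1 | G2 => G0 end.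

Lemma wall_gen s a : wall s (agen s * a) = (- 1 - wall s a)%ZZ.
Proof. by case: a => x y u; case: s; case: u; rewrite /wall /=; lia. Qed.
Lemma wall_tau s a : wall (gen_tau s) (atau * a) = wall s a.
Proof. by case: a => x y u; case: s; case: u; rewrite /wall /=; lia. Qed.
Lemma aff_tau_gen s a : (atau * (agen s * a))%A = (agen (gen_tau s) * (atau * a))%A.
Proof. by case: a => x y u; case: s; case: u; aff_eq. Qed.

Definition commuting (s t : gen) : bool :=
  match s, t with G0, G2 | G2, G0 => true | _, _ => false end.
Definition gen_eq (s t : gen) : bool :=
  match s, t with G0, G0 | G1, G1 | G2, G2 => true | _, _ => false end.
Lemma gen_eqP s t : reflect (s = t) (gen_eq s t).
Proof. by case: s; case: t; constructor. Qed.

(** An alcove beyond two walls of the base alcove is beyond all the hyperplanes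
    through their intersection.  So if s and t are both left descents of a, then
    every reduced word in s and t for the longest element of the dihedral group
    that they generate can be removed from the left of a. *)
Lemma wall_pair s t a : s <> t -> (wall s a < 0)%ZZ -> (wall t a < 0)%ZZ ->
  (wall t (agen s * a) < 0)%ZZ.
Proof. by case: a => x y u; case: s; case: t => //; case: u; rewrite /wall /=; lia. Qed.
Lemma wall_pair4 s t a : s <> t -> ~~ commuting s t ->
  (wall s a < 0)%ZZ -> (wall t a < 0)%ZZ ->
  (wall s (agen t * (agen s * a)) < 0)%ZZ /\
  (wall t (agen s * (agen t * (agen s * a))) < 0)%ZZ.
Proof. by case: a => x y u; case: s; case: t => //; case: u; rewrite /wall /=; lia. Qed.
Lemma agen_commute s t a : commuting s t ->
  (agen s * (agen t * a))%A = (agen t * (agen s * a))%A.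
Proof. by case: a => x y u; case: s; case: t => // _; case: u; aff_eq. Qed.
Lemma agen_braid s t a : s <> t -> ~~ commuting s t ->
  (agen s * (agen t * (agen s * (agen t * a))))%A = (agen t * (agen s * (agen t * (agen s * a))))%A.
Proof. by case: a => x y u; case: s; case: t => // _ _; case: u; aff_eq. Qed.

(** Induction along reduced words. *)
Lemma affine_ind_up (P : affine -> Prop) : P aff_one -> P atau ->
  (forall s a, (0 <= wall s a)%ZZ -> P a -> P (agen s * a)%A) -> forall a, P a.
Proof.
move=> P1 Pt Ps a; have [k hk] : exists k, Z.to_nat (alen a) = k by exists (Z.to_nat (alen a)).
elim/ltn_ind: k a hk => k IH a hk.
case: (pselect (exists s, (wall s a < 0)%ZZ)) => [[s hs]|/forallNP h]; last first.
  have /alen_descent[->|->] // : forall s, (0 <= wall s a)%ZZ by move=> s; have := h s; lia.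
rewrite -(aff_gg s a); apply: Ps; first by rewrite wall_gen; lia.
have := alen_down hs; have := alen_ge0 (agen s * a)%A.
by move=> h1 h2; apply: (IH (Z.to_nat (alen (agen s * a)))) => //; lia.
Qed.

(** A finite free A-module with basis I.  The generator s sends the basis vector
    at i to a combination of those at [move_to s i] and at i.  Matrices are kept
    as functions, and [op] and [opt] are left multiplication by the matrices of
    s and tau. *)
Section Module.
Variable I : finType.
Variables (move_to : gen -> I -> I) (move_coef stay_coef : gen -> I -> laurent) (tau_to : I -> I).

Definition kernel := I -> I -> laurent.
Definition op (s : gen) (K : kernel) : kernel :=
  fun i j => move_coef s i * K (move_to s i) j + stay_coef s i * K i j.
Definition opt (K : kernel) : kernel := fun i j => K (tau_to i) j.
Definition kernel_id : kernel := fun i j => (i == j)%:R.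

Hypothesis op_sqr : forall s K i j, op s (op s K) i j = K i j + q * op s K i j.
Hypothesis op_braid : forall s t K i j, s <> t -> ~~ commuting s t ->
  op s (op t (op s (op t K))) i j = op t (op s (op t (op s K))) i j.
Hypothesis op_comm : forall s t K i j, commuting s t -> op s (op t K) i j = op t (op s K) i j.
Hypothesis opt_sqr : forall K i j, opt (opt K) i j = K i j.
Hypothesis opt_op : forall s K i j, opt (op s K) i j = op (gen_tau s) (opt K) i j.

Lemma kernel_ext (K K' : kernel) : (forall i j, K i j = K' i j) -> K = K'.
Proof. by move=> h; apply/funext => i; apply/funext => j. Qed.

(** The matrix products along the reduced words of an element. *)
Inductive kernel_of : affine -> kernel -> Prop :=
| kernel_one : kernel_of aff_one kernel_id
| kernel_tau : kernel_of atau (opt kernel_id)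
| kernel_gen s a K : (0 <= wall s a)%ZZ -> kernel_of a K ->
    kernel_of (agen s * a)%A (op s K).

Lemma kernel_of_exists a : exists K, kernel_of a K.
Proof.
elim/affine_ind_up: a => [||s a h [K aK]]; first by exists kernel_id; constructor.
  by exists (opt kernel_id); constructor.
by exists (op s K); constructor.
Qed.

(** Matsumoto's theorem.  Two reduced words of c beginning with s and t, with
    s different from t, can by induction be compared through an element from
    which the longest element of <s, t> has been removed; there the braid
    relation applies. *)
Lemma kernel_of_fun a K K' : kernel_of a K -> kernel_of a K' -> K = K'.
Proof.
have [n hn] : exists n, Z.to_nat (alen a) = n by exists (Z.to_nat (alen a)).
elim/ltn_ind: n a hn K K' => n IH a hn K K' aK aK'.
case: aK aK' hn => [||s b L hb bL] aK' hn.
- move e : aff_one aK' => c cK'; case: cK' e => [//|//|t d M hd _ e].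
  by have := alen_up hd; have := alen_ge0 d; rewrite -e /alen /=; lia.
- move e : atau aK' => c cK'; case: cK' e => [//|//|t d M hd _ e].
  by have := alen_up hd; have := alen_ge0 d; rewrite -e /alen /=; lia.
have lb := alen_up hb.
move e : (agen s * b)%A aK' hn => c cK'; case: cK' e => [e|e|t d M hd dM e hn].
- by rewrite e in lb; have := alen_ge0 b; move: lb; rewrite /alen /=; lia.
- by rewrite e in lb; have := alen_ge0 b; move: lb; rewrite /alen /=; lia.
have ld := alen_up hd; have b0 := alen_ge0 b.
case: (gen_eqP s t) => [est|nst].
  subst t; have {}e : b = d by rewrite -(aff_gg s b) e aff_gg.
  by subst d; congr op; apply: (IH _ _ b erefl) => //; move: hn; rewrite lb; lia.
set c' := (agen s * b)%A in e lb hn *.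
have bE : b = (agen s * c')%A by rewrite /c' aff_gg.
have dE : d = (agen t * c')%A by rewrite e aff_gg.
have ws : (wall s c' < 0)%ZZ by rewrite /c' wall_gen; lia.
have wt : (wall t c' < 0)%ZZ by rewrite e wall_gen; lia.
have nts : t <> s by move=> /esym.
have len_b : (Z.to_nat (alen b) < n)%N by rewrite -hn -e lb; lia.
have len_d : (Z.to_nat (alen d) < n)%N by rewrite -hn; lia.
have w1 := wall_pair nst ws wt; have w2 := wall_pair nts wt ws.
have up r x : (wall r x < 0)%ZZ -> (0 <= wall r (agen r * x))%ZZ by rewrite wall_gen; lia.
case: (boolP (commuting s t)) => [cst|cst].
  have [X xX] := kernel_of_exists (agen t * (agen s * c'))%A.
  have -> : L = op t X.
    apply: (IH _ len_b b erefl) => //; rewrite bE -[X in kernel_of X](aff_gg t).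
    by constructor => //; exact: up.
  have -> : M = op s X.
    apply: (IH _ len_d d erefl) => //; rewrite dE -[X in kernel_of X](aff_gg s).
    rewrite -(agen_commute _ cst) in xX.
    by constructor => //; exact: up.
  by apply: kernel_ext => i j; rewrite op_comm.
have [w3 w4] := wall_pair4 nst cst ws wt.
have cts : ~~ commuting t s by move: cst; clear; case: s; case: t.
have [w5 w6] := wall_pair4 nts cts wt ws.
have [X xX] := kernel_of_exists (agen t * (agen s * (agen t * (agen s * c'))))%A.
have -> : L = op t (op s (op t X)).
  apply: (IH _ len_b b erefl) => //; rewrite bE.
  rewrite -[X in kernel_of X](aff_gg t); constructor; first exact: up.
  rewrite -[X in kernel_of X](aff_gg s); constructor; first exact: up.
  by rewrite -[X in kernel_of X](aff_gg t); constructor => //; exact: up.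
have -> : M = op s (op t (op s X)).
  apply: (IH _ len_d d erefl) => //; rewrite dE.
  rewrite -(agen_braid _ nst cst) in xX.
  rewrite -[X in kernel_of X](aff_gg s); constructor; first exact: up.
  rewrite -[X in kernel_of X](aff_gg t); constructor; first exact: up.
  by rewrite -[X in kernel_of X](aff_gg s); constructor => //; exact: up.
by apply: kernel_ext => i j; rewrite op_braid.
Qed.

Definition kernel_at (a : affine) : kernel := sval (cid (kernel_of_exists a)).
Lemma kernel_atP a : kernel_of a (kernel_at a).
Proof. exact: svalP (cid _). Qed.

Lemma kernel_at_one : kernel_at aff_one = kernel_id.
Proof. by apply: kernel_of_fun (kernel_atP _) _; constructor. Qed.
Lemma kernel_at_up s a : (0 <= wall s a)%ZZ -> kernel_at (agen s * a) = op s (kernel_at a).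
Proof. by move=> h; apply: kernel_of_fun (kernel_atP _) _; constructor => //; exact: kernel_atP. Qed.
Lemma kernel_at_down s a i j : (wall s a < 0)%ZZ ->
  op s (kernel_at a) i j = kernel_at (agen s * a)%A i j + q * kernel_at a i j.
Proof.
move=> h; have -> : kernel_at a = op s (kernel_at (agen s * a)).
  by rewrite -kernel_at_up ?aff_gg // wall_gen; lia.
exact: op_sqr.
Qed.
Lemma kernel_at_tau a : kernel_at (atau * a) = opt (kernel_at a).
Proof.
apply: kernel_of_fun (kernel_atP _) _.
elim: (kernel_atP a) => [||s {}a K h _ IH]; first by rewrite aff_mulr1; constructor.
  rewrite -[(atau * atau)%A]/aff_one (_ : opt (opt kernel_id) = kernel_id); first by constructor.
  by apply: kernel_ext => i j; rewrite opt_sqr.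
rewrite aff_tau_gen (_ : opt (op s K) = op (gen_tau s) (opt K)); last first.
  by apply: kernel_ext => i j; rewrite opt_op.
by constructor; rewrite ?wall_tau.
Qed.

Section Trace.
Variables (H : algType laurent) (T : extended -> H).
Hypothesis HT : is_hecke_algebra T.

Definition rep (h : H) : kernel := fun i j => lin_ext HT (fun a => kernel_at a i j) h.

Lemma repD h h' i j : rep (h + h') i j = rep h i j + rep h' i j.
Proof. exact: lin_extD. Qed.
Lemma repZ c h i j : rep (c *: h) i j = c * rep h i j.
Proof. exact: lin_extZ. Qed.
Lemma rep0 i j : rep 0 i j = 0.
Proof. exact: lin_ext0. Qed.
Lemma repT a i j : rep (Taff T a) i j = kernel_at a i j.
Proof. exact: lin_extT. Qed.

Lemma rep_gen s h i j : rep (Taff T (agen s) * h) i j = op s (rep h) i j.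
Proof.
elim/(hecke_ind HT): h => [|h h' e e'|c h e|a].
- by rewrite mulr0 /op !rep0 !mulr0 addr0.
- by rewrite mulrDr repD e e' /op !repD !mulrDr addrACA.
- by rewrite -scalerAr repZ e /op !repZ mulrDr !(mulrCA c).
have opT : op s (rep (Taff T a)) i j = op s (kernel_at a) i j by rewrite /op !repT.
case: (Z_lt_le_dec (wall s a) 0) => h.
  by rewrite (Taff_down HT) // repD repZ !repT opT kernel_at_down.
by rewrite (Taff_up HT) // repT opT kernel_at_up.
Qed.

Lemma rep_tau h i j : rep (Taff T atau * h) i j = opt (rep h) i j.
Proof.
elim/(hecke_ind HT): h => [|h h' e e'|c h e|a].
- by rewrite mulr0 /opt !rep0.
- by rewrite mulrDr repD e e' /opt !repD.
- by rewrite -scalerAr repZ e /opt !repZ.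
by rewrite (Taff_mul HT) ?alen_tau // /opt !repT kernel_at_tau.
Qed.

(** Multiplicativity follows from the case where the left factor is T_s or
    T_tau, as every T_a is a product of such along a reduced word. *)
Lemma repM h h' i j : rep (h * h') i j = \sum_l rep h i l * rep h' l j.
Proof.
elim/(hecke_ind HT): h i j => [|h1 h2 e1 e2|c h e|a] i j.
- by rewrite mul0r rep0 big1 // => l _; rewrite rep0 mul0r.
- by rewrite mulrDl repD e1 e2 -big_split; apply: eq_bigr => l _; rewrite repD mulrDl.
- by rewrite -scalerAl repZ e mulr_sumr; apply: eq_bigr => l _; rewrite repZ mulrA.
under eq_bigr do rewrite repT.
have kidM g k l : \sum_m kernel_id k m * rep g m l = rep g k l.
  rewrite (bigD1 k) //= /kernel_id eqxx mul1r big1 ?addr0 // => m /negPf mk.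
  by rewrite eq_sym mk mul0r.
elim/affine_ind_up: a i j => [||s a h IH] i j.
- by rewrite kernel_at_one kidM (Taff_one HT) mul1r.
- by rewrite -[atau]aff_mulr1 kernel_at_tau kernel_at_one {1}/opt kidM aff_mulr1 rep_tau.
- rewrite -(Taff_up HT) // -mulrA rep_gen kernel_at_up // /op !IH !mulr_sumr -big_split.
  by apply: eq_bigr => l _; rewrite mulrDl !mulrA.
Qed.

(** A permutation of the basis that commutes with the action of H. *)
Variable sh : I -> I.
Hypothesis twist_bij : bijective sh.
Hypothesis twist_move_to : forall s i, move_to s (sh i) = sh (move_to s i).
Hypothesis twist_tau_to : forall i, tau_to (sh i) = sh (tau_to i).
Hypothesis twist_move_coef : forall s i, move_coef s (sh i) = move_coef s i.
Hypothesis twist_stay_coef : forall s i, stay_coef s (sh i) = stay_coef s i.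

Lemma kernel_at_twist a i j : kernel_at a (sh i) (sh j) = kernel_at a i j.
Proof.
elim/affine_ind_up: a i j => [||s a h IH] i j.
- by rewrite kernel_at_one /kernel_id (bij_eq twist_bij).
- by rewrite -[atau]aff_mulr1 kernel_at_tau kernel_at_one /opt /kernel_id twist_tau_to (bij_eq twist_bij).
- by rewrite kernel_at_up // /op twist_move_to !IH twist_move_coef twist_stay_coef.
Qed.

Lemma rep_twist h i j : rep h (sh i) (sh j) = rep h i j.
Proof.
elim/(hecke_ind HT): h => [|h h' e e'|c h e|a].
- by rewrite !rep0.
- by rewrite !repD e e'.
- by rewrite !repZ e.
- by rewrite !repT kernel_at_twist.
Qed.

(** The trace of h composed with the permutation [sh]. *)
Definition twisted_trace (h : H) : laurent := \sum_i rep h i (sh i).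

(** The usual exchange of summations; the index of one sum is shifted by [sh],
    which the action does not see. *)
Lemma twisted_traceC h h' : twisted_trace (h * h') = twisted_trace (h' * h).
Proof.
rewrite /twisted_trace.
under eq_bigr do rewrite repM.
under [RHS]eq_bigr do rewrite repM.
rewrite exchange_big; apply: eq_bigr => l _ /=.
rewrite [RHS](reindex sh) /=; last exact: onW_bij.
by apply: eq_bigr => i _; rewrite rep_twist mulrC.
Qed.

Lemma twisted_traceD h h' : twisted_trace (h + h') = twisted_trace h + twisted_trace h'.
Proof. by rewrite /twisted_trace -big_split; apply: eq_bigr => i _; rewrite repD. Qed.
Lemma twisted_traceZ c h : twisted_trace (c *: h) = c * twisted_trace h.
Proof. by rewrite /twisted_trace mulr_sumr; apply: eq_bigr => i _; rewrite repZ. Qed.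

Lemma twisted_trace_commutator h : commutator_submodule h -> twisted_trace h = 0.
Proof.
have t0 : twisted_trace 0 = 0 by rewrite -(scale0r (0 : H)) twisted_traceZ mul0r.
move=> [r ->]; elim: r => [|p r IH]; first by rewrite big_nil.
rewrite big_cons twisted_traceD IH addr0 twisted_traceZ -scaleN1r twisted_traceD.
by rewrite twisted_traceZ twisted_traceC mulN1r subrr mulr0.
Qed.

Lemma twisted_traceT a : twisted_trace (Taff T a) = \sum_i kernel_at a i (sh i).
Proof. by apply: eq_bigr => i _; rewrite repT. Qed.
Lemma twisted_trace_sum (r : seq affine) (g : affine -> laurent) :
  twisted_trace (\sum_(a <- r) g a *: Taff T a) = \sum_(a <- r) g a * \sum_i kernel_at a i (sh i).
Proof.
have t0 : twisted_trace 0 = 0 by rewrite -(scale0r (0 : H)) twisted_traceZ mul0r.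
elim: r => [|a r IH]; rewrite ?big_nil ?t0 // !big_cons.
by rewrite twisted_traceD twisted_traceZ twisted_traceT IH.
Qed.
End Trace.

(** Values of the matrix entries at v = 1. *)
Variables (move_spec stay_spec : gen -> I -> int) (kap : affine -> I -> I -> int).
Hypothesis ca_sp : forall s i, specializes (move_coef s i) (move_spec s i).
Hypothesis cb_sp : forall s i, specializes (stay_coef s i) (stay_spec s i).
Hypothesis kap_one : forall i j, kap aff_one i j = (i == j)%:R.
Hypothesis kap_tau : forall i j, kap atau i j = (tau_to i == j)%:R.
Hypothesis kap_gen : forall s a i j,
  kap (agen s * a)%A i j = move_spec s i * kap a (move_to s i) j + stay_spec s i * kap a i j.

Lemma kernel_at_specializes a i j : specializes (kernel_at a i j) (kap a i j).
Proof.
have spb (b : bool) : specializes b%:R b%:R.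
  by case: b; [exact: specializes1|exact: specializes0].
elim/affine_ind_up: a i j => [||s a h IH] i j.
- by rewrite kernel_at_one kap_one; exact: spb.
- have := kernel_at_tau aff_one; rewrite aff_mulr1 kernel_at_one => ->.
  by rewrite kap_tau; exact: spb.
- by rewrite kernel_at_up // kap_gen; apply: specializesD; apply: specializesM.
Qed.
End Module.

(** * Modules on oriented alcoves and faces *)

Definition dih_code (u : dihedral) : 'I_8 :=
  inord (match u with Id => 0 | R1 => 1 | R2 => 2 | R12 => 3 | R21 => 4 | R121 => 5 | R212 => 6 | R1212 => 7 end).
Definition dih_decode (k : 'I_8) : dihedral := nth Id [:: Id; R1; R2; R12; R21; R121; R212; R1212] k.
Lemma dih_codeK : cancel dih_code dih_decode.
Proof. by rewrite /dih_decode; case; rewrite /dih_code inordK. Qed.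
HB.instance Definition _ := Finite.copy dihedral (can_type dih_codeK).

(** A finite quotient of the lattice through which translations act.  Three
    components suffice for all the modules below; the last one is used for the
    class of a coweight in P/Q. *)
Section Shift.
Variable n : nat.
Definition site_lattice := ('I_n.+2 * 'I_n.+2 * bool)%type.
Definition shift (a b : Z) (p : bool) (g : site_lattice) : site_lattice :=
  (g.1.1 + (int_of_Z a)%:~R, g.1.2 + (int_of_Z b)%:~R, p (+) g.2).

Lemma shiftD a b p c d r g : shift a b p (shift c d r g) = shift (a + c) (b + d) (p (+) r) g.
Proof.
rewrite /shift /= (_ : int_of_Z (a + c) = int_of_Z c + int_of_Z a); last lia.
rewrite (_ : int_of_Z (b + d) = int_of_Z d + int_of_Z b); last lia.
by rewrite !rmorphD !addrA addbA.
Qed.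
Lemma shift0 g : shift 0 0 false g = g.
Proof. by case: g => [[x y] p]; rewrite /shift /= !addr0. Qed.

Lemma shift_bij a b p : bijective (shift a b p).
Proof.
exists (shift (- a) (- b) p) => g; rewrite shiftD addbb -[RHS]shift0; congr shift; lia.
Qed.

Lemma shift_inj a b p c d r g : shift a b p g = shift c d r g ->
  (Z.abs (a - c) < Z.of_nat n.+2)%ZZ -> (Z.abs (b - d) < Z.of_nat n.+2)%ZZ ->
  [/\ a = c, b = d & p = r].
Proof.
have small (z : int) : (z%:~R = 0 :> 'I_n.+2) -> (`|z| < n.+2)%N -> z = 0.
  move=> z0 hz; have : (`|z|%N%:R = 0 :> 'I_n.+2).
    by case: (intP z) z0 => // k; rewrite ?mulrNz ?rmorphN //= => /eqP; rewrite oppr_eq0 => /eqP.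
  move=> e; have := @val_Zp_nat n.+2 isT `|z|%N; rewrite -[(_ %:R : 'Z__)]/(_%:R : 'I_n.+2) e /=.
  by rewrite modn_small //; lia.
move=> e h1 h2.
have /addrI e1 := congr1 (fun g : site_lattice => g.1.1) e.
have /addrI e2 := congr1 (fun g : site_lattice => g.1.2) e.
have /addIb e3 := congr1 (fun g : site_lattice => g.2) e; split=> //.
  have /small : (int_of_Z a - int_of_Z c)%:~R = 0 :> 'I_n.+2.
    by apply/eqP; rewrite rmorphB subr_eq0; apply/eqP; exact: e1.
  lia.
have /small : (int_of_Z b - int_of_Z d)%:~R = 0 :> 'I_n.+2.
  by apply/eqP; rewrite rmorphB subr_eq0; apply/eqP; exact: e2.
lia.
Qed.
End Shift.

(** How T_s acts at a basis vector: on a pair exchanged by s with eigenvalues v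
    and -v^-1, seen from the lower ([Up]) or the upper ([Down]) element of the
    pair, or on a fixed vector by v ([Fix]) or -v^-1 ([FixNeg]). *)
Variant status := Up | Down | Fix | FixNeg.
Definition status_move (s : status) : laurent := match s with Up | Down => 1 | _ => 0 end.
Definition status_stay (s : status) : laurent :=
  match s with Up => 0 | Down => q | Fix => v | FixNeg => - v_inv end.
Definition status_move_spec (s : status) : int := match s with Up | Down => 1 | _ => 0 end.
Definition status_stay_spec (s : status) : int := match s with Up | Down => 0 | Fix => 1 | FixNeg => -1 end.

Lemma status_move_specializes s : specializes (status_move s) (status_move_spec s).
Proof. by case: s; [exact: specializes1..|exact: specializes0|exact: specializes0]. Qed.
Lemma status_stay_specializes s : specializes (status_stay s) (status_stay_spec s).
Proof.
case: s; [exact: specializes0|exact: specializes_q|exact: specializes_v|].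
exact: specializesN specializes_v_inv.
Qed.

(** The basis vectors are pairs of a point of the lattice and an element of D;
    the generators move the second component and translate the first one by an
    amount that depends only on the second. *)
Section Data.
Variables (n : nat) (D : finType).
Variables (face_move : gen -> D -> D) (face_shift : gen -> D -> Z * Z * bool) (face_status : gen -> D -> status).
Variables (face_tau : D -> D) (face_tau_shift : D -> Z * Z * bool).

Definition shift_by (l : Z * Z * bool) : site_lattice n -> site_lattice n := shift l.1.1 l.1.2 l.2.
Definition site_move s (i : (site_lattice n * D)%type) : (site_lattice n * D)%type := (shift_by (face_shift s i.2) i.1, face_move s i.2).
Definition site_tau (i : (site_lattice n * D)%type) : (site_lattice n * D)%type := (shift_by (face_tau_shift i.2) i.1, face_tau i.2).
Definition site_move_coef s (i : (site_lattice n * D)%type) := status_move (face_status s i.2).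
Definition site_stay_coef s (i : (site_lattice n * D)%type) := status_stay (face_status s i.2).

Definition module_relations := forall K : kernel (site_lattice n * D)%type,
 [/\ forall s i j, op site_move site_move_coef site_stay_coef s (op site_move site_move_coef site_stay_coef s K) i j = K i j + q * op site_move site_move_coef site_stay_coef s K i j,
     forall s t i j, s <> t -> ~~ commuting s t ->
       op site_move site_move_coef site_stay_coef s (op site_move site_move_coef site_stay_coef t (op site_move site_move_coef site_stay_coef s (op site_move site_move_coef site_stay_coef t K))) i j =
       op site_move site_move_coef site_stay_coef t (op site_move site_move_coef site_stay_coef s (op site_move site_move_coef site_stay_coef t (op site_move site_move_coef site_stay_coef s K))) i j,
     forall s t i j, commuting s t ->
       op site_move site_move_coef site_stay_coef s (op site_move site_move_coef site_stay_coef t K) i j = op site_move site_move_coef site_stay_coef t (op site_move site_move_coef site_stay_coef s K) i j,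
     forall i j, opt site_tau (opt site_tau K) i j = K i j &
     forall s i j, opt site_tau (op site_move site_move_coef site_stay_coef s K) i j = op site_move site_move_coef site_stay_coef (gen_tau s) (opt site_tau K) i j].
End Data.

Ltac norm_shift :=
  rewrite ?shiftD;
  repeat match goal with
  | |- context [shift ?a ?b ?p ?g] =>
    let a' := eval vm_compute in a in
    let b' := eval vm_compute in b in
    let p' := eval vm_compute in p in
    progress change (shift a b p g) with (shift a' b' p' g)
  end;
  rewrite ?shift0.

(** The principal series: D = W, and the basis vectors are alcoves.  An alcove
    and its neighbour across a hyperplane are ordered by a direction deep inside
    the dominant chamber, an order which translations preserve; [Down] thus means
    that u maps the root of s to a negative root, the root of s_0 being negative
    itself. *)
Definition gdir (s : gen) : dihedral := adir (agen s).
Definition principal_move s u := dih_mul u (gdir s).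
Definition principal_shift s u : Z * Z * bool := (dih_act u (ax (agen s), ay (agen s)), false).
Definition principal_status s u : status :=
  match s, u with
  | G0, (Id | R1 | R2 | R12) => Down | G0, _ => Up
  | G1, (R1 | R21 | R121 | R1212) => Down | G1, _ => Up
  | G2, (R2 | R12 | R212 | R1212) => Down | G2, _ => Up
  end.
Definition principal_tau u := dih_mul u R212.
Definition principal_tau_shift u : Z * Z * bool := (dih_act u (0, 1)%ZZ, false).

Lemma principal_relations n : module_relations n principal_move principal_shift principal_status principal_tau principal_tau_shift.
Proof.
move=> K; split.
- move=> s [g u] j; case: s; case: u; rewrite /op /site_move /site_move_coef /site_stay_coef /shift_by /=; norm_shift; ring.
- move=> s t [g u] j; case: s; case: t => // _ _; case: u; rewrite /op /site_move /site_move_coef /site_stay_coef /shift_by /=; norm_shift; ring.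
- move=> s t [g u] j; case: s; case: t => // _; case: u; rewrite /op /site_move /site_move_coef /site_stay_coef /shift_by /=; norm_shift; ring.
- move=> [g u] j; case: u; rewrite /opt /site_tau /shift_by /=; norm_shift; ring.
- move=> s [g u] j; case: s; case: u; rewrite /opt /op /site_tau /site_move /site_move_coef /site_stay_coef /shift_by /=; norm_shift; ring.
Qed.

(** Right cosets of a subgroup of order two of W. *)
Variant coset := K0 | K1 | K2 | K3.
Definition coset_code (u : coset) : 'I_4 :=
  inord (match u with K0 => 0 | K1 => 1 | K2 => 2 | K3 => 3 end).
Definition coset_decode (k : 'I_4) : coset := nth K0 [:: K0; K1; K2; K3] k.
Lemma coset_codeK : cancel coset_code coset_decode.
Proof. by rewrite /coset_decode; case; rewrite /coset_code inordK. Qed.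
HB.instance Definition _ := Finite.copy coset (can_type coset_codeK).

Ltac split_site u := let g := fresh "g" in let w := fresh "u" in
  destruct u as [g w]; destruct w.
Ltac solve_relations :=
  let K := fresh "K" in let s := fresh "s" in let t := fresh "t" in
  let i := fresh "i" in let j := fresh "j" in let h := fresh "h" in let h' := fresh "h" in
  intro K; split;
  [ intros s i j; destruct s; split_site i
  | intros s t i j h h'; destruct s; destruct t; try by []; split_site i; clear h h'
  | intros s t i j h; destruct s; destruct t; try by []; split_site i; clear h
  | intros i j; split_site i
  | intros s i j; destruct s; split_site i ];
  rewrite /opt /op /site_tau /site_move /site_move_coef /site_stay_coef /shift_by /=; norm_shift;
  rewrite /q; ring: v_mul_inv.

(** Induction from the Levi subgroup of s_1: the affine reflections
    with linear part s_1 act by the scalar v, and the translations that are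
    products of two of them act trivially, which leaves the quotient Z x Z/2 of P
    given by [proj1]. *)
Definition coset1_rep (k : coset) := match k with K0 => Id | K1 => R2 | K2 => R21 | K3 => R212 end.
Definition coset1 (u : dihedral) :=
  match u with Id | R1 => K0 | R2 | R12 => K1 | R21 | R121 => K2 | _ => K3 end.
Definition proj1 (l : Z * Z) : Z * Z * bool := (l.1 + l.2, 0, Z.odd l.2)%ZZ.
Definition eq_coset (k l : coset) :=
  match k, l with K0, K0 | K1, K1 | K2, K2 | K3, K3 => true | _, _ => false end.

Definition levi1_move s k := coset1 (dih_mul (coset1_rep k) (gdir s)).
Definition levi1_shift s k := proj1 (dih_act (coset1_rep k) (ax (agen s), ay (agen s))).
Definition levi1_status s k := if eq_coset (levi1_move s k) k then Fix else principal_status s (coset1_rep k).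
Definition levi1_tau k := coset1 (dih_mul (coset1_rep k) R212).
Definition levi1_tau_shift k := proj1 (dih_act (coset1_rep k) (0, 1)%ZZ).

Lemma levi1_relations n : module_relations n levi1_move levi1_shift levi1_status levi1_tau levi1_tau_shift.
Proof. solve_relations. Qed.

(** The same for s_2, where the quotient of P is Z. *)
Definition coset2_rep (k : coset) := match k with K0 => Id | K1 => R1 | K2 => R12 | K3 => R121 end.
Definition coset2 (u : dihedral) :=
  match u with Id | R2 => K0 | R1 | R21 => K1 | R12 | R212 => K2 | _ => K3 end.
Definition proj2 (l : Z * Z) : Z * Z * bool := (2 * l.1 + l.2, 0, false)%ZZ.

Definition levi2_move s k := coset2 (dih_mul (coset2_rep k) (gdir s)).
Definition levi2_shift s k := proj2 (dih_act (coset2_rep k) (ax (agen s), ay (agen s))).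
Definition levi2_status s k := if eq_coset (levi2_move s k) k then Fix else principal_status s (coset2_rep k).
Definition levi2_tau k := coset2 (dih_mul (coset2_rep k) R212).
Definition levi2_tau_shift k := proj2 (dih_act (coset2_rep k) (0, 1)%ZZ).

Lemma levi2_relations n : module_relations n levi2_move levi2_shift levi2_status levi2_tau levi2_tau_shift.
Proof. solve_relations. Qed.

(** A module on which s_0 acts as s_2, and on which therefore the algebra acts
    through the finite Hecke algebra of W, induced from the character v of its
    subalgebra generated by T_(s_1).  Only the parity in P/Q is kept of the
    translations. *)
Definition finite_dir (s : gen) := match s with G1 => R1 | _ => R2 end.
Definition finite_gen (s : gen) := match s with G1 => G1 | _ => G2 end.
Definition finite_move s k := coset1 (dih_mul (coset1_rep k) (finite_dir s)).
Definition finite_status s k := if eq_coset (finite_move s k) k then Fix else principal_status (finite_gen s) (coset1_rep k).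
Definition no_shift (D : Type) (s : gen) (k : D) : Z * Z * bool := (0, 0, false)%ZZ.
Definition parity_shift (D : Type) (k : D) : Z * Z * bool := (0, 0, true)%ZZ.

Lemma finite_relations n : module_relations n finite_move (@no_shift coset) finite_status id (@parity_shift coset).
Proof. solve_relations. Qed.

(** The two characters with values v on T_(s_0) and T_(s_2), and v or -v^-1 on
    T_(s_1). *)
Definition triv_status (s : gen) (k : unit) := Fix.
Definition sgn_status (s : gen) (k : unit) := match s with G1 => FixNeg | _ => Fix end.
Lemma triv_relations n : module_relations n (fun=> id) (@no_shift unit) triv_status id (@parity_shift unit).
Proof. solve_relations. Qed.
Lemma sgn_relations n : module_relations n (fun=> id) (@no_shift unit) sgn_status id (@parity_shift unit).
Proof. solve_relations. Qed.

(** * Specialized traces *)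
Definition affine_code (a : affine) := (ax a, ay a, adir a).
Definition affine_decode (p : Z * Z * dihedral) := Aff p.1.1 p.1.2 p.2.
Lemma affine_codeK : cancel affine_code affine_decode.
Proof. by case. Qed.
HB.instance Definition _ := Equality.copy affine (can_type affine_codeK).

(** Values at v = 1 of a linear form that vanishes on commutators, over all
    Hecke algebras at once. *)
Definition spec_trace (c : affine -> int) : Prop := exists theta : affine -> laurent,
  (forall (H : algType laurent) (T : extended -> H) (HT : is_hecke_algebra T)
      (r : seq affine) (g : affine -> laurent),
    commutator_submodule (\sum_(a <- r) g a *: Taff T a) ->
    \sum_(a <- r) g a * theta a = 0) /\
  (forall a, specializes (theta a) (c a)).

(** At v = 1 a module above becomes a permutation module up to the sign
    [sgn_of], on which a sends (g, u) to a translate of g, by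
    [face_act_shift a u], and [face_act a u]. *)
Section SpecTrace.
Variables (n : nat) (D : finType).
Variables (face_move : gen -> D -> D) (face_shift : gen -> D -> Z * Z * bool) (face_status : gen -> D -> status).
Variables (face_tau : D -> D) (face_tau_shift : D -> Z * Z * bool).
Hypothesis rel : module_relations n face_move face_shift face_status face_tau face_tau_shift.
Variables (face_act : affine -> D -> D) (face_act_shift : affine -> D -> Z * Z * bool) (sgn_of : affine -> int).

Definition shift_add (l l' : Z * Z * bool) : Z * Z * bool :=
  (l.1.1 + l'.1.1, l.1.2 + l'.1.2, l.2 (+) l'.2)%ZZ.

Hypothesis face_act1 : forall u, face_act aff_one u = u.
Hypothesis face_act_shift1 : forall u, face_act_shift aff_one u = (0, 0, false)%ZZ.
Hypothesis face_actt : forall u, face_act atau u = face_tau u.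
Hypothesis face_act_shiftt : forall u, face_act_shift atau u = face_tau_shift u.
Hypothesis face_acts : forall s a u, face_act (agen s * a)%A u = face_act a (face_move s u).
Hypothesis face_act_shifts : forall s a u, face_act_shift (agen s * a)%A u = shift_add (face_act_shift a (face_move s u)) (face_shift s u).
Hypothesis sgn_of1 : sgn_of aff_one = 1.
Hypothesis sgn_oft : sgn_of atau = 1.
Hypothesis sgn_ofs : forall s a u, match face_status s u with
  | Up | Down => sgn_of (agen s * a)%A = sgn_of a
  | Fix => [/\ sgn_of (agen s * a)%A = sgn_of a, face_move s u = u & face_shift s u = (0, 0, false)%ZZ]
  | FixNeg => [/\ sgn_of (agen s * a)%A = - sgn_of a, face_move s u = u & face_shift s u = (0, 0, false)%ZZ]
  end.

Definition act (a : affine) (i : (site_lattice n * D)%type) : (site_lattice n * D)%type :=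
  (shift_by (face_act_shift a i.2) i.1, face_act a i.2).
Definition twist (l : Z * Z * bool) (i : (site_lattice n * D)%type) : (site_lattice n * D)%type := (shift_by l i.1, i.2).

(** The signed number of basis vectors on which a acts like the translation
    by l. *)
Definition fix_char (l : Z * Z * bool) (a : affine) : int :=
  \sum_(i : (site_lattice n * D)%type) sgn_of a * (act a i == twist l i)%:R.

Lemma shift_byD l l' g : shift_by l (shift_by l' g) = shift_by (shift_add l l') g :> site_lattice n.
Proof. by rewrite /shift_by shiftD. Qed.

Lemma fix_char_spec_trace l : spec_trace (fix_char l).
Proof.
pose move_to := @site_move n D face_move face_shift; pose move_coef := @site_move_coef n D face_status; pose stay_coef := @site_stay_coef n D face_status.
pose tau_to := @site_tau n D face_tau face_tau_shift.
have h1 s K i j : op move_to move_coef stay_coef s (op move_to move_coef stay_coef s K) i j = K i j + q * op move_to move_coef stay_coef s K i j.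
  by have [] := rel K.
have h2 s t K i j : s <> t -> ~~ commuting s t ->
  op move_to move_coef stay_coef s (op move_to move_coef stay_coef t (op move_to move_coef stay_coef s (op move_to move_coef stay_coef t K))) i j =
  op move_to move_coef stay_coef t (op move_to move_coef stay_coef s (op move_to move_coef stay_coef t (op move_to move_coef stay_coef s K))) i j.
  by have [_ h _ _ _] := rel K; exact: h.
have h3 s t K i j : commuting s t ->
  op move_to move_coef stay_coef s (op move_to move_coef stay_coef t K) i j = op move_to move_coef stay_coef t (op move_to move_coef stay_coef s K) i j.
  by have [_ _ h _ _] := rel K; exact: h.
have h4 K i j : opt tau_to (opt tau_to K) i j = K i j by have [_ _ _ h _] := rel K; exact: h.
have h5 s K i j : opt tau_to (op move_to move_coef stay_coef s K) i j = op move_to move_coef stay_coef (gen_tau s) (opt tau_to K) i j.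
  by have [_ _ _ _ h] := rel K; exact: h.
pose M := kernel_at move_to move_coef stay_coef tau_to.
have tw_bij : bijective (twist l).
  have [f fK Kf] : bijective (@shift_by n l) by exact: shift_bij.
  by exists (fun i => (f i.1, i.2)) => -[g u]; rewrite /twist /= ?fK ?Kf.
have tw_nb s i : move_to s (twist l i) = twist l (move_to s i).
  rewrite /move_to /site_move /twist /= !shift_byD /shift_add; congr pair.
  by rewrite /= addbC; congr (shift_by (_, _, _)); lia.
have tw_tb i : tau_to (twist l i) = twist l (tau_to i).
  rewrite /tau_to /site_tau /twist /= !shift_byD /shift_add; congr pair.
  by rewrite /= addbC; congr (shift_by (_, _, _)); lia.
exists (fun a => \sum_i M a i (twist l i)); split.
  move=> H T HT r g /(twisted_trace_commutator h1 h2 h3 h4 h5 HT tw_bij tw_nb tw_tb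
    (fun _ _ => erefl) (fun _ _ => erefl)) tr0.
  by move: tr0; rewrite twisted_trace_sum.
move=> a; apply: specializes_sum => i.
apply: (@kernel_at_specializes _ move_to move_coef stay_coef tau_to h2 h3 h4 h5 (fun s i => status_move_spec (face_status s i.2)) (fun s i => status_stay_spec (face_status s i.2))
  (fun a i j => sgn_of a * (act a i == j)%:R)) => {a i}.
- by move=> s i; exact: status_move_specializes.
- by move=> s i; exact: status_stay_specializes.
- by move=> [g u] j; rewrite sgn_of1 mul1r /act face_act_shift1 face_act1 /shift_by shift0.
- by move=> [g u] j; rewrite sgn_oft mul1r /act face_act_shiftt face_actt.
- move=> s a [g u] j; have := sgn_ofs s a u.
  rewrite /act /move_to /site_move /= face_act_shifts face_acts -shift_byD.
  case: (face_status s u) => /=; rewrite ?mul1r ?mul0r ?addr0 ?add0r.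
  + by move->. + by move->.
  + by case=> -> -> ->; rewrite /shift_by shift0.
  + by case=> -> -> ->; rewrite /shift_by shift0 mulN1r mulNr.
Qed.

Lemma fix_char_neq0 l a : fix_char l a <> 0 -> exists u, face_act a u = u /\
  ((Z.abs ((face_act_shift a u).1.1 - l.1.1) < Z.of_nat n.+2)%ZZ ->
   (Z.abs ((face_act_shift a u).1.2 - l.1.2) < Z.of_nat n.+2)%ZZ -> face_act_shift a u = l).
Proof.
move=> c0; have [i ei] : exists i, act a i == twist l i.
  apply: contrapT => /forallNP h; apply: c0; apply: big1 => i _.
  by case: eqP (h i) => // _ _; rewrite mulr0.
have e := eqP ei; have e1 := congr1 fst e; have e2 := congr1 snd e.
exists i.2; split=> // h1' h2'.
have [e3 e4 e5] := shift_inj e1 h1' h2'.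
have tri (p p' : Z * Z * bool) : p.1.1 = p'.1.1 -> p.1.2 = p'.1.2 -> p.2 = p'.2 -> p = p'.
  by case: p p' => [[? ?] ?] [[? ?] ?] /= -> -> ->.
exact: tri.
Qed.

Lemma fix_char_pos l a u : sgn_of a <> 0 -> face_act a u = u -> face_act_shift a u = l -> fix_char l a <> 0.
Proof.
move=> e0 du lu; rewrite /fix_char -mulr_sumr => /eqP; rewrite mulf_eq0 => /orP[/eqP//|].
rewrite -natr_sum pnatr_eq0 sum_nat_eq0 => /forallP /(_ ((0, 0, false), u)).
by rewrite /act /twist /= du lu eqxx.
Qed.

Lemma fix_char_unit l a : (forall u, face_act a u = u) -> (forall u, face_act_shift a u = l) ->
  fix_char l a = sgn_of a * (#|{: (site_lattice n * D)%type}|)%:R.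
Proof.
move=> du lu; rewrite /fix_char -mulr_sumr; congr (_ * _).
rewrite -natr_sum; congr (_%:R); rewrite -sum1_card; apply: eq_bigr => i _.
by rewrite /act /twist du lu eqxx.
Qed.
End SpecTrace.

(** * Separation of the conjugacy classes at v = 1 *)
Definition triv_of (a : affine) : int := 1.
Definition dir_sgn (u : dihedral) : bool :=
  match u with R1 | R12 | R21 | R212 => true | _ => false end.
Definition sgn_char_of (a : affine) : int :=
  if Z.odd (ay a) (+) dir_sgn (adir a) then -1 else 1.

Definition principal_act (a : affine) u := dih_mul u (adir a).
Definition principal_act_shift (a : affine) u : Z * Z * bool := (dih_act u (ax a, ay a), false).
Definition levi1_act (a : affine) k := coset1 (dih_mul (coset1_rep k) (adir a)).
Definition levi1_act_shift (a : affine) k := proj1 (dih_act (coset1_rep k) (ax a, ay a)).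
Definition levi2_act (a : affine) k := coset2 (dih_mul (coset2_rep k) (adir a)).
Definition levi2_act_shift (a : affine) k := proj2 (dih_act (coset2_rep k) (ax a, ay a)).
(** The image of a under the homomorphism onto W that sends s_0 and s_2 to s_2,
    s_1 to s_1 and tau to 1; it maps epsilon_1 and epsilon_2 to w_0 and
    s_2 s_1 s_2. *)
Definition finite_part (a : affine) : dihedral :=
  dih_mul (if Z.odd (ax a) then R1212 else Id)
    (dih_mul (if Z.odd (ay a) then R212 else Id) (adir a)).
Definition finite_act (a : affine) k := coset1 (dih_mul (coset1_rep k) (finite_part a)).
Definition parity_act_shift (D : Type) (a : affine) (k : D) : Z * Z * bool := (0, 0, Z.odd (ay a))%ZZ.

Lemma odd_neg z : Z.odd (- z) = Z.odd z.
Proof. by rewrite Z.odd_opp. Qed.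
Definition oddE := (Z.odd_add, Z.odd_mul, odd_neg).

Definition principal_char n := fix_char n principal_act principal_act_shift triv_of.
Lemma principal_char_spec n l : spec_trace (principal_char n l).
Proof.
apply: (fix_char_spec_trace (@principal_relations n)); [by [|case]|by [|case]|by [|case]|by [|case]| | |by []|by []|].
- by move=> s [x y w] u; case: s; case: u; case: w.
- move=> s [x y w] u; case: s; case: u;
    rewrite /principal_act_shift /principal_shift /principal_move /shift_add /=; congr (_, _, _); lia.
- by move=> s a u; case: s; case: u.
Qed.

Definition levi1_char n := fix_char n levi1_act levi1_act_shift triv_of.
Lemma levi1_char_spec n l : spec_trace (levi1_char n l).
Proof.
apply: (fix_char_spec_trace (@levi1_relations n)); [by [|case]|by [|case]|by [|case]|by [|case]| | |by []|by []|].
- by move=> s [x y w] u; case: s; case: u; case: w.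
- move=> s [x y w] u; case: s; case: u;
    rewrite /levi1_act_shift /levi1_shift /levi1_move /proj1 /shift_add /= ?oddE /=; congr (_, _, _); by [lia|case: (Z.odd x); case: (Z.odd y)].
- by move=> s a u; case: s; case: u.
Qed.

Definition levi2_char n := fix_char n levi2_act levi2_act_shift triv_of.
Lemma levi2_char_spec n l : spec_trace (levi2_char n l).
Proof.
apply: (fix_char_spec_trace (@levi2_relations n)); [by [|case]|by [|case]|by [|case]|by [|case]| | |by []|by []|].
- by move=> s [x y w] u; case: s; case: u; case: w.
- move=> s [x y w] u; case: s; case: u;
    rewrite /levi2_act_shift /levi2_shift /levi2_move /proj2 /shift_add /=; congr (_, _, _); lia.
- by move=> s a u; case: s; case: u.
Qed.

Lemma odd_ay_gen s a : Z.odd (ay (agen s * a)%A) = Z.odd (ay a).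
Proof.
case: a => x y u; case: s; rewrite /= ?oddE /=.
all: by case: (Z.odd x); case: (Z.odd y).
Qed.

Definition finite_char n := fix_char n finite_act (@parity_act_shift coset) triv_of.
Lemma finite_char_spec n l : spec_trace (finite_char n l).
Proof.
apply: (fix_char_spec_trace (@finite_relations n)); [by [|case]|by [|case]|by [|case]|by [|case]| | |by []|by []|].
- move=> s [x y w] u; rewrite /finite_act /finite_part; case: s; rewrite /= ?oddE /=;
    case: (Z.odd x); case: (Z.odd y); case: u; by case: w.
- by move=> s a u; rewrite /parity_act_shift /shift_add odd_ay_gen /no_shift /= addbF.
- by move=> s a u; case: s; case: u.
Qed.

Definition triv_char n := fix_char n (fun _ => @id unit) (@parity_act_shift unit) triv_of.
Lemma triv_char_spec n l : spec_trace (triv_char n l).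
Proof.
apply: (fix_char_spec_trace (@triv_relations n)); [by [|case]|by [|case]|by [|case]|by [|case]| | |by []|by []|].
- by [].
- by move=> s a u; rewrite /parity_act_shift /shift_add odd_ay_gen /no_shift /= addbF.
- by [].
Qed.

Definition sgn_char n := fix_char n (fun _ => @id unit) (@parity_act_shift unit) sgn_char_of.
Lemma sgn_char_spec n l : spec_trace (sgn_char n l).
Proof.
apply: (fix_char_spec_trace (@sgn_relations n)); [by [|case]|by [|case]|by [|case]|by [|case]| | |by []|by []|].
- by [].
- by move=> s a u; rewrite /parity_act_shift /shift_add odd_ay_gen /no_shift /= addbF.
- move=> s a u; rewrite /sgn_char_of odd_ay_gen; case: (Z.odd (ay a));
    case: a => x y w; case: s; by case: w.
Qed.

(** Coefficients of finitely many pairwise non conjugate elements that are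
    killed by all specialized traces. *)
Section Separation.
Variables (r : seq affine) (z : affine -> int).
Hypothesis r_uniq : uniq r.
Hypothesis r_class : {in r &, forall a b, class_inv a = class_inv b -> a = b}.
Hypothesis z_killed : forall c, spec_trace c -> \sum_(a <- r) z a * c a = 0.

Let bound : nat := (\sum_(a <- r) (Z.abs_nat (ax a) + Z.abs_nat (ay a)))%N.
(* Large enough for congruences modulo N.+2 between the translation parts that
   occur below to be equalities. *)
Let N : nat := (20 * bound + 20)%N.

Let bound_ax a : a \in r -> (Z.abs (ax a) <= Z.of_nat bound)%ZZ /\ (Z.abs (ay a) <= Z.of_nat bound)%ZZ.
Proof. by move=> ar; rewrite /bound (big_rem _ ar) /=; split; lia. Qed.

Lemma isolate (c : affine -> int) a : a \in r -> \sum_(b <- r) z b * c b = 0 -> c a <> 0 ->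
  (forall b, b \in r -> b <> a -> c b <> 0 -> z b = 0) -> z a = 0.
Proof.
move=> ar sum0 ca others; move: sum0; rewrite (bigD1_seq a) //= big1_seq ?addr0.
  by move=> /eqP; rewrite mulf_eq0 => /orP[/eqP//|/eqP].
move=> b /andP[/eqP ba br]; case: (eqVneq (c b) 0) => [->|/eqP cb]; first by rewrite mulr0.
by rewrite (others b) ?mul0r.
Qed.

(** Nontrivial linear parts have no fixed point in the principal series, and the
    trace twisted by a coweight detects its W-orbit. *)
Lemma separate_translation a : a \in r -> adir a = Id -> z a = 0.
Proof.
move=> ar da; pose l := (ax a, ay a, false).
apply: (isolate ar (z_killed (principal_char_spec N l))).
  by apply: (@fix_char_pos _ _ _ _ _ _ _ Id) => //; rewrite /principal_act da.
move=> b br ba /fix_char_neq0[u [du lu]]; case: ba; apply: r_class => //.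
have [a1 a2] := bound_ax ar; have [b1 b2] := bound_ax br.
case: a b {br ar} da @l a1 a2 b1 b2 du lu => [x y d] [x' y' d'] /= -> a1 a2 b1 b2 du lu.
have {}du : d' = Id by case: u d' du {lu} => -[].
have {lu} : principal_act_shift (Aff x' y' d') u = (x, y, false).
  by apply: lu; rewrite /N; case: u {du} => /=; lia.
by rewrite du; case: u {du} => -[<- <-] /=; congr (_, _, _); lia.
Qed.

Lemma odd_mod2 y : (y mod 2 = if Z.odd y then 1 else 0)%ZZ.
Proof. exact: Zmod_odd. Qed.

(** On the cosets of <s_1> only translations, already dealt with, and
    conjugates of t^mu s_1 have fixed points; the twist detects the class of mu
    in P/(1 - s_1)P up to sign. *)
Lemma separate_reflection1 a : a \in r -> adir a = R1 \/ adir a = R212 -> z a = 0.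
Proof.
move=> ar da; pose k := if adir a is R1 then K0 else K1; pose l := levi1_act_shift a k.
apply: (isolate ar (z_killed (levi1_char_spec N l))).
  by apply: (@fix_char_pos _ _ _ _ _ _ _ k) => //; rewrite /levi1_act /k; case: da => ->.
move=> b br ba /fix_char_neq0[u [du lu]].
case: (boolP (adir b == Id)) => [/eqP db|/eqP ndb]; first exact: separate_translation.
case: ba; apply: r_class => //.
have [a1 a2] := bound_ax ar; have [b1 b2] := bound_ax br.
case: a b {br ar} da @k @l a1 a2 b1 b2 ndb du lu => [x y d] [x' y' d'] /= da a1 a2 b1 b2 ndb du lu.
have {}du : (d' = R1 /\ (u = K0 \/ u = K3)) \/ (d' = R212 /\ (u = K1 \/ u = K2)).
  by case: u d' ndb du {lu} => -[]; auto.
have {lu} : levi1_act_shift (Aff x' y' d') u = levi1_act_shift (Aff x y d) (if d is R1 then K0 else K1).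
  by apply: lu; rewrite /N; case: u {du}; case: da => e; rewrite ?e /=; lia.
move=> lu; move: (congr1 (fun t => t.1.1) lu) (congr1 snd lu) => /= {lu}.
by case: du => -[-> [] ->]; case: da => ->; rewrite /= ?oddE /= => e o; rewrite /class_inv;
  congr (_, _, _); rewrite ?odd_mod2; (try lia); move: o;
  case: (Z.odd x); case: (Z.odd x'); case: (Z.odd y); case: (Z.odd y').
Qed.

Lemma separate_reflection2 a : a \in r -> adir a = R2 \/ adir a = R121 -> z a = 0.
Proof.
move=> ar da; pose k := if adir a is R2 then K0 else K1; pose l := levi2_act_shift a k.
apply: (isolate ar (z_killed (levi2_char_spec N l))).
  by apply: (@fix_char_pos _ _ _ _ _ _ _ k) => //; rewrite /levi2_act /k; case: da => ->.
move=> b br ba /fix_char_neq0[u [du lu]].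
case: (boolP (adir b == Id)) => [/eqP db|/eqP ndb]; first exact: separate_translation.
case: ba; apply: r_class => //.
have [a1 a2] := bound_ax ar; have [b1 b2] := bound_ax br.
case: a b {br ar} da @k @l a1 a2 b1 b2 ndb du lu => [x y d] [x' y' d'] /= da a1 a2 b1 b2 ndb du lu.
have {}du : (d' = R2 /\ (u = K0 \/ u = K3)) \/ (d' = R121 /\ (u = K1 \/ u = K2)).
  by case: u d' ndb du {lu} => -[]; auto.
have {lu} : levi2_act_shift (Aff x' y' d') u = levi2_act_shift (Aff x y d) (if d is R2 then K0 else K1).
  by apply: lu; rewrite /N; case: u {du}; case: da => e; rewrite ?e /=; lia.
by case: du => -[-> [] ->]; case: da => -> -[] e; rewrite /class_inv;
  congr (_, _, _); lia.
Qed.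

Definition elliptic (a : affine) : bool :=
  match adir a with R12 | R21 | R1212 => true | _ => false end.

Lemma separate_non_elliptic a : a \in r -> ~~ elliptic a -> z a = 0.
Proof.
move=> ar; rewrite /elliptic; case e : (adir a) => // _; move: e ar.
- by move=> e /separate_translation; apply.
- by move=> e /separate_reflection1; apply; left.
- by move=> e /separate_reflection2; apply; left.
- by move=> e /separate_reflection2; apply; right.
- by move=> e /separate_reflection1; apply; right.
Qed.

Let par (p : bool) : Z * Z * bool := (0, 0, p)%ZZ.

Lemma par_char (D : finType) sgn_of p a : fix_char N (fun _ => @id D) (@parity_act_shift D) sgn_of (par p) a <> 0 ->
  Z.odd (ay a) = p.
Proof.
by move=> /fix_char_neq0[u [_ h]]; have := h ltac:(rewrite /=; lia) ltac:(rewrite /=; lia) => -[].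
Qed.

Lemma triv_charE p a : triv_char N (par p) a =
  if Z.odd (ay a) == p then (#|{: (site_lattice N * unit)%type}|)%:R else 0.
Proof.
case: eqP => [e|ne].
  by rewrite /triv_char (@fix_char_unit _ _ _ _ _ (par p)) ?mul1r // => u; rewrite /parity_act_shift e.
by apply/eqP; apply: contra_notT ne => /eqP; exact: par_char.
Qed.

Lemma sgn_charE p a : sgn_char N (par p) a = sgn_char_of a * triv_char N (par p) a.
Proof.
rewrite triv_charE; case: eqP => [e|ne].
  by rewrite /sgn_char (@fix_char_unit _ _ _ _ _ (par p)) // => u; rewrite /parity_act_shift e.
by rewrite mulr0; apply/eqP; apply: contra_notT ne => /eqP; exact: par_char.
Qed.

Lemma card_lat_neq0 : (#|{: (site_lattice N * unit)%type}|)%:R <> 0 :> int.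
Proof.
move=> /eqP; rewrite pnatr_eq0 => /eqP /card0_eq /(_ ((0, 0, false), tt)).
by rewrite inE.
Qed.

(** Among the elliptic elements of W_a only the class of t^Lambda_1 w_0 = s_0 s_2
    is mapped to 1 by [finite_part]; the others go to elements of order 4 or to
    w_0, which fix no coset of <s_1>. *)
Lemma separate_s0s2 a : a \in r -> adir a = R1212 -> Z.odd (ay a) = false ->
  Z.odd (ax a) = true -> z a = 0.
Proof.
move=> ar da ya xa.
apply: (isolate ar (z_killed (finite_char_spec N (par false)))).
  apply: (@fix_char_pos _ _ _ _ _ _ _ K0); rewrite ?/parity_act_shift ?ya //.
  by rewrite /finite_act /finite_part da xa ya.
move=> b br ba /fix_char_neq0[u [du lu]].
have /lu {lu} : (Z.abs ((parity_act_shift b u).1.1 - (par false).1.1) < Z.of_nat N.+2)%ZZ by rewrite /=; lia.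
move=> /(_ ltac:(rewrite /=; lia)) [yb].
case: (boolP (elliptic b)) => [|/separate_non_elliptic]; last exact.
move: du; rewrite /finite_act /finite_part yb /elliptic; case db : (adir b) => // + _;
  case xb : (Z.odd (ax b)); case: u => // _.
all: case: ba; apply: r_class => //; move: da ya xa db yb xb.
all: case: (a) => x y d /=; case: (b) => x' y' d' /= -> ya xa -> yb xb.
all: by rewrite /class_inv !odd_mod2 ya yb xa xb.
Qed.

(** Among the elliptic elements of a given parity, only those of Coxeter type
    contribute to this combination of the two characters. *)
Lemma separate_coxeter a : a \in r -> adir a = R12 \/ adir a = R21 -> z a = 0.
Proof.
move=> ar da; pose p := Z.odd (ay a).
pose c b := triv_char N (par p) b - (-1) ^+ p * sgn_char N (par p) b.
have sum0 : \sum_(b <- r) z b * c b = 0.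
  rewrite (eq_bigr (fun b => z b * triv_char N (par p) b - (-1) ^+ p * (z b * sgn_char N (par p) b))).
    rewrite sumrB -mulr_sumr (z_killed (triv_char_spec N (par p))).
    by rewrite (z_killed (sgn_char_spec N (par p))) mulr0 subrr.
  by move=> b _; rewrite /c mulrBr mulrCA.
have cE b : c b = (1 - (-1) ^+ p * sgn_char_of b) * triv_char N (par p) b.
  by rewrite /c sgn_charE mulrBl mul1r mulrA.
apply: (isolate ar sum0).
  rewrite cE triv_charE eqxx => /eqP; rewrite mulf_eq0 => /orP[|/eqP/card_lat_neq0//].
  by rewrite /sgn_char_of /p; case: da => ->; case: (Z.odd (ay a)).
move=> b br ba cb; have yb : Z.odd (ay b) = p.
  by apply/eqP; apply: contra_notT cb => ne; rewrite cE triv_charE (negPf ne) mulr0.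
case: (boolP (elliptic b)) => [|/separate_non_elliptic]; last exact.
rewrite /elliptic; case db : (adir b) => // _.
- case: ba; apply: r_class => //; move: da db yb; rewrite /p.
  case: (a) => x y d; case: (b) => x' y' d' /= da -> yb.
  by case: da => ->; rewrite /class_inv !odd_mod2 yb.
- case: ba; apply: r_class => //; move: da db yb; rewrite /p.
  case: (a) => x y d; case: (b) => x' y' d' /= da -> yb.
  by case: da => ->; rewrite /class_inv !odd_mod2 yb.
- by case: cb; rewrite cE /sgn_char_of yb db /p; case: (Z.odd (ay a)); rewrite /= ?expr0 ?expr1 ?mulN1r ?opprK ?mulr1 subrr mul0r.
Qed.

(** What remains are the elements t^mu w_0 not conjugate to s_0 s_2.  They form
    one class for each parity of mu in P/Q, and the character v is nonzero on
    both. *)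
Lemma separation a : a \in r -> z a = 0.
Proof.
move=> ar; case: (boolP (elliptic a)) => [|/separate_non_elliptic]; last exact.
rewrite /elliptic; case da : (adir a) => // _.
- by apply: separate_coxeter ar _; left.
- by apply: separate_coxeter ar _; right.
case: (boolP (~~ Z.odd (ay a) && Z.odd (ax a))) => [/andP[/negPf ya xa]|ea].
  exact: separate_s0s2 ar da ya xa.
pose p := Z.odd (ay a).
apply: (isolate ar (z_killed (triv_char_spec N (par p)))).
  by rewrite triv_charE eqxx; exact: card_lat_neq0.
move=> b br ba cb; have yb : Z.odd (ay b) = p.
  by apply/eqP; apply: contra_notT cb => ne; rewrite triv_charE (negPf ne).
case: (boolP (elliptic b)) => [|/separate_non_elliptic]; last exact.
rewrite /elliptic; case db : (adir b) => // _.
- by apply: separate_coxeter br _; left.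
- by apply: separate_coxeter br _; right.
case: (boolP (~~ Z.odd (ay b) && Z.odd (ax b))) => [/andP[/negPf yb' xb]|eb].
  exact: separate_s0s2 br db yb' xb.
case: ba; apply: r_class => //; move: da db yb ea eb; rewrite /p.
case: (a) => x y d; case: (b) => x' y' d' /= -> -> yb.
rewrite /class_inv !odd_mod2 yb; case: (Z.odd y) => //= /negPf ea /negPf eb.
by rewrite ea eb.
Qed.
End Separation.

Theorem cocenter_independent (H : algType laurent) (T : extended -> H)
    (HT : is_hecke_algebra T) (r : seq affine) (g : affine -> laurent) :
  uniq r -> {in r &, forall a b, class_inv a = class_inv b -> a = b} ->
  commutator_submodule (\sum_(a <- r) g a *: Taff T a) -> {in r, forall a, g a = 0}.
Proof.
move=> ur cr comm.
pose fam := {c : affine -> int | spec_trace c}.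
pose theta (f : fam) := sval (cid (svalP f)).
apply: (@specialization_argument _ r fam theta (fun f => sval f)) => //.
- by move=> f a; have [_ sp] := svalP (cid (svalP f)); exact: sp.
- by move=> z hz a ar; apply: (separation ur cr _ ar) => c hc; exact: (hz (exist _ c hc)).
- by move=> f; have [kill _] := svalP (cid (svalP f)); exact: (kill H T HT r g comm).
Qed.

(** * The coweights in the diamonds *)
Section Geometry.
Variable R : realType.

Lemma convex_hull4 (V : lmodType R) (p1 p2 p3 p4 x : V) :
  convex_hull [:: p1; p2; p3; p4] x <->
  exists c1 c2 c3 c4 : R, [/\ 0 <= c1, 0 <= c2, 0 <= c3 & 0 <= c4] /\
    c1 + c2 + c3 + c4 = 1 /\ x = c1 *: p1 + c2 *: p2 + c3 *: p3 + c4 *: p4.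
Proof.
split=> [[c [c0 c1 ->]]|[c1 [c2 [c3 [c4 [[h1 h2 h3 h4] [s1 ->]]]]]]].
  exists (c 0), (c 1), (c 2%R), (c 3%R); split; first by [].
  move: c1; rewrite !big_ord_recl !big_ord0 !addr0 !addrA => <-.
  have e2 : lift ord0 (lift ord0 ord0) = 2%R :> 'I_4 by apply: val_inj.
  have e1 : lift ord0 ord0 = 1%R :> 'I_4 by apply: val_inj.
  have e3 : lift ord0 (lift ord0 (lift ord0 ord0)) = 3%R :> 'I_4 by apply: val_inj.
  by rewrite e1 e2 e3.
exists (fun j => nth 0 [:: c1; c2; c3; c4] j); split.
- by case=> -[|[|[|[]]]].
- by rewrite !big_ord_recl big_ord0 addr0 !addrA.
- by rewrite !big_ord_recl big_ord0 addr0 !addrA.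
Qed.

Lemma plane_combination (c1 c2 c3 c4 a1 b1 a2 b2 a3 b3 a4 b4 : R) :
  c1 *: ((a1, b1) : R^o * R^o) + c2 *: ((a2, b2) : R^o * R^o)
    + c3 *: ((a3, b3) : R^o * R^o) + c4 *: ((a4, b4) : R^o * R^o)
  = (c1 * a1 + c2 * a2 + c3 * a3 + c4 * a4, c1 * b1 + c2 * b2 + c3 * b3 + c4 * b4).
Proof. by []. Qed.
Lemma plane_scale (c a b : R) : c *: ((a, b) : R^o * R^o) = (c * a, c * b).
Proof. by []. Qed.
Lemma plane0 : 0 = ((0, 0) : R^o * R^o).
Proof. by []. Qed.

Lemma diamondP (a b : int) (x y : R) : @diamond R a b (x, y) <->
  exists c2 c3 c4 : R, [/\ 0 <= c2, 0 <= c3, 0 <= c4 & c2 + c3 + c4 <= 1] /\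
    x = c2 * (a%:~R / 2 + b%:~R) + (c3 + c4) * (a + b)%:~R /\
    y = c2 * (a%:~R / 2 + b%:~R) + c4 * b%:~R.
Proof.
rewrite /diamond convex_hull4 !cwE /to_plane /= plane0 !plane_scale.
under eq_exists do under eq_exists do under eq_exists do under eq_exists do rewrite plane_combination.
split=> [[c1 [c2 [c3 [c4 [[h1 h2 h3 h4] [h5 [-> ->]]]]]]]|[c2 [c3 [c4 [[h2 h3 h4 h5] [-> ->]]]]]].
  exists c2, c3, c4; split; first by split=> //; rewrite -h5 -!addrA lerDr.
  by rewrite !intrD !intrM /=; split; field.
exists (1 - (c2 + c3 + c4)), c2, c3, c4; split; first by split=> //; rewrite subr_ge0.
split; first by ring.
by congr pair; rewrite !intrD !intrM /=; field.
Qed.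

(** The segment from (a/2 + b, a/2 + b) to (a + b, 0) cuts the diamond into the
    triangle at the origin and the triangle at (a + b, b); in each case the
    barycentric coordinates are given.  In the second case neither a nor b can be
    nonpositive. *)
Lemma in_quadrilateral (a b x y : R) : 0 <= b -> 1 <= x -> 1 <= y ->
  x + y <= a + b -> x + y *+ 2 <= a + b *+ 2 ->
  exists c2 c3 c4 : R, [/\ 0 <= c2, 0 <= c3, 0 <= c4 & c2 + c3 + c4 <= 1] /\
    x + y = c2 * (a / 2 + b) + (c3 + c4) * (a + b) /\
    y = c2 * (a / 2 + b) + c4 * b.
Proof.
move=> hb hx hy le1 le2; have s0 : 0 < a / 2 + b by lra.
have N0 : 0 < a + b by lra.
have [near|far] := leP (y * (a + b) + x * (a / 2 + b)) ((a / 2 + b) * (a + b)).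
  exists (y / (a / 2 + b)), (x / (a + b)), 0; split.
    split=> //; [by rewrite divr_ge0; lra|by rewrite divr_ge0; lra|].
    rewrite addr0 addf_div ?gt_eqF // ler_pdivrMr ?mulr_gt0 // mul1r; lra.
  by split; field; rewrite !gt_eqF //; lra.
have a0 : 0 < a.
  rewrite ltNge; apply/negP => a0; move: far; apply/negP; rewrite -leNgt.
  have h : 0 <= (a / 2 + b) * (a + b - (x + y)) by rewrite mulr_ge0 //; lra.
  have h' : 0 <= y * (- a / 2) by rewrite mulr_ge0 //; lra.
  nra.
have {}hb : 0 < b.
  rewrite lt_def hb andbT; apply/eqP => b0; subst b; move: far; apply/negP; rewrite -leNgt.
  have h : 0 <= a * (a - (x + y *+ 2)) by rewrite mulr_ge0 //; lra.
  nra.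
pose c2 := (a + b - x - y) / (a / 2); pose c4 := (y - c2 * (a / 2 + b)) / b.
have c2E : c2 * (a / 2) = a + b - x - y by rewrite /c2; field; lra.
have c4E : c4 * b = y - c2 * (a / 2 + b) by rewrite /c4; field; lra.
have c20 : 0 <= c2 by rewrite divr_ge0; lra.
have c40 : 0 <= c4.
  rewrite divr_ge0 //; last lra.
  rewrite -(pmulr_lge0 _ (_ : 0 < a / 2)); last lra.
  rewrite mulrBl mulrAC c2E; nra.
have c24 : c2 + c4 <= 1.
  rewrite -(ler_pM2r hb) mulrDl c4E mul1r; nra.
exists c2, (1 - c2 - c4), c4; split; first by split=> //; lra.
by split; [nra|lra].
Qed.

(** When a = -1 the corner (a/2 + b, a/2 + b) sticks out of the half plane
    x + y <= a + b (for the coweight x Lambda_1 + y Lambda_2) by only 1/2, which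
    integral points do not notice. *)
Lemma mem_diamond (a b x y : int) : -1 <= a -> 0 <= b -> 0 <= a + b -> 1 <= x -> 1 <= y ->
  @diamond R a b (to_plane R (Lam1 *~ x + Lam2 *~ y)) <-> (x + y <= a + b) && (x + y *+ 2 <= a + b *+ 2).
Proof.
move=> ha hb hab hx hy.
have plE : to_plane R (Lam1 *~ x + Lam2 *~ y) = ((x + y)%:~R, y%:~R).
  by rewrite !cwE /to_plane /= !intrD !intrM /=; congr pair; field.
rewrite plE diamondP.
have ha' : (-1 : R) <= a%:~R by rewrite -(ler_int R) in ha.
have hb' : (0 : R) <= b%:~R by rewrite -(ler_int R) in hb.
have hab' : (0 : R) <= a%:~R + b%:~R by rewrite -(ler_int R) intrD in hab.
have hx' : (1 : R) <= x%:~R by rewrite -(ler_int R) in hx.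
have hy' : (1 : R) <= y%:~R by rewrite -(ler_int R) in hy.
rewrite !intrD; split.
  move=> [c2 [c3 [c4 [[h2 h3 h4 h5] [ex ey]]]]].
  have sum_le : x%:~R + y%:~R *+ 2 <= a%:~R + b%:~R *+ 2 :> R.
    have h : 0 <= (1 - (c2 + c3 + c4)) * (a%:~R + b%:~R *+ 2) + c3 * b%:~R :> R.
      by rewrite addr_ge0 ?mulr_ge0 ?subr_ge0 //; lra.
    lra.
  have X_lt : x%:~R + y%:~R < a%:~R + b%:~R + 1 :> R.
    have h : 0 <= (1 - (c2 + c3 + c4)) * (a%:~R + b%:~R) :> R.
      by rewrite mulr_ge0 ?subr_ge0.
    have h' : 0 <= c2 * (a%:~R + 1) :> R by rewrite mulr_ge0 //; lra.
    lra.
  apply/andP; split.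
    by rewrite -ltzD1 -(ltr_int R) !intrD.
  by rewrite -(ler_int R) !mulr2n !intrD; move: sum_le; rewrite !mulr2n.
move=> /andP[le1 le2].
have {}le1 : (x + y)%:~R <= (a + b)%:~R :> R by rewrite ler_int.
have {}le2 : (x + y *+ 2)%:~R <= (a + b *+ 2)%:~R :> R by rewrite ler_int.
rewrite !intrD in le1; rewrite !mulr2n !intrD -!mulr2n in le2.
exact: in_quadrilateral.
Qed.

(** For w~_1 and w~_2 the diamond degenerates to a triangle, and the corner to
    be removed is not in Q_++. *)
Lemma lambda_setE (i : nat) (m n : int) (l : coweight) : 1 <= m -> 1 <= n -> (1 <= i <= 8)%N ->
  lambda_set R i m n l <-> exists x y : int, [/\ 1 <= x, 1 <= y, x + y <= bound4_1 i m n,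
    x + y *+ 2 <= bound6 i m n & l = Lam1 *~ x + Lam2 *~ y].
Proof.
move=> hm hn hi.
have le_case (a b N D : int) : -1 <= a -> 0 <= b -> 0 <= a + b -> a + b = N -> a + b *+ 2 = D ->
    Lambda_le R a b l <-> exists x y : int, [/\ 1 <= x, 1 <= y, x + y <= N,
      x + y *+ 2 <= D & l = Lam1 *~ x + Lam2 *~ y].
  move=> ha hb hab <- <-; split.
    move=> [[x /= hx [y /= hy <-]]]; rewrite /preimage /= mem_diamond // => /andP[h1 h2].
    by exists x, y.
  move=> [x [y [hx hy h1 h2 ->]]]; split; first by exists x => //; exists y.
  by rewrite /preimage /= mem_diamond // h1.
have lt_case (a N : int) : 0 <= a -> N = a \/ N = a - 1 ->
    Lambda_lt R a 0 l <-> exists x y : int, [/\ 1 <= x, 1 <= y, x + y <= N,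
      x + y *+ 2 <= a & l = Lam1 *~ x + Lam2 *~ y].
  move=> ha hN; rewrite /Lambda_lt /setD /= (le_case a 0 a a) ?mul0rn ?addr0 //; last lia.
  split=> [[[x [y [hx hy h1 h2 ->]]] _]|[x [y [hx hy h1 h2 ->]]]].
    by exists x, y; split=> //; lia.
  split; first by exists x, y; split => //; lia.
  by rewrite /= !cwE => -[_]; lia.
case: i hi => [//|[|[|[|[|[|[|[|[|//]]]]]]]]] _; rewrite /lambda_set /bound4_1 /bound6.
- by apply: lt_case; lia.
- by apply: lt_case; lia.
- by apply: le_case; lia.
- by apply: le_case; lia.
- by apply: le_case; lia.
- by apply: le_case; lia.
- by apply: le_case; lia.
- by apply: le_case; lia.
Qed.
End Geometry.

(** * Class polynomials *)
Definition class_of (a : affine) : set extended := conj_class (ext_of a).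

Lemma class_ofP a b : class_of a = class_of b <-> class_inv a = class_inv b.
Proof.
rewrite /class_of !conj_class_of; split=> [e|->//].
have : [set ext_of c | c in [set c | class_inv c = class_inv a]] (ext_of a) by exists a.
by rewrite e => -[c <- /ext_of_inj ->].
Qed.

Lemma mem_class_of a b : class_of a (ext_of b) <-> class_inv b = class_inv a.
Proof.
rewrite /class_of conj_class_of; split=> [[c <- /ext_of_inj ->]//|e].
by exists b.
Qed.

Definition has_expansion_class (N D : Z) (e : nat) (O : set extended) : Prop :=
  exists2 r, expansion N D r e & O = class_of r.

Section DegreeClasses.
Variables (R : realType) (i : nat) (m n : int).
Hypotheses (hm : 1 <= m) (hn : 1 <= n) (hi : (1 <= i <= 8)%N).
Let N := Z_of_int (bound4_1 i m n).
Let D := Z_of_int (bound6 i m n).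

Lemma degree2_classesE O : degree2_classes R i m n O <-> has_expansion_class N D 2 O.
Proof.
split=> [[l /(lambda_setE R l hm hn hi)[x [y [hx hy h1 h2 ->]]] <-]|].
  exists (plane_aff (Z_of_int (x + y)) (Z_of_int y) Id).
    constructor 4; split=> //; exists (Z_of_int (x + y)), (Z_of_int y).
    by split=> //; rewrite /N /D; lia.
  rewrite !cwE /class_of /plane_aff -classO_coweightE; congr classO_coweight.
  by congr pair; lia.
move=> [r [[]//|[]//|[]//|[_ [X [Y [-> h1 h2 h3]]]]] ->].
exists (Lam1 *~ int_of_Z (X - Y) + Lam2 *~ int_of_Z Y).
  apply/(lambda_setE R _ hm hn hi); exists (int_of_Z (X - Y)), (int_of_Z Y).
  by split=> //; move: h1 h2 h3; rewrite /N /D; lia.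
rewrite !cwE /class_of /plane_aff -classO_coweightE; congr classO_coweight.
by congr pair; lia.
Qed.

Lemma degree1_classesE O : degree1_classes i m n O <-> has_expansion_class N D 1 O.
Proof.
have hD3 (k : nat) : (k%:Z <= bound6_3 i m n) = (Z.leb (2 * Z.of_nat k + 1) D).
  by case: i hi @D => [//|[|[|[|[|[|[|[|[|//]]]]]]]]] _ /=; mod_lia.
have hD1 (k : nat) : (k%:Z <= bound6_1 i m n) = (Z.leb (2 * Z.of_nat k) D).
  by case: i hi @D => [//|[|[|[|[|[|[|[|[|//]]]]]]]]] _ /=; mod_lia.
split=> [[[[k /= /andP[k1 kN] <-]|[k /= kN <-]]|[k /= /andP[k1 kN] <-]]|].
- exists (rep_refl2 (Z.of_nat k)); last exact: classO4_1E.
  by constructor 2; split=> //; exists (Z.of_nat k); split=> //; rewrite /N; lia.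
- exists (rep_refl1 (2 * Z.of_nat k + 1)); last exact: classO6_3E.
  by constructor 3; split=> //; exists (2 * Z.of_nat k + 1)%ZZ; split=> //; rewrite hD3 in kN; lia.
- exists (rep_refl1 (2 * Z.of_nat k)); last exact: classO6_1E.
  by constructor 3; split=> //; exists (2 * Z.of_nat k)%ZZ; split=> //; rewrite hD1 in kN; lia.
move=> [r [[]//|[_ [k [-> hk]]]|[_ [k [-> hk]]]|[]//] ->].
- left; left; exists (Z.to_nat k); last by rewrite classO4_1E /class_of; congr (conj_class (ext_of (rep_refl2 _))); lia.
  by rewrite /=; move: hk; rewrite /N; lia.
- have [j kj] : exists j, (k = 2 * Z.of_nat j \/ k = 2 * Z.of_nat j + 1)%ZZ.
    by exists (Z.to_nat (k / 2)); mod_lia.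
  case: kj => kj; subst k.
    right; exists j; last exact: classO6_1E.
    by rewrite /= hD1; lia.
  left; right; exists j; last exact: classO6_3E.
  by rewrite /= hD3; lia.
Qed.

Lemma degree0_classE O : O = classO2 <-> has_expansion_class N D 0 O.
Proof.
split=> [->|[r [[-> _]|[]//|[]//|[]//] ->]]; last by rewrite classO2E.
by exists rep_coxeter; [constructor 1|exact: classO2E].
Qed.
End DegreeClasses.

(** The power of q with which a class can occur depends only on the kind of the
    class: translations, reflections, elliptic elements. *)
Definition class_exponent (a : affine) : nat :=
  match (class_inv a).1.1 with 0%N => 2%N | 1%N | 2%N => 1%N | _ => 0%N end.

Lemma expansion_exponent N D r e : expansion N D r e -> e = class_exponent r.
Proof.
case=> [[-> ->]|[-> [k [-> _]]]|[-> [k [-> _]]]|[-> [X [Y [-> _ _ _]]]]] //.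
by rewrite /rep_refl1; case: ifP.
Qed.

Lemma expansion_minimal N D r e : expansion N D r e -> minimal_rep r.
Proof.
case=> [[-> _]|[_ [k [-> h]]]|[_ [k [-> h]]]|[_ [X [Y [-> h _ _]]]]].
- exact: minimal_rep_coxeter.
- by apply: minimal_rep_refl2; lia.
- by apply: minimal_rep_refl1; lia.
- exact: minimal_rep_translation.
Qed.

Lemma In_mem (J : eqType) (x : J) (s : seq J) : List.In x s <-> x \in s.
Proof.
elim: s => [//|y s IH] /=; rewrite inE IH; split=> [[->|->]|/predU1P[->|->]];
  rewrite ?eqxx ?orbT //; [by left|by right].
Qed.

Section ClassPolynomials.
Variables (H : algType laurent) (T : extended -> H).
Hypothesis HT : is_hecke_algebra T.

Lemma minimal_cong r a b : minimal_rep r -> class_inv a = class_inv r -> class_inv b = class_inv r ->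
  alen a = alen r -> alen b = alen r -> cong (Taff T a) (Taff T b).
Proof.
move=> hr ca cb la lb; have [_ /(_ la) ra] := hr a ca; have [_ /(_ lb) rb] := hr b cb.
have := reduces_cong HT ra; have := reduces_cong HT rb.
rewrite /Tsum big_seq1 /= expr0 scale1r => hb ha.
exact: cong_trans ha (cong_sym hb).
Qed.

Definition class_sum (l : seq (affine * nat)) (O : set extended) : laurent :=
  \sum_(p <- l | class_of p.1 == O) q ^+ p.2.

Lemma mem_classes p (l : seq (affine * nat)) : p \in l -> class_of p.1 \in [seq class_of p.1 | p <- l].
Proof. exact: (map_f (fun p => class_of p.1)). Qed.

Lemma class_polynomials_of a l : reduces a l ->
  (forall p, p \in l -> exists r, [/\ minimal_rep r, class_inv p.1 = class_inv r & alen p.1 = alen r]) ->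
  class_polynomials T (ext_of a) (class_sum l).
Proof.
move=> al lmin.
have supp O : class_sum l O != 0 -> O \in [seq class_of p.1 | p <- l].
  apply: contraNT => hO; rewrite /class_sum big1_seq // => p /andP[/eqP pO p_in].
  by move/negP: hO; case; rewrite -pO; exact: mem_classes.
split.
- move=> O /= /supp /mapP[p _ ->]; exists (ext_of p.1) => //.
- apply: sub_finite_set (finite_seq [seq class_of p.1 | p <- l]) => O /=; exact: supp.
move=> x xmin.
have -> : \sum_(O \in conj_classes) class_sum l O *: T (x O) = \sum_(p <- l) q ^+ p.2 *: T (x (class_of p.1)).
  rewrite (@fsum_seq _ _ _ (undup [seq class_of p.1 | p <- l])) ?undup_uniq //.
  - rewrite /class_sum; under eq_bigr do rewrite scaler_suml big_mkcond.
    rewrite exchange_big /=; apply: eq_big_seq => p p_in.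
    rewrite -big_mkcond /= -big_filter; rewrite (_ : [seq _ <- _ | _] = [:: class_of p.1]) ?big_seq1 //.
    rewrite (eq_filter (a2 := pred1 (class_of p.1))); last by move=> O; rewrite /= eq_sym.
    by rewrite filter_pred1_uniq ?undup_uniq // mem_undup; exact: mem_classes.
  - by move=> O; rewrite mem_undup => /mapP[p _ ->]; exists (ext_of p.1).
  - move=> O _; rewrite mem_undup => /negP hO; have /eqP -> : class_sum l O == 0.
      by apply: contra_notT hO => /supp.
    by rewrite scale0r.
apply: cong_trans (reduces_cong HT al) _; rewrite /Tsum.
elim: l lmin {al supp} => [|p l IH] lmin; first by rewrite !big_nil; exact: cong_refl.
rewrite !big_cons; apply: congD; last by apply: IH => p' p'l; apply: lmin; rewrite inE p'l orbT.
apply: congZ; have [r [rmin pr lr]] := lmin p (mem_head _ _).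
have [xO xle] := xmin (class_of p.1) ltac:(by exists (ext_of p.1)).
have [b xb] := ext_of_surj (x (class_of p.1)).
rewrite xb -/(Taff T b); rewrite xb in xO xle.
have br : class_inv b = class_inv r by rewrite -pr; apply/mem_class_of.
apply: (minimal_cong rmin) => //.
have [rb _] := rmin b br; have := xle (ext_of p.1) ltac:(by apply/mem_class_of).
rewrite !len_of; have := alen_ge0 b; have := alen_ge0 p.1; have lr' : alen p.1 = alen r := lr; lia.
Qed.

(** For a common choice of elements of minimal length, the difference of the two
    expansions is a linear relation between the T_O. *)
Lemma class_polynomials_unique w f f' :
  class_polynomials T w f -> class_polynomials T w f' -> f = f'.
Proof.
move=> [f1 f2 f3] [f1' f2' f3'].
have [x xmin] : exists x : set extended -> extended, forall O, conj_classes O -> min_length O (x O).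
  have : forall O, exists y, conj_classes O -> min_length O y.
    move=> O; case: (pselect (conj_classes O)) => [[e _ <-]|]; last by exists 1%g.
    have : exists k, `[< exists2 y, conj_class e y & len y = k >].
      by exists (len e); apply/asboolP; exists e => //; exists 1%g => //; rewrite conjg1.
    move=> /ex_minnP[k /asboolP[y ey yk] kmin]; exists y => _; split=> // y' ey'.
    by rewrite yk; apply: kmin; apply/asboolP; exists y'.
  by move=> /choice[x hx]; exists x.
have [s sE] := (finite_seqP _).1 f2; have [s' sE'] := (finite_seqP _).1 f2'.
pose S := undup (s ++ s').
have inS O : f O != 0 \/ f' O != 0 -> O \in S.
  rewrite mem_undup mem_cat => -[h|h].
    by have : [set` s] O by [rewrite -sE]; move=> /= ->.
  by have : [set` s'] O by [rewrite -sE']; move=> /= ->; rewrite orbT.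
have Sconj O : O \in S -> conj_classes O.
  rewrite mem_undup mem_cat => /orP[h|h].
    by apply: f1; have : [set` s] O by [exact: h]; rewrite -sE.
  by apply: f1'; have : [set` s'] O by [exact: h]; rewrite -sE'.
have sumE g : (forall O, g O != 0 -> O \in S) ->
    \sum_(O \in conj_classes) g O *: T (x O) = \sum_(O <- S) g O *: T (x O).
  move=> gS; apply: fsum_seq; rewrite ?undup_uniq // => O _ OS.
  by have /eqP-> : g O == 0; [apply: contraNT OS; exact: gS|rewrite scale0r].
have := cong_trans (cong_sym (f3 x xmin)) (f3' x xmin).
rewrite !sumE; [|by move=> O h; apply: inS; right|by move=> O h; apply: inS; left].
rewrite /cong -sumrB => comm.
have [y yx] : exists y : set extended -> affine, forall O, ext_of (y O) = x O.
  have /choice[z hz] := ext_of_surj.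
  by exists (fun O => z (x O)) => O; rewrite -hz.
have yO O : O \in S -> class_of (y O) = O.
  move=> /Sconj OC; have [+ _] := xmin O OC; rewrite -yx; case: OC => e _ <-.
  have [a ->] := ext_of_surj e; move=> /mem_class_of h; exact/class_ofP.
have yinj : {in S &, injective y} by move=> O O' hO hO' e; rewrite -(yO O) // -(yO O') // e.
have zero : {in map y S, forall a, f (class_of a) - f' (class_of a) = 0}.
  apply: (cocenter_independent HT).
  - by rewrite map_inj_in_uniq ?undup_uniq.
  - move=> a b /mapP[O OS ->] /mapP[O' OS' ->] e; congr y.
    by rewrite -(yO O) // -(yO O') //; apply/class_ofP.
  - rewrite big_map; move: comm; congr commutator_submodule.
    by apply: eq_big_seq => O OS; rewrite /Taff yx yO // scalerBl.
apply/funext => O; have [OS|OS] := boolP (O \in S).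
  by apply/eqP; rewrite -subr_eq0; apply/eqP; rewrite -(yO O OS); apply: zero; rewrite map_f.
have /eqP-> : f O == 0 by apply: contraNT OS => h; apply: inS; left.
by apply/esym/eqP; apply: contraNT OS => h; apply: inS; right.
Qed.
End ClassPolynomials.

(** The polynomial is k X^e, where k is the number of occurrences of O. *)
Lemma class_sum_degree l O e : (forall p, p \in l -> class_of p.1 = O -> p.2 = e) ->
  has_degree (class_sum l O) (if has (fun p => class_of p.1 == O) l then Some e else None).
Proof.
move=> he; pose k := count (fun p : affine * nat => class_of p.1 == O) l.
exists ((k%:R : int) *: 'X^e); split.
  rewrite /class_sum map_polyZ map_polyXn hornerZ hornerXn -/q big_seq_cond.
  rewrite (eq_bigr (fun=> q ^+ e)); last by move=> p /andP[p_in /eqP pO]; rewrite (he p).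
  by rewrite -big_seq_cond big_const_seq iter_addr_0 -/k /= rmorph_nat mulr_natl.
rewrite scale_poly_eq0 -(size_poly_eq0 'X^e) size_polyXn orbF pnatr_eq0 has_count -/k.
case: (posnP k) => // k0; congr Some.
by rewrite size_scale ?size_polyXn // pnatr_eq0 -lt0n.
Qed.

Unset Implicit Arguments.

Theorem proposition3p17 (R : realType) (H : algType laurent)
    (T : extended -> H) (HT : is_hecke_algebra T)
    (m n : int) (hm : 1 <= m) (hn : 1 <= n)
    (i : nat) (hi : (1 <= i <= 8)%N)
    (w : extended) (hw : classO2 w) (hwi : w \in w_tilde i m n) :
  exists f : set extended -> laurent,
    unique (class_polynomials T w) f /\
    forall O : set extended, conj_classes O ->
      has_degree (f O) (expected_degree R i m n O).
Proof.
have [a wa [P [[l al lP] Pr rP]]] := expands_w_tilde hm hn hi hwi; subst w.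
have lmem p : p \in l <-> P p.1 p.2.
  by rewrite -lP -In_mem; case: p.
have pcls : class_polynomials T (ext_of a) (class_sum l).
  apply: (class_polynomials_of HT al) => p /lmem /Pr[r [hr pr lr]].
  by exists r; split => //; exact: expansion_minimal hr.
have exponent p : p \in l -> p.2 = class_exponent p.1.
  move=> /lmem /Pr[r [/expansion_exponent -> pr _]].
  by rewrite /class_exponent pr.
have classes e O : has_expansion_class (Z_of_int (bound4_1 i m n)) (Z_of_int (bound6 i m n)) e O <->
    exists2 p, p \in l & class_of p.1 = O /\ p.2 = e.
  split=> [[r hr ->]|[p /lmem /Pr[r [hr pr _]] [<- pe]]].
    have [b Pb br] := rP r e hr; exists (b, e); first exact/lmem.
    by split=> //; apply/class_ofP.
  by exists r; [rewrite -pe|apply/class_ofP].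
exists (class_sum l); split.
  by split=> // f'; exact: class_polynomials_unique HT _ _ _ pcls.
move=> O _.
have same p p' : p \in l -> p' \in l -> class_of p.1 = class_of p'.1 -> p.2 = p'.2.
  by move=> /exponent-> /exponent-> /class_ofP; rewrite /class_exponent => ->.
have deg e : (exists2 p, p \in l & class_of p.1 = O /\ p.2 = e) -> has_degree (class_sum l O) (Some e).
  move=> [p p_in [pO <-]]; have := @class_sum_degree l O p.2.
  have -> : has (fun p' => class_of p'.1 == O) l by apply/hasP; exists p => //; apply/eqP.
  by apply=> p' p'l p'O; apply: same => //; rewrite pO.
rewrite /expected_degree; case: ifPn => [/set_mem/(degree2_classesE R hm hn hi)/classes/deg //|/negP n2].
case: ifPn => [/set_mem/(degree1_classesE hm hn hi)/classes/deg //|/negP n1].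
case: ifPn => [/eqP/(degree0_classE i m n)/classes/deg //|/eqP n0].
have none p : p \in l -> class_of p.1 <> O.
  move=> p_in pO; have hp e : p.2 = e -> exists2 p', p' \in l & class_of p'.1 = O /\ p'.2 = e by exists p.
  have [e0|[e1|e2]] : p.2 = 0%N \/ p.2 = 1%N \/ p.2 = 2%N.
    by rewrite (exponent p p_in) /class_exponent; case: (class_inv p.1).1.1 => [|[|[|k]]]; auto.
  - by apply/n0/(degree0_classE i m n)/classes/hp.
  - by apply/n1/mem_set/(degree1_classesE hm hn hi)/classes/hp.
  - by apply/n2/mem_set/(degree2_classesE R hm hn hi)/classes/hp.
have := @class_sum_degree l O 0 (fun p p_in pO => False_ind _ (none p p_in pO)).
by rewrite (_ : has _ _ = false) //; apply/hasP => -[p p_in /eqP]; exact: none.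
Qed.
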